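(* Let $\Omega\subseteq\mathbb{R}^N$ be an open set. Denote by $\mathfrak{S}_{\mathrm{ess}}(\Omega)$ the essential spectrum of the Dirichlet-Laplacian on $\Omega$, and by $\mathfrak{S}_{\mathrm{ess},2}(\Omega)$ the variational essential spectrum of the Dirichlet $p$-Laplacian on $\Omega$ for $p=2$. Then \[ \mathfrak{S}_{\mathrm{ess},2}(\Omega)=\mathfrak{S}_{\mathrm{ess}}(\Omega). \]
   Context: $B_R=\{x\in\mathbb{R}^N: |x|<R\}$. $W^{1,2}_0(\Omega)$ is the closure of $C^\infty_0(\Omega)$ in $W^{1,2}(\Omega)$, with norm $\|\varphi\|_{W^{1,2}(\Omega)}=(\int_\Omega|\varphi|^2\,dx+\int_\Omega|\nabla\varphi|^2\,dx)^{1/2}$; $W^{-1,2}(\Omega)$ is its topological dual with the dual norm. For $u\in W^{1,2}_0(\Omega)$, $-\Delta u\in W^{-1,2}(\Omega)$ is the functional $\varphi\mapsto\int_\Omega\langle\nabla u,\nabla\varphi\rangle\,dx$, and $u$ is identified with the functional $\varphi\mapsto\int_\Omega u\,\varphi\,dx$. The Dirichlet-Laplacian on $\Omega$ is the self-adjoint operator on $L^2(\Omega)$ associated with the quadratic form $\varphi\mapsto\int_\Omega|\nabla\varphi|^2\,dx$, $\varphi\in W^{1,2}_0(\Omega)$. Its essential spectrum is characterized by the classical Weyl criterion (which may be taken as the definition): $\lambda\in\mathfrak{S}_{\mathrm{ess}}(\Omega)$ if and only if there exists $\{u_n\}_{n\in\mathbb{N}}\subseteq L^2(\Omega)$ such that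 (W1) $\|u_n\|_{L^2(\Omega)}=1$ for every $n$; (W2) $u_n\rightharpoonup0$ weakly in $L^2(\Omega)$; (W3) $u_n\in W^{1,2}_0(\Omega)$ and $-\Delta u_n\in L^2(\Omega)$ for every $n$; (W4) $\lim_{n\to\infty}\|-\Delta u_n-\lambda u_n\|_{L^2(\Omega)}=0$. $\mathfrak{S}_{\mathrm{ess},2}(\Omega)$ is the set of all $\lambda\in\mathbb{R}$ for which there exists a singular constrained Palais-Smale sequence at the level $\lambda$, i.e. a sequence $\{u_n\}_{n\in\mathbb{N}}\subseteq W^{1,2}_0(\Omega)$ such that: (i) $\|u_n\|_{L^2(\Omega)}=1$ for every $n$; (ii) $\lim_{n\to\infty}\int_\Omega|\nabla u_n|^2\,dx=\lambda$; (iii) $\lim_{n\to\infty}\|-\Delta u_n-\lambda u_n\|_{W^{-1,2}(\Omega)}=0$; and (singularity) $\lim_{n\to\infty}\|u_n\|_{L^2(\Omega\cap B_R)}=0$ for every $R>0$. *)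

(* Defs.v *)
From HB Require Import structures.
From mathcomp Require Import all_boot all_order all_algebra.
From mathcomp Require Import all_classical all_reals all_analysis.

Set Implicit Arguments.
Unset Strict Implicit.
Unset Printing Implicit Defensive.

Import Order.TTheory GRing.Theory Num.Theory.
Import numFieldNormedType.Exports.

Local Open Scope classical_set_scope.
Local Open Scope ring_scope.

(* ['rV[R]_n] carries the topology of the library (that of the sup norm) and,
   like the library's [n.-tuple T], the sigma-algebra generated by the
   coordinates; [measurable_rV_borel] below shows it is the Borel one. *)
Section measurable_rV.
Context {R : realType}.
Variable n : nat.

Let coord : 'I_n -> 'rV[R]_n -> R := fun i v => v ord0 i.

Let rV_set0 : g_sigma_preimage coord set0.
Proof. exact: sigma_algebra0. Qed.

Let rV_setC A : g_sigma_preimage coord A -> g_sigma_preimage coord (~` A).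
Proof. exact: sigma_algebraC. Qed.

Let rV_bigcup (F : (set 'rV[R]_n)^nat) :
  (forall i, g_sigma_preimage coord (F i)) ->
  g_sigma_preimage coord (\bigcup_i (F i)).
Proof. exact: sigma_algebra_bigcup. Qed.

HB.instance Definition _ := @isMeasurable.Build default_measure_display
  'rV[R]_n (g_sigma_preimage coord) rV_set0 rV_setC rV_bigcup.

End measurable_rV.

Lemma measurable_coord {R : realType} n (i : 'I_n) :
  measurable_fun [set: 'rV[R]_n] (fun v : 'rV[R]_n => v ord0 i).
Proof.
move=> _ Y mY; rewrite setTI; apply: sub_sigma_algebra => /=.
rewrite -bigcup_seq/=; exists i => /=; first by rewrite mem_index_enum.
by exists Y => //; rewrite setTI.
Qed.

Lemma measurable_fun_rVP d (T : measurableType d) {R : realType} n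
    (f : T -> 'rV[R]_n) :
  (forall i, measurable_fun [set: T] (fun t => f t ord0 i)) ->
  measurable_fun [set: T] f.
Proof.
move=> mf _ A mA; rewrite setTI.
pose C := [set B : set 'rV[R]_n | measurable (f @^-1` B)].
suff : g_sigma_preimage (fun (i : 'I_n) (v : 'rV[R]_n) => v ord0 i) `<=` C.
  by apply.
apply: smallest_sub.
  split; rewrite /C /=.
  - by rewrite preimage_set0.
  - by move=> B mB; rewrite setTD preimage_setC; exact: measurableC.
  - by move=> F mF; rewrite preimage_bigcup; exact: bigcupT_measurable.
rewrite -bigcup_seq => B [i _ [Y mY <-]]; rewrite /C /=.
have := mf i measurableT Y mY.
by rewrite !setTI.
Qed.

Definition rV_cons {R : realType} n (p : R * 'rV[R]_n) : 'rV[R]_n.+1 :=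
  \row_(i < n.+1) oapp (fun j => p.2 ord0 j) p.1 (unlift ord0 i).

Lemma measurable_rV_cons {R : realType} n :
  measurable_fun [set: R * 'rV[R]_n] (@rV_cons R n).
Proof.
apply: measurable_fun_rVP => i; rewrite /rV_cons.
case: (unliftP ord0 i) => [j ->|->].
  rewrite (_ : (fun _ => _) = (fun v : 'rV[R]_n => v ord0 j) \o snd).
    exact: measurableT_comp (measurable_coord j) measurable_snd.
  by apply/funext => p /=; rewrite mxE liftK.
rewrite (_ : (fun _ => _) = fst); first exact: measurable_fst.
by apply/funext => p /=; rewrite mxE unlift_none.
Qed.

Lemma measurable_rV_behead {R : realType} n :
  measurable_fun [set: 'rV[R]_n.+1]
    (fun v : 'rV[R]_n.+1 => (v ord0 ord0, \row_(j < n) v ord0 (lift ord0 j))).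
Proof.
apply/measurable_fun_pairP; split; first exact: measurable_coord.
apply: measurable_fun_rVP => j /=.
under eq_fun do rewrite mxE.
exact: measurable_coord.
Qed.


(* The image of (lebesgue_measure \x mu) under R * R^n ~ R^(n+1); its
   sigma-finiteness, needed to iterate, is reproved here because the canonical
   instance on [_ \x _] is only the one for subprobabilities. *)
Section lebesgueS.
Context {R : realType} (n : nat).
Variable mu : {sigma_finite_measure set 'rV[R]_n -> \bar R}.

Definition lebesgueS : set 'rV[R]_n.+1 -> \bar R :=
  fun A => (@lebesgue_measure R \x mu)%E (@rV_cons R n @^-1` A).

Let mcons A : measurable A -> measurable (@rV_cons R n @^-1` A).
Proof. by move=> mA; rewrite -[X in measurable X]setTI; exact: measurable_rV_cons. Qed.

Let lebesgueS0 : lebesgueS set0 = 0%E.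
Proof. by rewrite /lebesgueS preimage_set0 measure0. Qed.

Let lebesgueS_ge0 A : (0 <= lebesgueS A)%E.
Proof. exact: measure_ge0. Qed.

Let lebesgueS_sigma_additive : semi_sigma_additive lebesgueS.
Proof.
move=> F mF tF mUF; rewrite /lebesgueS preimage_bigcup.
apply: measure_semi_sigma_additive.
- by move=> k; exact: mcons.
- apply/trivIsetP => /= i j _ _ ij; rewrite -preimage_setI.
  by move/trivIsetP : tF => /(_ _ _ _ _ ij) ->//; rewrite preimage_set0.
- by rewrite -preimage_bigcup; exact: mcons.
Qed.

HB.instance Definition _ := isMeasure.Build _ _ _ lebesgueS
  lebesgueS0 lebesgueS_ge0 lebesgueS_sigma_additive.

Let lebesgueS_sigma_finite : sigma_finite setT lebesgueS.
Proof.
pose uncons (v : 'rV[R]_n.+1) : R * 'rV[R]_n :=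
  (v ord0 ord0, \row_(j < n) v ord0 (lift ord0 j)).
have unconsK : cancel (@rV_cons R n) uncons.
  move=> [x v]; rewrite /uncons /rV_cons; congr pair.
    by rewrite mxE unlift_none.
  by apply/rowP => j; rewrite !mxE liftK.
have /sigma_finiteP[F [TF ndF Foo]] := sigma_finiteT (@lebesgue_measure R).
have /sigma_finiteP[G [TG ndG Goo]] := sigma_finiteT mu.
exists (fun k => uncons @^-1` (F k `*` G k)).
  rewrite -preimage_bigcup (_ : \bigcup_k _ = setT) ?preimage_setT//.
  rewrite -subTset => -[x y] _.
  have [k _ Fkx] : (\bigcup_k F k) x by rewrite -TF.
  have [l _ Gly] : (\bigcup_k G k) y by rewrite -TG.
  exists (maxn k l) => //; split.
  - by move: x Fkx; exact/subsetPset/ndF/leq_maxl.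
  - by move: y Gly; exact/subsetPset/ndG/leq_maxr.
move=> k; have [mF Fk] := Foo k; have [mG Gk] := Goo k; split.
  rewrite -[X in measurable X]setTI.
  by apply: (@measurable_rV_behead R n) => //; exact: measurableX.
rewrite /lebesgueS -comp_preimage (_ : _ \o _ = id); last exact/funext.
by rewrite preimage_id product_measure1E// lte_mul_pinfty// ge0_fin_numE.
Qed.

HB.instance Definition _ := Measure_isSigmaFinite.Build _ _ _ lebesgueS
  lebesgueS_sigma_finite.

End lebesgueS.

Fixpoint lebesgue_rV (R : realType) (n : nat) :
    {sigma_finite_measure set 'rV[R]_n -> \bar R} :=
  match n return {sigma_finite_measure set 'rV[R]_n -> \bar R} with
  | 0 => \d_(0 : 'rV[R]_0)
  | m.+1 => lebesgueS (lebesgue_rV R m)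
  end.

Lemma lebesgue_rV_box {R : realType} n (A : 'I_n -> set R) :
  (forall i, measurable (A i)) ->
  lebesgue_rV R n [set v | forall i, A i (v ord0 i)] =
  (\prod_(i < n) lebesgue_measure (A i))%E.
Proof.
elim: n A => [A _|n IHn A mA].
  rewrite big_ord0 /= diracE mem_set//= => -[]//.
rewrite big_ord_recl -IHn//.
have mB : measurable [set v : 'rV[R]_n | forall i, A (lift ord0 i) (v ord0 i)].
  rewrite (_ : [set v | _] = \big[setI/setT]_(i < n)
      ((fun v : 'rV[R]_n => v ord0 i) @^-1` A (lift ord0 i))).
    apply: bigsetI_measurable => i _; rewrite -[X in measurable X]setTI.
    exact: measurable_coord.
  rewrite -bigcap_seq; apply/seteqP; split=> v /= Av i; first by move=> _.
  by apply: Av => /=; rewrite mem_index_enum.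
have := product_measure1E lebesgue_measure (lebesgue_rV R n) (mA ord0) mB.
move=> /= <-; rewrite /lebesgueS; congr product_measure1.
apply/seteqP; split=> -[x v] /=.
  move=> Av; split; first by have := Av ord0; rewrite mxE unlift_none.
  by move=> i; have := Av (lift ord0 i); rewrite mxE liftK.
move=> [Ax Av] i; rewrite mxE.
by case: (unliftP ord0 i) => [j ->|->]/=.
Qed.

Lemma open_measurable_rV {R : realType} n (U : set 'rV[R]_n) :
  open U -> measurable U.
Proof.
move=> oU.
pose F (p : 'rV[rat]_n * rat) : set 'rV[R]_n :=
  let V := [set v : 'rV[R]_n | forall i, `|ratr (p.1 ord0 i) - v ord0 i| < ratr p.2] in
  if `[< V `<=` U >] then V else set0.
have mF p : measurable (F p).
  rewrite /F; case: ifP => // _.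
  rewrite (_ : [set v | _] = \big[setI/setT]_(i < n)
      ((fun v : 'rV[R]_n => v ord0 i) @^-1` [set x | `|ratr (p.1 ord0 i) - x| < ratr p.2])).
    apply: bigsetI_measurable => i _; rewrite -[X in measurable X]setTI.
    apply: measurable_coord => //.
    rewrite (_ : [set x | _] =
      `]ratr (p.1 ord0 i) - ratr p.2, ratr (p.1 ord0 i) + ratr p.2[%classic) //.
    by apply/seteqP; split=> x /=; rewrite in_itv/= ltr_distlC.
  rewrite -bigcap_seq; apply/seteqP; split=> v /= Av i; first by move=> _; exact: Av.
  by apply: Av => /=; rewrite mem_index_enum.
rewrite (_ : U = \bigcup_p F p).
  apply: countable_bigcupT_measurable => //.
apply/seteqP; split=> [v Uv|v [p _]]; last first.
  by rewrite /F; case: ifP => // /asboolP; exact.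
have /nbhs_ballP[e /= e0 veU] : nbhs v U by exact: open_nbhs_nbhs.
have e2 : 0 < e / 2 by rewrite divr_gt0.
have [q /andP[q0 qe]] : exists q : rat, (0 < ratr q :> R) && (ratr q < e / 2).
  have [q] := rat_in_itvoo e2; rewrite in_itv /= => qe.
  by exists q.
have /choice[f fP] (i : 'I_n) : exists r : rat, `|ratr r - v ord0 i| < ratr q.
  have : v ord0 i - ratr q < v ord0 i + ratr q.
    by rewrite ltrBlDr -addrA ltrDl addr_gt0.
  move=> /rat_in_itvoo[r]; rewrite in_itv/= => /andP[r1 r2]; exists r.
  by rewrite ltr_distl r1 r2.
exists (\row_i f i, q) => //.
set V := [set w : 'rV[R]_n | forall i, `|ratr ((\row_i f i) ord0 i) - w ord0 i| < ratr q].
have VU : V `<=` U.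
  move=> w Vw; apply: veU; split=> // i j; rewrite ord1 -ball_normE/=.
  have -> : v ord0 j - w ord0 j =
      (v ord0 j - ratr (f j)) + (ratr (f j) - w ord0 j) by rewrite addrA subrK.
  rewrite (le_lt_trans (ler_normD _ _))// [ltRHS]splitr ltrD//.
    by rewrite distrC (lt_trans (fP j)).
  by have := Vw j; rewrite mxE => /lt_trans; exact.
by rewrite /F /= asboolT//= => i; rewrite mxE.
Qed.

Lemma measurable_rV_borel {R : realType} n :
  @measurable _ 'rV[R]_n = <<s [set U : set 'rV[R]_n | open U] >>.
Proof.
apply/seteqP; split; last first.
  apply: smallest_sub; first exact: sigma_algebra_measurable.
  exact: open_measurable_rV.
apply: smallest_sub; first exact: smallest_sigma_algebra.
rewrite -bigcup_seq => B [i _ [Y mY <-]]; rewrite setTI.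
pose S := <<s [set U : set 'rV[R]_n | open U] >>.
pose C := [set D : set R | S ((fun v : 'rV[R]_n => v ord0 i) @^-1` D)].
suff : @measurable _ (measurableTypeR R) `<=` C by apply.
rewrite measurable_realfun.RGenOpens.measurableE; apply: smallest_sub.
  split; rewrite /C /=.
  - by rewrite preimage_set0; exact: sigma_algebra0.
  - by move=> D SD; rewrite setTD preimage_setC; exact: sigma_algebraC.
  - by move=> F SF; rewrite preimage_bigcup; exact: sigma_algebra_bigcup.
move=> _ [x [y ->]]; apply: sub_sigma_algebra => /=.
apply: open_comp; last exact: interval_open.
by move=> v _; exact: coord_continuous.
Qed.

Section spectra.
Context {R : realType} {N : nat}.
Implicit Types (Omega : set 'rV[R]_N) (u f g phi : 'rV[R]_N -> R) (lambda : R).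

Local Notation leb := (lebesgue_rV R N).

Definition enorm (x : 'rV[R]_N) : R :=
  Num.sqrt (\sum_(i < N) x ord0 i ^+ 2).

(* The balls of the library are those of the sup norm. *)
Definition eball (r : R) : set 'rV[R]_N := [set x | enorm x < r].

Definition basis_rV (i : 'I_N) : 'rV[R]_N := delta_mx ord0 i.

Definition partial (i : 'I_N) f : 'rV[R]_N -> R := fun x => 'D_(basis_rV i) f x.

Definition smooth f : Prop := forall s : seq 'I_N,
  continuous (foldr partial f s) /\
  (forall i x, derivable (foldr partial f s) x (basis_rV i)).

Definition test_function Omega phi : Prop :=
  [/\ smooth phi, compact (closure [set x | phi x != 0])
    & closure [set x | phi x != 0] `<=` Omega].

(* Elements of L^2(Omega) are represented by functions on the whole space whose
   values outside Omega are irrelevant; everything below is invariant under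
   modification on a null set. *)
Definition L2 Omega u : Prop := (u \_ Omega) \in Lfun leb 2%:E.

Definition L2norm Omega u : R :=
  fine ('N[leb]_(2%:E)[EFin \o (u \_ Omega)])%E.

Definition L2dot Omega u v : R := \int[leb]_(x in Omega) (u x * v x).

Definition weak_partial Omega (i : 'I_N) u g : Prop :=
  forall phi, test_function Omega phi ->
    L2dot Omega u (partial i phi) = - L2dot Omega g phi.

Definition W12 Omega u : Prop :=
  L2 Omega u /\ forall i, exists2 g, L2 Omega g & weak_partial Omega i u g.

(* Weak derivatives are unique up to null sets, so the choice is immaterial. *)
Definition wgrad Omega u (i : 'I_N) : 'rV[R]_N -> R :=
  xget (cst 0) [set g | L2 Omega g /\ weak_partial Omega i u g].

Definition dirichlet_form Omega u v : R :=
  \int[leb]_(x in Omega) (\sum_(i < N) wgrad Omega u i x * wgrad Omega v i x).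

Definition W12norm Omega u : R :=
  Num.sqrt (\int[leb]_(x in Omega) (u x ^+ 2) + dirichlet_form Omega u u).

Definition W012 Omega u : Prop :=
  W12 Omega u /\ forall e : R, 0 < e ->
    exists2 phi, test_function Omega phi & W12norm Omega (u \- phi) < e.

(* Elements of W^{-1,2}(Omega), seen as functionals on representatives; only
   their values on W^{1,2}_0(Omega) matter. *)
Definition functional := ('rV[R]_N -> R) -> R.

Definition neg_laplacian Omega u : functional := dirichlet_form Omega u.

Definition dual_norm Omega (T : functional) : \bar R :=
  ereal_sup [set `|T phi|%:E | phi in
    [set phi | W012 Omega phi /\ W12norm Omega phi <= 1]].

(* The functional T belongs to L^2(Omega), where it is f. *)
Definition represented_by Omega (T : functional) f : Prop :=
  L2 Omega f /\ forall phi, W012 Omega phi -> T phi = L2dot Omega f phi.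

Definition weakly_null Omega (u : nat -> 'rV[R]_N -> R) : Prop :=
  forall v, L2 Omega v -> (fun n => L2dot Omega (u n) v) @ \oo --> (0 : R).

(* [f n] is the element -Delta u_n of L^2(Omega). *)
Definition weyl_sequence Omega lambda (u : nat -> 'rV[R]_N -> R) : Prop :=
  [/\ forall n, L2 Omega (u n) /\ L2norm Omega (u n) = 1,
      weakly_null Omega u,
      forall n, W012 Omega (u n)
    & exists f : nat -> 'rV[R]_N -> R,
        (forall n, represented_by Omega (neg_laplacian Omega (u n)) (f n)) /\
        (fun n => L2norm Omega (fun x => f n x - lambda * u n x)) @ \oo -->
          (0 : R)].

Definition ess_spectrum Omega : set R :=
  [set lambda | exists u : nat -> 'rV[R]_N -> R, weyl_sequence Omega lambda u].

Definition palais_smale_sequence Omega lambda (u : nat -> 'rV[R]_N -> R) : Prop :=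
  [/\ forall n, W012 Omega (u n),
      forall n, L2norm Omega (u n) = 1,
      (fun n => dirichlet_form Omega (u n) (u n)) @ \oo --> lambda
    & (fun n => dual_norm Omega (fun phi =>
        neg_laplacian Omega (u n) phi - lambda * L2dot Omega (u n) phi))
        @ \oo --> 0%E].

Definition singular_sequence Omega (u : nat -> 'rV[R]_N -> R) : Prop :=
  forall r : R, 0 < r ->
    (fun n => L2norm (Omega `&` eball r) (u n)) @ \oo --> (0 : R).

(* The variational essential spectrum of the Dirichlet p-Laplacian for p = 2. *)
Definition vess_spectrum2 Omega : set R :=
  [set lambda | exists2 u : nat -> 'rV[R]_N -> R,
    palais_smale_sequence Omega lambda u & singular_sequence Omega u].

End spectra.

(* Main.v *)
Require Import Defs.
From HB Require Import structures.
From mathcomp Require Import all_boot all_order all_algebra.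
From mathcomp Require Import all_classical all_reals all_analysis.
From mathcomp Require Import measurable_realfun ring lra.

(** A Weyl sequence is a Palais-Smale sequence because, by Cauchy-Schwarz, the
    dual norm of [- Delta u - lambda u] is at most its L^2 norm. It is singular
    because a weakly null sequence bounded in W^{1,2}_0 tends to 0 in L^2 of
    every ball: cover the ball by small cubes of side [h], where Poincare's
    inequality bounds the L^2 norm squared by [h ^ 2] times the energy plus
    finitely many squared mean values.

    Conversely, let [u_n] be singular Palais-Smale. Riesz's theorem in W^{1,2}_0
    gives [v_n] with [- Delta v_n + v_n = (1 + lambda) u_n]. The distance from
    [v_n] to [u_n] in W^{1,2} is at most the dual norm of
    [- Delta u_n - lambda u_n], and
    [- Delta v_n - lambda v_n = (1 + lambda) (u_n - v_n)] lies in L^2 and tends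
    to 0, so the normalised [v_n] form a Weyl sequence; they are weakly null
    because a bounded singular sequence is.

    Linearity of the Dirichlet form and completeness of W^{1,2}_0 require the
    weak derivatives to be unique; this follows by testing against smooth bumps
    increasing to the indicators of open boxes. *)

Set Implicit Arguments.
Unset Strict Implicit.
Unset Printing Implicit Defensive.

Import Order.TTheory GRing.Theory Num.Theory.
Import numFieldNormedType.Exports.

Local Open Scope classical_set_scope.
Local Open Scope ring_scope.

(** * Semi-inner products *)

(** Everything is done with representatives: functions are not identified when they agree almost
    everywhere, and [wgrad] is an arbitrary choice, so the [wgrad] of a sum is not the sum of the
    [wgrad]s. Only pairings against L^2 functions are linear. Hence the Hilbert space theory below
    is stated for a possibly degenerate form [B] on a predicate [S].

    The two definitions measure the residual - Delta u - lambda u differently: a Palais-Smale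
    sequence controls it as a functional, a Weyl sequence needs it in L^2. Adding u to both sides of
    - Delta u ~ lambda u gives a coercive operator on the left, and solving that equation exactly,
    with the L^2 right-hand side (1 + lambda) u_n, gives a nearby function whose Laplacian lies in
    L^2.

    As Omega is an arbitrary open set, nothing is known about its boundary. Poincare's inequality is
    therefore applied to test functions extended by zero, on cubes that may leave Omega, and reaches
    W^{1,2}_0 by density. The mean values on the cubes are pairings with indicators, to which weak
    convergence applies directly, without extraction of a subsequence. *)

Lemma discriminant_le (R : realType) (a b x : R) : 0 <= b ->
  (forall t, 0 <= a + 2 * t * x + t ^+ 2 * b) -> x ^+ 2 <= a * b.
Proof.
move=> b0 H; have [b1|b1] := eqVneq b 0.
  rewrite b1 mulr0; suff -> : x = 0 by rewrite expr0n.
  apply/eqP/negPn/negP => x0.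
  (* For [b = 0] the polynomial is affine in [t], and this [t] gives it the value -1. *)
  have := H (- (a + 1) / (2 * x)); rewrite b1 mulr0 addr0.
  have -> : a + 2 * (- (a + 1) / (2 * x)) * x = -1 by field.
  by rewrite oppr_ge0 ler10.
(* The minimiser of the polynomial. *)
have := H (- x / b).
have -> : a + 2 * (- x / b) * x + (- x / b) ^+ 2 * b = a - x ^+ 2 / b by field.
by rewrite subr_ge0 ler_pdivrMr// lt_neqAle eq_sym b1.
Qed.

Section semi_inner.
Context {R : realType} {V : lmodType R}.

(** [V] will be the type of all functions, so the axioms bind only on [S]. [B] may vanish on nonzero
    vectors, since functions that are null almost everywhere are not quotiented out. *)
Record semi_inner (S : V -> Prop) (B : V -> V -> R) : Prop := SemiInner {
  semi_inner0 : S 0 ;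
  semi_innerD : forall u v, S u -> S v -> S (u + v) ;
  semi_innerZ : forall a u, S u -> S (a *: u) ;
  semi_inner_sym : forall u v, S u -> S v -> B u v = B v u ;
  semi_innerDl : forall u v w, S u -> S v -> S w ->
    B (u + v) w = B u w + B v w ;
  semi_innerZl : forall a u v, S u -> S v -> B (a *: u) v = a * B u v ;
  semi_inner_ge0 : forall u, S u -> 0 <= B u u }.

Definition semi_norm (B : V -> V -> R) (u : V) : R := Num.sqrt (B u u).

(** The limit is existential because [B] determines it only up to null vectors. *)
Definition semi_complete (S : V -> Prop) (B : V -> V -> R) : Prop :=
  forall u : nat -> V, (forall n, S (u n)) ->
  (forall e, 0 < e -> exists k, forall m n, (k <= m)%N -> (k <= n)%N ->
     semi_norm B (u m - u n) < e) ->
  exists2 l, S l & semi_norm B (u n - l) @[n --> \oo] --> (0 : R).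

Context (S : V -> Prop) (B : V -> V -> R) (SB : semi_inner S B).

Lemma semi_innerN u : S u -> S (- u).
Proof. by move=> Su; rewrite -scaleN1r; exact: (semi_innerZ SB). Qed.

Lemma semi_innerB u v : S u -> S v -> S (u - v).
Proof. by move=> Su Sv; apply: (semi_innerD SB) => //; exact: semi_innerN. Qed.

Lemma semi_innerNl u v : S u -> S v -> B (- u) v = - B u v.
Proof. by move=> Su Sv; rewrite -scaleN1r (semi_innerZl SB)// mulN1r. Qed.

Lemma semi_innerBl u v w : S u -> S v -> S w -> B (u - v) w = B u w - B v w.
Proof.
move=> Su Sv Sw; rewrite (semi_innerDl SB)//; last exact: semi_innerN.
by rewrite semi_innerNl.
Qed.

Lemma semi_innerDr u v w : S u -> S v -> S w -> B w (u + v) = B w u + B w v.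
Proof.
move=> Su Sv Sw; have Suv := semi_innerD SB Su Sv.
by rewrite (semi_inner_sym SB)// (semi_innerDl SB)//; congr +%R; exact: (semi_inner_sym SB).
Qed.

Lemma semi_innerZr a u v : S u -> S v -> B v (a *: u) = a * B v u.
Proof.
move=> Su Sv; have Sau := semi_innerZ SB a Su.
by rewrite (semi_inner_sym SB)// (semi_innerZl SB)// (semi_inner_sym SB).
Qed.

Lemma semi_norm_ge0 u : 0 <= semi_norm B u.
Proof. exact: sqrtr_ge0. Qed.

Lemma sqr_semi_norm u : S u -> semi_norm B u ^+ 2 = B u u.
Proof. by move=> Su; rewrite sqr_sqrtr//; exact: (semi_inner_ge0 SB). Qed.

Lemma semi_inner_line u w t : S u -> S w ->
  B (u + t *: w) (u + t *: w) = B u u + 2 * t * B u w + t ^+ 2 * B w w.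
Proof.
move=> Su Sw; have Stw := semi_innerZ SB t Sw; have Sutw := semi_innerD SB Su Stw.
rewrite (semi_innerDl SB)// !semi_innerDr// !(semi_innerZl SB)// !semi_innerZr//.
by rewrite (semi_inner_sym SB Sw Su); ring.
Qed.

Lemma semi_inner_CS_sqr u v : S u -> S v -> B u v ^+ 2 <= B u u * B v v.
Proof.
move=> Su Sv; apply: discriminant_le; first exact: (semi_inner_ge0 SB).
move=> t; rewrite -semi_inner_line//; apply: (semi_inner_ge0 SB).
by apply: (semi_innerD SB) => //; exact: (semi_innerZ SB).
Qed.

Lemma semi_inner_CS u v : S u -> S v ->
  `|B u v| <= semi_norm B u * semi_norm B v.
Proof.
move=> Su Sv; rewrite -(@ler_pXn2r _ 2)// ?nnegrE ?mulr_ge0 ?semi_norm_ge0//.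
by rewrite real_normK ?num_real// exprMn !sqr_semi_norm// semi_inner_CS_sqr.
Qed.

Lemma semi_normD u v : S u -> S v ->
  semi_norm B (u + v) <= semi_norm B u + semi_norm B v.
Proof.
move=> Su Sv; have Suv := semi_innerD SB Su Sv.
rewrite -(@ler_pXn2r _ 2)// ?nnegrE ?addr_ge0 ?semi_norm_ge0//.
rewrite sqr_semi_norm// -[v]scale1r semi_inner_line// scale1r sqrrD !sqr_semi_norm//.
have := le_trans (ler_norm _) (semi_inner_CS Su Sv).
by rewrite expr1n mul1r mulr1 mulr2n; lra.
Qed.

Lemma semi_normZ a u : S u -> semi_norm B (a *: u) = `|a| * semi_norm B u.
Proof.
move=> Su; have Sau := semi_innerZ SB a Su.
by rewrite /semi_norm (semi_innerZl SB)// semi_innerZr// mulrA -expr2 sqrtrM ?sqr_ge0// sqrtr_sqr.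
Qed.

Lemma semi_normN u : S u -> semi_norm B (- u) = semi_norm B u.
Proof. by move=> Su; rewrite -scaleN1r semi_normZ// normrN1 mul1r. Qed.

Lemma semi_norm0 : semi_norm B 0 = 0.
Proof. by rewrite -(scale0r 0) semi_normZ ?normr0 ?mul0r//; exact: semi_inner0 SB. Qed.

Lemma semi_norm_sub u v : S u -> S v -> semi_norm B (u - v) = semi_norm B (v - u).
Proof. by move=> Su Sv; rewrite -semi_normN ?opprB//; exact: semi_innerB. Qed.

Lemma semi_norm_sub_le u v : S u -> S v ->
  `|semi_norm B u - semi_norm B v| <= semi_norm B (u - v).
Proof.
move=> Su Sv; rewrite ler_norml; apply/andP; split.
  rewrite lerBrDr addrC lerBlDr semi_norm_sub// -{1}(subrK u v) addrC addrC.
  by rewrite [leRHS]addrC; apply: semi_normD => //; exact: semi_innerB.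
by rewrite lerBlDr -{1}(subrK v u); apply: semi_normD => //; exact: semi_innerB.
Qed.

(* Minimise [B v v - 2 F v]; a minimising sequence is Cauchy by the
   parallelogram identity. *)
Lemma semi_inner_riesz (F : V -> R) (C : R) : semi_complete S B ->
  (forall u v, S u -> S v -> F (u + v) = F u + F v) ->
  (forall a u, S u -> F (a *: u) = a * F u) ->
  (forall u, S u -> `|F u| <= C * semi_norm B u) ->
  exists2 v, S v & forall w, S w -> B v w = F w.
Proof.
move=> cplt FD FZ FC.
pose J v := B v v - 2 * F v.
pose E := [set J v | v in S].
have S0 := semi_inner0 SB.
(* With [x = semi_norm B v], [J v >= x ^ 2 - 2 C x = (x - C) ^ 2 - C ^ 2]. *)
have lbE : lbound E (- C ^+ 2).
  move=> _ [v Sv <-]; rewrite /J -sqr_semi_norm//.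
  have := le_trans (ler_norm _) (FC _ Sv).
  have := sqr_ge0 (semi_norm B v - C); rewrite sqrrB mulr2n; lra.
have infE : has_inf E by split; [exists (J 0), 0|exists (- C ^+ 2)].
have Jge v : S v -> inf E <= J v by move=> Sv; apply: ge_inf; [exact: infE.2|exists v].
pose d n : R := n.+1%:R^-1.
have d0 n : 0 < d n by rewrite invr_gt0.
have /choice[v vP] n : exists v, S v /\ J v < inf E + d n.
  have [_ [v Sv <-] Jv] := inf_adherent (d0 n) infE; by exists v.
have Sv n : S (v n) by have [] := vP n.
have Jv n : J (v n) < inf E + d n by have [] := vP n.
(* The Euler-Lagrange equation with an error: [J (v n + t *: w) >= inf E > J (v n) - d n] makes a
   quadratic polynomial in [t] nonnegative, and its discriminant gives the bound. *)
have approx n w : S w -> (B (v n) w - F w) ^+ 2 <= d n * B w w.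
  move=> Sw; apply: discriminant_le; first exact: (semi_inner_ge0 SB).
  move=> t; have Stw := semi_innerZ SB t Sw.
  have := Jge _ (semi_innerD SB (Sv n) Stw).
  rewrite /J semi_inner_line// FD// FZ//.
  have := Jv n; rewrite /J; lra.
have par m n : B (v m - v n) (v m - v n) <= 2 * d m + 2 * d n.
  have Smn := semi_innerD SB (Sv m) (Sv n).
  have := Jge _ (semi_innerZ SB 2^-1 Smn); rewrite /J FZ// FD//.
  have Shmn := semi_innerZ SB 2^-1 Smn; have Smn' := semi_innerB (Sv m) (Sv n).
  rewrite (semi_innerZl SB)// semi_innerZr//.
  have -> : B (v m + v n) (v m + v n) = B (v m) (v m) + 2 * B (v m) (v n) + B (v n) (v n).
    by rewrite -[v n]scale1r semi_inner_line// scale1r expr1n mul1r mulr1.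
  have -> : B (v m - v n) (v m - v n) = B (v m) (v m) - 2 * B (v m) (v n) + B (v n) (v n).
    by rewrite -[- v n]scaleN1r semi_inner_line//; ring.
  have := Jv n; have := Jv m; rewrite /J; lra.
have dcvg : d n @[n --> \oo] --> (0 : R) by exact: cvg_harmonic.
have [l Sl lP] : exists2 l, S l & semi_norm B (v n - l) @[n --> \oo] --> (0 : R).
  apply: cplt => // e e0.
  have e4 : 0 < e ^+ 2 / 4 by rewrite divr_gt0 ?exprn_gt0.
  have /cvgrPdist_lt/(_ _ e4)[k _ kP] := dcvg.
  exists k => m n km kn; have Smn := semi_innerB (Sv m) (Sv n).
  rewrite -(@ltr_pXn2r _ 2)// ?nnegrE ?semi_norm_ge0 ?(ltW e0)//.
  rewrite sqr_semi_norm//; apply: le_lt_trans (par m n) _.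
  have := kP m km; have := kP n kn; rewrite /= !sub0r !normrN !ger0_norm ?(ltW (d0 _))//.
  lra.
exists l => // w Sw; apply/eqP; rewrite -subr_eq0 -normr_le0; apply/ler_addgt0Pl => e e0.
rewrite addr0.
pose q n := semi_norm B (v n - l) * semi_norm B w + Num.sqrt (d n) * semi_norm B w.
have : q n @[n --> \oo] --> (0 : R).
  rewrite /q -[0 in X in _ --> X](_ : 0 * semi_norm B w + Num.sqrt 0 * semi_norm B w = 0); last first.
    by rewrite sqrtr0 !mul0r addr0.
  apply: cvgD; apply: cvgMr_tmp => //.
  by apply: continuous_cvg => //; exact: sqrt_continuous.
move=> /cvgrPdist_lt/(_ _ e0)[k _ /(_ k (leqnn _))]; rewrite /= sub0r normrN => qk.
apply: ltW; apply: le_lt_trans qk; apply: le_trans (ler_norm _).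
have -> : B l w - F w = - B (v k - l) w + (B (v k) w - F w) by rewrite semi_innerBl//; ring.
apply: le_trans (ler_normD _ _) _; rewrite normrN lerD//.
  by apply: semi_inner_CS => //; exact: semi_innerB.
rewrite -(@ler_pXn2r _ 2)// ?nnegrE ?mulr_ge0 ?sqrtr_ge0 ?semi_norm_ge0//.
by rewrite real_normK ?num_real// exprMn sqr_sqrtr ?(ltW (d0 k))// sqr_semi_norm//; exact: approx.
Qed.

End semi_inner.

(** * The space L^2 *)

Lemma sum_half_le2 (R : realType) n : \sum_(0 <= k < n) 2 ^- k <= 2 :> R.
Proof.
have := @geometric_le_lim R n 1 2^-1 ler01.
rewrite invr_gt0 ltr0n ger0_norm ?invr_ge0// invf_lt1 ?ltr1n// => /(_ isT isT).
rewrite /series/=; under eq_bigr do rewrite mul1r exprVn.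
by rewrite div1r (_ : 1 - 2^-1 = 2^-1) ?invrK//; lra.
Qed.

Section L2_complete.
Context d (T : measurableType d) (R : realType) (mu : {measure set T -> \bar R}).
Implicit Types f g : T -> R.

Definition sqint f : \bar R := (\int[mu]_x ((f x) ^+ 2)%:E)%E.

Lemma sqint_Lnorm f : sqint f = (\int[mu]_x (`|(f x)%:E| `^ 2))%E.
Proof. by apply: eq_integral => x _ /=; rewrite powR_mulrn// real_normK ?num_real. Qed.

Lemma Lfun2P f : f \in Lfun mu 2%:E <-> measurable_fun setT f /\ (sqint f < +oo)%E.
Proof.
split=> [fL|[mf foo]].
  split; first by move: (fL); rewrite inE => /andP[/[!inE]].
  by have /integrable_lty := Lfun2_integrable_sqr fL; apply.
rewrite inE; apply/andP; split; rewrite inE//=.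
by rewrite /finite_norm unlock -sqint_Lnorm poweR_lty.
Qed.

Lemma measurable_sqr f : measurable_fun setT f ->
  measurable_fun setT (fun x => ((f x) ^+ 2)%:E).
Proof. by move=> mf; apply/measurable_EFinP; exact: measurable_funX. Qed.

(* [\sum_k 2 ^ k * (g (k+1) - g k) ^ 2] is integrable, hence finite almost
   everywhere, which makes [\sum_k `|g (k+1) - g k|] converge there. *)
Lemma L2_subseq_cvg (g : nat -> T -> R) :
  (forall k, measurable_fun setT (g k)) ->
  (forall k, (sqint (g k.+1 \- g k)%R <= (8%:R ^- k)%:E)%E) ->
  exists2 A, measurable A /\ mu (~` A) = 0%E & forall x, A x -> cvgn (g^~ x).
Proof.
move=> mg gd; pose D k x := 2 ^+ k * (g k.+1 x - g k x) ^+ 2.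
have D0 k x : 0 <= D k x by rewrite mulr_ge0// sqr_ge0.
have mD k : measurable_fun setT (fun x => (D k x)%:E).
  apply/measurable_EFinP; apply: measurable_funM => //.
  by apply: measurable_funX; exact: measurable_funB.
pose h x := (\sum_(0 <= k <oo) (D k x)%:E)%E.
have h0 x : (0 <= h x)%E by apply: nneseries_ge0 => k _ _; rewrite lee_fin.
have mh : measurable_fun setT h.
  by apply: ge0_emeasurable_sum => // k x _ _; rewrite lee_fin.
have hoo : (\int[mu]_x h x < +oo)%E.
  rewrite /h integral_nneseries//; last by move=> k x _; rewrite lee_fin.
  apply: (@le_lt_trans _ _ (\sum_(0 <= k <oo) (2 ^- k)%:E)%E).
    apply: lee_nneseries => [k _ _|k _].
      by apply: integral_ge0 => x _; rewrite lee_fin.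
    have -> : (\int[mu]_x (D k x)%:E = (2 ^+ k)%:E * sqint (g k.+1 \- g k)%R)%E.
      rewrite /sqint -ge0_integralZl//.
      - by apply/measurable_sqr/measurable_funB.
      - by move=> x _; rewrite lee_fin sqr_ge0.
    (* The ratio 8 leaves [2 ^ k * 8 ^- k = 4 ^- k], which is at most the summable [2 ^- k]. *)
    apply: (@le_trans _ _ ((2 ^+ k)%:E * (8%:R ^- k)%:E)%E).
      by apply: lee_wpmul2l; rewrite ?lee_fin ?exprn_ge0.
    rewrite -EFinM lee_fin -!exprVn -exprMn; apply: lerXn2r; rewrite ?nnegrE; lra.
  apply: (@le_lt_trans _ _ 2%:E); last by rewrite ltry.
  apply: lime_le.
    by apply: is_cvg_nneseries => k _ _; rewrite lee_fin invr_ge0 exprn_ge0.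
  by near=> n; rewrite sumEFin lee_fin; exact: sum_half_le2.
have hA : mu.-integrable setT h.
  apply/integrableP; split => //.
  by under eq_integral do rewrite gee0_abs//.
pose A := [set x | h x < +oo]%E.
have mA : measurable A.
  by rewrite -[A]setTI; exact: emeasurable_fun_infty_o.
exists A.
  split=> //; have [N [mN N0 subN]] := integrable_ae measurableT hA.
  apply: (subset_measure0 _ mN _ N0); first exact: measurableC.
  move=> x /negP; rewrite -leNgt leye_eq => /eqP hx; apply: subN => /(_ Logic.I).
  by rewrite hx.
move=> x Ax.
have cd : cvgn (series (fun k => `|g k.+1 x - g k x|)).
  apply: nondecreasing_is_cvgn.
    by apply: nondecreasing_series => k _ _.
  (* Completing a square gives [|y| <= 2 ^ k * y ^ 2 + 2 ^- k]; the first terms sum to at most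
     [h x], the second to at most 2. *)
  exists (fine (h x) + 2) => _ [n _ <-].
  have le1 : series (fun k => D k x) n <= fine (h x).
    rewrite -lee_fin fineK ?ge0_fin_numE//.
    rewrite /series/= -sumEFin; apply: nneseries_lim_ge => k _ _; by rewrite lee_fin.
  have le2 : series (fun k => 2 ^- k) n <= 2 :> R.
    exact: sum_half_le2.
  apply: le_trans (lerD le1 le2); rewrite /series/= -big_split/=.
  apply: ler_sum => k _; rewrite /D; set y := g k.+1 x - g k x.
  have p0 : 0 < 2 ^+ k :> R by rewrite exprn_gt0.
  rewrite -(@ler_pM2l _ (2 ^+ k))// mulrDr mulfV ?gt_eqF// mulrA -expr2 -exprMn.
  rewrite -[leLHS]ger0_norm ?mulr_ge0 ?(ltW p0)// normrM normr_id -normrM.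
  set z := _ * y.
  have := sqr_ge0 (`|z| - 2^-1); rewrite sqrrB real_normK ?num_real//; lra.
have cs : cvgn (series (fun k => g k.+1 x - g k x)) by exact: normed_cvg.
rewrite (_ : (fun n => g n x) = (fun n => g 0%N x + series (fun k => g k.+1 x - g k x) n)).
  by apply: is_cvgD => //; exact: is_cvg_cst.
by apply/funext => n; rewrite /series/= telescope_sumr//= addrC subrK.
Unshelve. all: by end_near. Qed.

Lemma limn_einf_le (u : nat -> \bar R) (c : \bar R) k :
  (forall n, (k <= n)%N -> (u n <= c)%E) -> (limn_einf u <= c)%E.
Proof.
move=> uc; rewrite limn_einf_lim; apply: lime_le; first exact: is_cvg_einfs.
near=> n; apply: (@le_trans _ _ (u (maxn n k))).
  by apply: ereal_inf_lbound; exists (maxn n k) => //=; rewrite leq_maxl.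
by apply: uc; rewrite leq_maxr.
Unshelve. all: by end_near. Qed.

(** Fatou's lemma on [A], whose complement is null: the squared L^2 norm is lower semicontinuous
    under convergence almost everywhere. *)
Lemma sqint_cvg_le (A : set T) (w : nat -> T -> R) (l : T -> R) (c : \bar R) k :
  measurable A -> mu (~` A) = 0%E ->
  (forall n, measurable_fun setT (w n)) -> measurable_fun setT l ->
  (forall x, A x -> w n x @[n --> \oo] --> l x) ->
  (forall n, (k <= n)%N -> (sqint (w n) <= c)%E) -> (sqint l <= c)%E.
Proof.
move=> mA A0 mw ml wl wc.
have -> : sqint l = (\int[mu]_(x in A) ((l x) ^+ 2)%:E)%E.
  rewrite /sqint (ge0_negligible_integral (N := ~` A) (D := setT))//.
  - by rewrite setDE setCK setTI.
  - exact: measurableC.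
  - exact: measurable_sqr.
  - by move=> x _; rewrite lee_fin sqr_ge0.
have -> : (\int[mu]_(x in A) ((l x) ^+ 2)%:E =
    \int[mu]_(x in A) limn_einf (fun n => ((w n x) ^+ 2)%:E))%E.
  apply: eq_integral => x /[!inE] Ax; apply/esym.
  have [] // := @cvg_limn_einf_sup _ (fun n => ((w n x) ^+ 2)%:E) ((l x) ^+ 2)%:E.
  apply: cvg_EFin; first by apply: nearW.
  by apply: cvgM; apply: wl.
apply: le_trans (fatou _ _ _ _) _ => //.
- by move=> n; apply: measurable_funTS; exact: measurable_sqr.
- by move=> n x _; rewrite lee_fin sqr_ge0.
apply: (@limn_einf_le _ _ k) => n kn; apply: le_trans (wc n kn).
apply: ge0_subset_integral => //; first exact: measurable_sqr.
by move=> x _; rewrite lee_fin sqr_ge0.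
Qed.

Lemma L2_complete (u : nat -> T -> R) :
  (forall n, measurable_fun setT (u n)) ->
  (forall e, 0 < e -> exists k, forall m n, (k <= m)%N -> (k <= n)%N ->
    (sqint (u m \- u n)%R <= e%:E)%E) ->
  exists2 g, measurable_fun setT g & forall e, 0 < e -> exists k, forall n,
    (k <= n)%N -> (sqint (u n \- g)%R <= e%:E)%E.
Proof.
move=> mu_ uC.
have /choice[ks ksP] j : exists k, forall m n, (k <= m)%N -> (k <= n)%N ->
    (sqint (u m \- u n)%R <= (8%:R ^- j)%:E)%E.
  by apply: uC; rewrite invr_gt0 exprn_gt0.
(* Summing makes [phi j] at least every [ks i] with [i <= j], so the subsequence needs no recursive
   choice. *)
pose phi j := (\sum_(i < j.+1) ks i)%N.
have phi_ge i j : (i <= j)%N -> (ks i <= phi j)%N.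
  by move=> ij; rewrite /phi (bigD1 (Ordinal (ij : (i < j.+1)%N)))//= leq_addr.
have [A [mA A0] Acvg] : exists2 A, measurable A /\ mu (~` A) = 0%E &
    forall x, A x -> cvgn (fun k => u (phi k) x).
  apply: L2_subseq_cvg => k //; apply: ksP; exact: phi_ge.
(* Killing the exceptional null set makes the sequence converge everywhere, hence its limit
   measurable. *)
pose v k x := u (phi k) x * \1_A x.
have vcvg x : cvgn (v^~ x).
  rewrite /v indicE; have [/set_mem Ax|_] := boolP (x \in A).
    by under eq_fun do rewrite mulr1; exact: Acvg.
  by under eq_fun do rewrite mulr0; exact: is_cvg_cst.
have mv k : measurable_fun setT (v k).
  by apply: measurable_funM => //; exact: measurable_indic.
pose g x := lim (v k x @[k --> \oo]).
have mg : measurable_fun setT g by apply: measurable_fun_cvg mv _ => x _; exact: vcvg.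
exists g => // e e0.
have [j je] : exists j, 8%:R ^- j <= e :> R.
  have h8 : `|8%:R^-1 : R| < 1 by rewrite ger0_norm ?invr_ge0// invf_lt1 ?ltr1n.
  have /cvgrPdist_le/(_ _ e0)[j _ /(_ j (leqnn j))] := cvg_expr h8.
  by rewrite /= sub0r normrN exprVn ger0_norm ?invr_ge0 ?exprn_ge0//; exists j.
exists (ks j) => n jn.
(* [n] is fixed and the other index runs along the subsequence: the Cauchy estimate passes to the
   limit by Fatou. *)
apply: (@sqint_cvg_le A (fun k => u n \- u (phi k)) _ _ j) => //.
- by move=> k; exact: measurable_funB.
- exact: measurable_funB.
- move=> x Ax; apply: cvgB; first exact: cvg_cst.
  have := vcvg x; rewrite /g /v indicE mem_set//.
  by under eq_fun do rewrite mulr1.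
- move=> k jk; apply: le_trans (ksP j _ _ jn (phi_ge _ _ jk)) _.
  by rewrite lee_fin.
Qed.

End L2_complete.

Section L2_semi_inner.
Context {R : realType} {N : nat}.
Local Notation leb := (lebesgue_rV R N).
Implicit Types (Omega : set 'rV[R]_N) (u v : 'rV[R]_N -> R).

Lemma L2dotE Omega u v :
  L2dot Omega u v = \int[leb]_x ((u \_ Omega) x * (v \_ Omega) x).
Proof.
rewrite /L2dot Rintegral_mkcond; apply: eq_Rintegral => x _.
by rewrite /patch; case: ifP; rewrite ?mulr0.
Qed.

Lemma L2_integrable Omega u v : L2 Omega u -> L2 Omega v ->
  leb.-integrable setT (EFin \o (fun x => (u \_ Omega) x * (v \_ Omega) x)).
Proof. by move=> Lu Lv; exact/Lfun1_integrable/Lfun2_mul_Lfun1. Qed.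

Let one_le2 : (1 <= 2%:E :> \bar R)%E.
Proof. by rewrite lee_fin ler1n. Qed.

Lemma L2_semi_inner Omega : semi_inner (L2 Omega) (L2dot Omega).
Proof.
have [L0 LZD] := Lfun_submod_closed leb one_le2.
have rD u v : (u + v) \_ Omega = (u \_ Omega) + (v \_ Omega).
  by apply/funext => x; rewrite /patch !fctE; case: ifP; rewrite ?addr0.
have rZ a u : (a *: u) \_ Omega = a *: (u \_ Omega).
  by apply/funext => x; rewrite /patch !fctE; case: ifP; rewrite ?scaler0.
split.
- rewrite /L2 (_ : 0 \_ Omega = 0)//.
  by apply/funext => x; rewrite /patch; case: ifP.
- by move=> u v Lu Lv; rewrite /L2 rD -(scale1r (u \_ Omega)); exact: LZD.
- by move=> a u Lu; rewrite /L2 rZ -(addr0 (_ *: _)); exact: LZD.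
- by move=> u v _ _; rewrite !L2dotE; apply: eq_Rintegral => x _; rewrite mulrC.
- move=> u v w Lu Lv Lw; rewrite !L2dotE -RintegralD//; try exact: L2_integrable.
  by apply: eq_Rintegral => x _; rewrite rD fctE mulrDl.
- move=> a u v Lu Lv; rewrite !L2dotE -RintegralZl//; last exact: L2_integrable.
  by apply: eq_Rintegral => x _; rewrite rZ fctE -mulrA.
- by move=> u _; rewrite L2dotE; apply: Rintegral_ge0 => x _; rewrite -expr2 sqr_ge0.
Qed.

Lemma sqint_L2dot Omega u : L2 Omega u ->
  sqint leb (u \_ Omega) = (L2dot Omega u u)%:E.
Proof.
move=> Lu; rewrite L2dotE /Rintegral fineK ?integrable_fin_num//.
exact: L2_integrable.
Qed.

Lemma L2normE Omega u : L2 Omega u -> L2norm Omega u = semi_norm (L2dot Omega) u.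
Proof.
move=> Lu; rewrite /L2norm unlock -sqint_Lnorm sqint_L2dot// poweR_EFin/=.
by rewrite /semi_norm powR12_sqrt//; exact: (semi_inner_ge0 (L2_semi_inner Omega)).
Qed.

Lemma L2_semi_complete Omega : measurable Omega ->
  semi_complete (L2 Omega) (L2dot Omega).
Proof.
move=> mO u Lu uC; have SI := L2_semi_inner Omega.
have rB v w : (v - w) \_ Omega = (v \_ Omega) \- (w \_ Omega).
  by apply/funext => x; rewrite /patch /=; case: ifP => //; rewrite subr0.
have mu n : measurable_fun setT (u n \_ Omega) by have /Lfun2P[] := Lu n.
have sq v : L2 Omega v -> sqint leb (v \_ Omega) = (semi_norm (L2dot Omega) v ^+ 2)%:E.
  by move=> Lv; rewrite sqint_L2dot// (sqr_semi_norm SI).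
have [|g mg gP] := L2_complete (mu := leb) mu.
  move=> e e0; have [|k kP] := uC (Num.sqrt e); first by rewrite sqrtr_gt0.
  exists k => m n km kn; rewrite -rB sq ?lee_fin; last exact: (semi_innerB SI).
  rewrite -[leRHS](@sqr_sqrtr _ e) ?(ltW e0)// ler_pXn2r// ?nnegrE ?sqrtr_ge0 ?semi_norm_ge0//.
  exact/ltW/kP.
(* The limit was found on the whole space; cutting it off outside [Omega] can only bring it closer
   to the restrictions of [u n]. *)
pose l := g \_ Omega.
have lE : l \_ Omega = l.
  by apply/funext => x; rewrite /l /patch; case: (x \in Omega).
have mOl : measurable_fun setT l.
  by apply/measurable_restrict => //; rewrite setTI; exact: measurable_funTS.
have ml : measurable_fun setT (l \_ Omega) by rewrite lE.
have le_sq n : (sqint leb ((u n - l)%R \_ Omega) <= sqint leb (u n \_ Omega \- g)%R)%E.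
  apply: ge0_le_integral => //.
  - by move=> x _; rewrite lee_fin sqr_ge0.
  - by apply: measurable_sqr; rewrite rB; exact: measurable_funB.
  - by apply: measurable_sqr; exact: measurable_funB.
  - move=> x _; rewrite lee_fin rB/= lE /l /patch; case: ifP => // _.
    by rewrite subrr expr0n sqr_ge0.
have Ld n : (exists2 c : R, True & (sqint leb (u n \_ Omega \- g)%R <= c%:E)%E) -> L2 Omega (u n - l).
  case=> c _ nc; apply/Lfun2P; split.
    by rewrite rB; exact: measurable_funB.
  by apply: le_lt_trans (le_sq n) _; apply: le_lt_trans nc _; rewrite ltry.
have Ll : L2 Omega l.
  have [k /(_ k (leqnn k)) kP] := gP 1 ltr01.
  have Lkl : L2 Omega (u k - l) by apply: Ld; exists 1.
  by have := semi_innerB SI (Lu k) Lkl; rewrite subKr.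
exists l => //; apply/cvgrPdist_lt => e e0.
have e2 : 0 < (e / 2) ^+ 2 by rewrite exprn_gt0 ?divr_gt0.
have [k kP] := gP _ e2; exists k => // n /= kn.
rewrite sub0r normrN ger0_norm ?semi_norm_ge0//.
apply: (@le_lt_trans _ _ (e / 2)); last by rewrite ltr_pdivrMr// ltr_pMr// ltr1n.
rewrite -(@ler_pXn2r _ 2)// ?nnegrE ?semi_norm_ge0 ?divr_ge0 ?(ltW e0)//.
rewrite -lee_fin -sq; last exact: (semi_innerB SI).
exact: le_trans (le_sq n) (kP n kn).
Qed.

End L2_semi_inner.

(** * Poincare's inequality on cubes *)

Section row_vectors.
Context {R : realType}.

Lemma continuous_rV (T : topologicalType) n (g : T -> 'rV[R]_n) :
  (forall i, continuous (fun x => g x ord0 i)) -> continuous g.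
Proof.
move=> gc x; apply/cvg_ballP => e e0.
have H : \forall y \near x, forall i, ball (g x ord0 i) e (g y ord0 i).
  by apply: filter_forall => i; have /cvg_ballP/(_ _ e0) := gc i x.
near=> y; split=> // i j; rewrite ord1.
by have : forall k, ball (g x ord0 k) e (g y ord0 k) by near: y.
Unshelve. all: by end_near. Qed.

Lemma continuous_measurable_rV n (f : 'rV[R]_n -> R) :
  continuous f -> measurable_fun setT f.
Proof.
move=> /continuousP fc; apply: (measurability _ (RGenOpens.measurableE R)).
move=> _ [_ [a [b ->] <-]]; rewrite setTI; apply: open_measurable_rV.
exact/fc/interval_open.
Qed.

Lemma rV_cons0 n (t : R) (v : 'rV[R]_n) : rV_cons (t, v) ord0 ord0 = t.
Proof. by rewrite mxE unlift_none. Qed.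

Lemma rV_cons_lift n (t : R) (v : 'rV[R]_n) j : rV_cons (t, v) ord0 (lift ord0 j) = v ord0 j.
Proof. by rewrite mxE liftK. Qed.

Lemma continuous_slice n (f : 'rV[R]_n.+1 -> R) t : continuous f ->
  continuous (fun v => f (rV_cons (t, v))).
Proof.
move=> fc v; apply: (@continuous_comp _ _ _ (fun v => rV_cons (t, v)) f); last exact: fc.
apply: continuous_rV v => i; have [j ->|->] := unliftP ord0 i.
  rewrite (_ : (fun v => _) = (fun v : 'rV[R]_n => v ord0 j)).
    exact: coord_continuous.
  by apply/funext => v; rewrite rV_cons_lift.
rewrite (_ : (fun v => _) = cst t); first exact: cst_continuous.
by apply/funext => v; rewrite rV_cons0.
Qed.

Lemma continuous_line n (f : 'rV[R]_n.+1 -> R) v : continuous f ->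
  continuous (fun t => f (rV_cons (t, v))).
Proof.
move=> fc t; apply: (@continuous_comp _ _ _ (fun t => rV_cons (t, v)) f); last exact: fc.
apply: continuous_rV t => i; have [j ->|->] := unliftP ord0 i.
  rewrite (_ : (fun t => _) = cst (v ord0 j)); first exact: cst_continuous.
  by apply/funext => t; rewrite rV_cons_lift.
rewrite (_ : (fun t => _) = id); first by move=> t; exact: cvg_id.
by apply/funext => t; rewrite rV_cons0.
Qed.

Lemma rV_cons_add_basis0 n h t (v : 'rV[R]_n) :
  h *: basis_rV ord0 + rV_cons (t, v) = rV_cons (h + t, v).
Proof.
apply/rowP => i; rewrite !mxE eqxx/=; have [j ->|->] := unliftP ord0 i.
  by rewrite eq_sym (negbTE (neq_lift _ _)) mulr0 add0r.
by rewrite eqxx mulr1.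
Qed.

Lemma rV_cons_add_basis_lift n h t (v : 'rV[R]_n) j :
  h *: basis_rV (lift ord0 j) + rV_cons (t, v) = rV_cons (t, h *: basis_rV j + v).
Proof.
apply/rowP => i; rewrite !mxE eqxx/=; have [k ->|->] := unliftP ord0 i.
  by rewrite (inj_eq lift_inj) /= !mxE eqxx.
by rewrite (negbTE (neq_lift _ _)) mulr0 add0r.
Qed.

(** Only derivatives along the axes are asked for. The class is stable under fixing the first
    coordinate, which makes induction on the dimension possible. *)
Definition C1 n (f : 'rV[R]_n -> R) : Prop := continuous f /\
  forall i, (forall x, derivable f x (basis_rV i)) /\ continuous (partial i f).

(** The two difference quotients are the same function of [h], so both derivability and the value of
    the derivative transfer between a function and its slices. *)
Lemma slice_quotient n (f : 'rV[R]_n.+1 -> R) t v j :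
  (fun h => h^-1 *: (((fun w => f (rV_cons (t, w))) \o shift v) (h *: basis_rV j)
     - f (rV_cons (t, v)))) =
  (fun h => h^-1 *: ((f \o shift (rV_cons (t, v))) (h *: basis_rV (lift ord0 j))
     - f (rV_cons (t, v)))).
Proof. by apply/funext => h /=; rewrite rV_cons_add_basis_lift. Qed.

Lemma partial_slice n (f : 'rV[R]_n.+1 -> R) t v j :
  partial j (fun w => f (rV_cons (t, w))) v = partial (lift ord0 j) f (rV_cons (t, v)).
Proof. by rewrite /partial /derive slice_quotient. Qed.

Lemma C1_slice n (f : 'rV[R]_n.+1 -> R) t : C1 f -> C1 (fun v => f (rV_cons (t, v))).
Proof.
move=> [fc fd]; split; first exact: continuous_slice.
move=> j; have [dj cj] := fd (lift ord0 j); split.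
  by move=> v; rewrite /derivable slice_quotient; exact: dj.
rewrite (_ : partial j _ = fun v => partial (lift ord0 j) f (rV_cons (t, v))).
  exact: continuous_slice.
by apply/funext => v; exact: partial_slice.
Qed.

Lemma line_quotient n (f : 'rV[R]_n.+1 -> R) t v :
  (fun h => h^-1 *: (((fun s => f (rV_cons (s, v))) \o shift t) (h *: (1 : R))
     - f (rV_cons (t, v)))) =
  (fun h => h^-1 *: ((f \o shift (rV_cons (t, v))) (h *: basis_rV ord0)
     - f (rV_cons (t, v)))).
Proof. by apply/funext => h /=; rewrite rV_cons_add_basis0 scaler1. Qed.

Lemma derivable_line n (f : 'rV[R]_n.+1 -> R) t v :
  derivable f (rV_cons (t, v)) (basis_rV ord0) ->
  derivable (fun s => f (rV_cons (s, v))) t 1.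
Proof. by rewrite /derivable line_quotient. Qed.

Lemma derive1_line n (f : 'rV[R]_n.+1 -> R) t v :
  derive1 (fun s => f (rV_cons (s, v))) t = partial ord0 f (rV_cons (t, v)).
Proof. by rewrite derive1E /partial /derive line_quotient. Qed.

(** Half-open, so that the cubes of a grid are disjoint and cover without leaving gaps. *)
Definition cube n (a : 'rV[R]_n) (h : R) : set 'rV[R]_n :=
  [set v | forall i, v ord0 i \in `[a ord0 i, a ord0 i + h[].

Lemma measurable_cube n (a : 'rV[R]_n) h : measurable (cube a h).
Proof.
rewrite (_ : cube a h = \bigcap_(i in [set: 'I_n])
    ((fun v : 'rV[R]_n => v ord0 i) @^-1` `[a ord0 i, a ord0 i + h[%classic)).
  apply: fin_bigcap_measurable => // i _; rewrite -[X in measurable X]setTI.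
  exact: measurable_coord.
by apply/seteqP; split=> v /= Hv i => [_|]; apply: Hv.
Qed.

Lemma lebesgue_cube n (a : 'rV[R]_n) h : 0 <= h ->
  lebesgue_rV R n (cube a h) = (h ^+ n)%:E.
Proof.
move=> h0; have := @lebesgue_rV_box R n (fun i => `[a ord0 i, a ord0 i + h[%classic) (fun=> measurable_itv _).
rewrite -[X in X = _ -> _]/(lebesgue_rV R n (cube a h)) => ->; rewrite (eq_bigr (fun=> h%:E)).
  by rewrite big_const_ord -[RHS]mul1e; elim: n {a} => [|n IHn]; rewrite ?expr0 ?mule1//= IHn mul1e mul1e exprS EFinM.
move=> i _; rewrite lebesgue_measure_itv/= lte_fin ltrDl.
have [h1|h1] := ltP 0 h; first by rewrite -EFinB addrC addKr.
by congr EFin; apply/eqP; rewrite eq_le h0 h1.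
Qed.

Lemma continuous_bounded_cube n (a : 'rV[R]_n) h (f : 'rV[R]_n -> R) :
  continuous f -> exists M, forall x, cube a h x -> `|f x| <= M.
Proof.
move=> fc.
pose K := [set v : 'rV[R]_n | forall i, `[a ord0 i, a ord0 i + h]%classic (v ord0 i)].
have cK : compact K by apply: (@rV_compact _ _ (fun i => `[a ord0 i, a ord0 i + h]%classic)) => i; exact: segment_compact.
have /compact_bounded[M [_ MP]] : compact (f @` K).
  by apply: continuous_compact => //; exact: continuous_subspaceT.
exists (M + 1) => x Qx; apply: MP; first by rewrite ltrDl.
exists x => // i /=; have := Qx i; rewrite !in_itv/= => /andP[-> /ltW ->]//.
Qed.

Lemma cube_integrable_bounded n (a : 'rV[R]_n) h (f : 'rV[R]_n -> R) M :
  0 <= h -> measurable_fun (cube a h) f -> (forall x, cube a h x -> `|f x| <= M) ->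
  (lebesgue_rV R n).-integrable (cube a h) (EFin \o f).
Proof.
move=> h0 mf fM; apply: measurable_bounded_integrable => //.
- exact: measurable_cube.
- by have := lebesgue_cube a h0 => /= ->; rewrite ltry.
- exists M; split; first exact: num_real.
  by move=> x Mx y /fM fy; exact: le_trans fy (ltW Mx).
Qed.

Lemma cube_integrable n (a : 'rV[R]_n) h (f : 'rV[R]_n -> R) : 0 <= h ->
  continuous f -> (lebesgue_rV R n).-integrable (cube a h) (EFin \o f).
Proof.
move=> h0 fc; have [M fM] := continuous_bounded_cube a h fc.
apply: cube_integrable_bounded fM => //; apply: measurable_funTS.
exact: continuous_measurable_rV.
Qed.

Definition rV_behead n (a : 'rV[R]_n.+1) : 'rV[R]_n := \row_(j < n) a ord0 (lift ord0 j).

Lemma cube_cons n (a : 'rV[R]_n.+1) h t v : cube a h (rV_cons (t, v)) <->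
  (t \in `[a ord0 ord0, a ord0 ord0 + h[) /\ cube (rV_behead a) h v.
Proof.
split=> [Q|[It Qv] i].
  split; first by have := Q ord0; rewrite rV_cons0.
  by move=> j; have := Q (lift ord0 j); rewrite rV_cons_lift mxE.
have [j ->|->] := unliftP ord0 i; last by rewrite rV_cons0.
by rewrite rV_cons_lift; have := Qv j; rewrite mxE.
Qed.

(** * Iterated integrals over a cube *)

Section fubini.
Variable n : nat.
Local Notation leb1 := (@lebesgue_measure R).
Local Notation lebn := (lebesgue_rV R n).
Local Notation lebS := (lebesgue_rV R n.+1).

(** By construction the measure in dimension [n.+1] is the image of the product measure under
    [rV_cons], so this is a change of variables. *)
Lemma integrable_rV_cons (f : 'rV[R]_n.+1 -> \bar R) :
  lebS.-integrable setT f -> (leb1 \x lebn)%E.-integrable setT (f \o @rV_cons R n).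
Proof.
move=> /integrableP[mf foo]; apply/integrableP; split.
  by apply: measurableT_comp => //; exact: measurable_rV_cons.
apply: le_lt_trans foo.
have mc : measurable_fun (setT : set (measurableTypeR R * 'rV[R]_n)%type) (@rV_cons R n).
  exact: measurable_rV_cons.
have := @ge0_integral_pushforward _ _ _ _ R _ mc [the measure _ _ of (leb1 \x lebn)%E] setT (abse \o f) measurableT.
have maf : measurable_fun setT (abse \o f) by exact: measurableT_comp.
rewrite preimage_setT => /(_ maf (fun _ _ => abse_ge0 _)) <-.
by rewrite (eq_measure_integral lebS).
Qed.

Lemma integral_rV_cons (f : 'rV[R]_n.+1 -> \bar R) : lebS.-integrable setT f ->
  (\int[lebS]_x f x = \int[leb1 \x lebn]_p f (rV_cons p))%E.
Proof.
move=> fi; have mc : measurable_fun (setT : set (measurableTypeR R * 'rV[R]_n)%type) (@rV_cons R n).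
  exact: measurable_rV_cons.
have := @integral_pushforward _ _ _ _ R _ mc [the measure _ _ of (leb1 \x lebn)%E] setT f
  (measurable_int _ fi).
rewrite preimage_setT => /(_ (integrable_rV_cons fi) measurableT) <-.
by rewrite (eq_measure_integral lebS).
Qed.

Lemma mem_cube_cons (a : 'rV[R]_n.+1) h t v : (rV_cons (t, v) \in cube a h) =
  (t \in `[a ord0 ord0, a ord0 ord0 + h[%classic) && (v \in cube (rV_behead a) h).
Proof. by apply/idP/andP; rewrite !inE => /cube_cons. Qed.

(** The integrability of the two inner integrals is part of the conclusion because real-valued
    integrals are additive and monotone only on integrable functions. The proof applies Fubini to
    the extension of [f] by zero. *)
Lemma cube_fubini (a : 'rV[R]_n.+1) h (f : 'rV[R]_n.+1 -> R) :
  0 <= h -> continuous f ->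
  let I := `[a ord0 ord0, a ord0 ord0 + h[%classic in
  let Q := cube (rV_behead a) h in
  [/\ leb1.-integrable I (EFin \o (fun t => \int[lebn]_(v in Q) f (rV_cons (t, v)))),
      lebn.-integrable Q (EFin \o (fun v => \int[leb1]_(t in I) f (rV_cons (t, v)))),
      \int[lebS]_(x in cube a h) f x =
        \int[leb1]_(t in I) \int[lebn]_(v in Q) f (rV_cons (t, v)) &
      \int[lebS]_(x in cube a h) f x =
        \int[lebn]_(v in Q) \int[leb1]_(t in I) f (rV_cons (t, v))].
Proof.
move=> h0 fc I Q.
have mI : measurable (I : set (measurableTypeR R)) by exact: measurable_itv.
have mQ : measurable Q by exact: measurable_cube.
have mC := measurable_cube a h.
have iF : lebS.-integrable setT (EFin \o (f \_ (cube a h))).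
  by rewrite -restrict_EFin; apply/(integrable_mkcond _ mC); exact: cube_integrable.
have iG := integrable_rV_cons iF; have eG := integral_rV_cons iF.
set G := _ \o @rV_cons R n in iG.
have GE t v : G (t, v) = (if (t \in I) && (v \in Q) then f (rV_cons (t, v)) else 0)%:E.
  by rewrite /G /= /patch mem_cube_cons.
pose g t := \int[lebn]_(v in Q) f (rV_cons (t, v)).
pose k v := \int[leb1]_(t in I) f (rV_cons (t, v)).
have ig t : lebn.-integrable Q (EFin \o (fun v => f (rV_cons (t, v)))).
  by apply: cube_integrable => //; exact: continuous_slice.
have ik v : leb1.-integrable I (EFin \o (fun t => f (rV_cons (t, v)))).
  have : leb1.-integrable `[a ord0 ord0, a ord0 ord0 + h]
      (EFin \o (fun t => f (rV_cons (t, v)))).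
    apply: continuous_compact_integrable; first exact: segment_compact.
    by apply: continuous_subspaceT; exact: continuous_line.
  apply: integrableS => //.
  by move=> t; rewrite /I/= !in_itv/= => /andP[-> /ltW].
have FE : fubini_F lebn G = (EFin \o g) \_ I.
  apply/funext => t; rewrite /fubini_F /patch; case: ifPn => tI.
    have -> : (EFin \o g) t = (\int[lebn]_(v in Q) (f (rV_cons (t, v)))%:E)%E.
      by rewrite -[RHS]fineK//; apply: integrable_fin_num; [exact: mQ|exact: ig].
    rewrite [RHS]integral_mkcond.
    by apply: eq_integral => v _; rewrite GE tI /patch/=; case: ifP.
  by apply: integral0_eq => v _; rewrite GE (negbTE tI).
have GE' : fubini_G leb1 G = (EFin \o k) \_ Q.
  apply/funext => v; rewrite /fubini_G /patch; case: ifPn => vQ.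
    have -> : (EFin \o k) v = (\int[leb1]_(t in I) (f (rV_cons (t, v)))%:E)%E.
      by rewrite -[RHS]fineK//; apply: integrable_fin_num; [exact: mI|exact: ik].
    rewrite [RHS]integral_mkcond.
    by apply: eq_integral => t _; rewrite GE vQ andbT /patch/=; case: ifP.
  by apply: integral0_eq => t _; rewrite GE (negbTE vQ) andbF.
have i1 := integrable_fubini_F iG.
have mG := measurable_int _ iG.
have mfG := measurable_fubini_G iG.
(* Dominated by the inner integral of [|G|], whose outer integral is finite by Tonelli. *)
have i2 : lebn.-integrable setT (fubini_G leb1 G).
  apply/integrableP; split; first exact: mfG.
  have lt := (@integrable21ltyP _ _ _ _ R leb1 lebn G mG).1 iG.
  apply: le_lt_trans lt.
  apply: ge0_le_integral => //; first exact: measurableT_comp.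
    have := @measurable_fun_fubini_tonelli_G _ _ _ _ R leb1 (abse \o G).
    apply; first exact: measurable_int (integrable_abse iG).
    by move=> x; exact: abse_ge0.
  move=> v _; apply: le_abse_integral => //.
  exact: measurableT_comp.
have i1' : leb1.-integrable setT ((EFin \o g) \_ I) by rewrite -FE.
have i2' : lebn.-integrable setT ((EFin \o k) \_ Q) by rewrite -GE'.
have e1 : (\int[leb1 \x lebn]_p G p = \int[leb1]_t ((EFin \o g) \_ I) t)%E.
  by rewrite -FE; exact/esym/integral12_prod_meas1.
have e2 : (\int[leb1 \x lebn]_p G p = \int[lebn]_v ((EFin \o k) \_ Q) v)%E.
  by rewrite -GE'; exact/esym/integral21_prod_meas1.
split.
- exact/(integrable_mkcond _ mI).
- exact/(integrable_mkcond _ mQ).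
- rewrite Rintegral_mkcond /Rintegral; congr fine.
  by transitivity (\int[leb1 \x lebn]_p G p)%E => //; rewrite e1 [in RHS]integral_mkcond.
- rewrite Rintegral_mkcond /Rintegral; congr fine.
  by transitivity (\int[leb1 \x lebn]_p G p)%E => //; rewrite e2 [in RHS]integral_mkcond.
Qed.

End fubini.
End row_vectors.

(** * Variance estimates on a set of finite measure *)

Section mean_oscillation.
Context d (T : measurableType d) (R : realType) (mu : {measure set T -> \bar R}).
Context (D : set T) (m : R).
Hypotheses (mD : measurable D) (mDm : mu D = m%:E).

Let cst_int c : mu.-integrable D (EFin \o cst c).
Proof.
apply: measurable_bounded_integrable => //; last exact: bounded_cst.
by rewrite mDm ltry.
Qed.

Lemma integrable_sqrD_cst (f : T -> R) c : mu.-integrable D (EFin \o f) ->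
  mu.-integrable D (EFin \o (fun x => f x ^+ 2)) ->
  mu.-integrable D (EFin \o (fun x => (f x + c) ^+ 2)) /\
  \int[mu]_(x in D) (f x + c) ^+ 2 =
    \int[mu]_(x in D) f x ^+ 2 + 2 * c * (\int[mu]_(x in D) f x) + c ^+ 2 * m.
Proof.
move=> fi f2i.
have i1 : mu.-integrable D (EFin \o (fun x => 2 * c * f x)).
  by have := integrableZl mD (2 * c) fi.
have i2 : mu.-integrable D (EFin \o (fun x => 2 * c * f x + c ^+ 2)).
  by have := integrableD mD i1 (cst_int (c ^+ 2)).
have E : (fun x => (f x + c) ^+ 2) = (fun x => f x ^+ 2 + (2 * c * f x + c ^+ 2)).
  by apply/funext => x; ring.
split; first by rewrite E; have := integrableD mD f2i i2.
rewrite E RintegralD// RintegralD//; last exact: cst_int.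
by rewrite RintegralZl// Rintegral_cst// mDm/= addrA.
Qed.

(** The integral of [(f + t) ^ 2] is a nonnegative quadratic polynomial in [t]; this is its
    discriminant. *)
Lemma Rintegral_sqr_le (f : T -> R) : 0 <= m -> mu.-integrable D (EFin \o f) ->
  mu.-integrable D (EFin \o (fun x => f x ^+ 2)) ->
  (\int[mu]_(x in D) f x) ^+ 2 <= m * \int[mu]_(x in D) f x ^+ 2.
Proof.
move=> m0 fi f2i; rewrite mulrC; apply: discriminant_le => // t.
have [_ <-] := integrable_sqrD_cst t fi f2i.
by apply: Rintegral_ge0 => x _; rewrite sqr_ge0.
Qed.

(** The last term is the contribution of the mean [G / m]; the rest is the variance. As
    [g s - G / m] is the average of [g s - g t] over [t], its square is at most the average of
    [(g s - g t) ^ 2], hence at most [M]. *)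
Lemma oscillation_le (g : T -> R) M : 0 < m -> mu.-integrable D (EFin \o g) ->
  mu.-integrable D (EFin \o (fun x => g x ^+ 2)) ->
  (forall s t, D s -> D t -> (g s - g t) ^+ 2 <= M) ->
  \int[mu]_(x in D) g x ^+ 2 <= m * M + m^-1 * (\int[mu]_(x in D) g x) ^+ 2.
Proof.
move=> m0 gi g2i gM.
set G := \int[mu]_(x in D) g x.
have [ic Ec] := integrable_sqrD_cst (- (G / m)) gi g2i.
have E1 : \int[mu]_(x in D) g x ^+ 2 = \int[mu]_(x in D) (g x + - (G / m)) ^+ 2 + m^-1 * G ^+ 2.
  by rewrite Ec -/G; field; rewrite gt_eqF.
rewrite E1 lerD2r.
have M0 x : D x -> 0 <= M by move=> Dx; have := gM x x Dx Dx; rewrite subrr expr0n.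
rewrite [leRHS]mulrC; have <- : \int[mu]_(x in D) M = M * m by rewrite Rintegral_cst// mDm.
apply: le_Rintegral => //; first exact: cst_int.
move=> s Ds.
have [gsi _] := integrable_sqrD_cst (- g s) gi g2i.
have i1 : mu.-integrable D (EFin \o (fun x => g x + - g s)).
  by have := integrableD mD gi (cst_int (- g s)).
have := Rintegral_sqr_le (ltW m0) i1 gsi.
rewrite RintegralD//; last exact: cst_int.
rewrite Rintegral_cst// mDm/= -/G.
have -> : G + - g s * m = - m * (g s + - (G / m)) by field; rewrite gt_eqF.
rewrite exprMn sqrrN expr2 -mulrA ler_pM2l// => le1.
have le2 : \int[mu]_(x in D) (g x + - g s) ^+ 2 <= M * m.
  have <- : \int[mu]_(x in D) M = M * m by rewrite Rintegral_cst// mDm.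
  apply: le_Rintegral => //.
    exact: cst_int.
  by move=> t Dt; exact: gM.
by have := le_trans le1 le2; rewrite mulrC ler_pM2r.
Qed.

End mean_oscillation.

(** * Oscillation along a line *)

Section poincare.
Context {R : realType}.
Local Notation leb1 := (@lebesgue_measure R).

Lemma le_Rintegral_subset d (T : measurableType d) (mu : {measure set T -> \bar R})
    (A B : set T) (f : T -> R) : measurable A -> measurable B ->
  A `<=` B -> (forall x, B x -> 0 <= f x) -> mu.-integrable B (EFin \o f) ->
  \int[mu]_(x in A) f x <= \int[mu]_(x in B) f x.
Proof.
move=> mA mB AB f0 fi; apply: fine_le.
- by apply: integrable_fin_num => //; exact: integrableS fi.
- exact: integrable_fin_num.
- apply: ge0_subset_integral => //.
  exact: measurable_int fi.
Qed.

Lemma continuous_itv_integrable (f : R -> R) a b : continuous f ->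
  leb1.-integrable `[a, b] (EFin \o f) /\ leb1.-integrable `[a, b[ (EFin \o f).
Proof.
move=> fc; have i1 : leb1.-integrable `[a, b] (EFin \o f).
  apply: continuous_compact_integrable; first exact: segment_compact.
  exact: continuous_subspaceT.
split=> //; apply: integrableS i1 => //.
by move=> t /=; rewrite !in_itv/= => /andP[-> /ltW].
Qed.

Lemma Rintegral_derive1 (F : R -> R) (a b : R) : a <= b ->
  (forall x, derivable F x 1) -> continuous (derive1 F) ->
  \int[leb1]_(x in `[a, b]) derive1 F x = F b - F a.
Proof.
rewrite le_eqVlt => /predU1P[->|ab] dF cF.
  by rewrite set_itv1 Rintegral_set1 subrr.
have Fc x : {for x, continuous F} by apply/differentiable_continuous/derivable1_diffP.
have dLR : derivable_oo_LRcontinuous F a b.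
  by split; [move=> x _; exact: dF|apply: cvg_at_right_filter; exact: Fc
            |apply: cvg_at_left_filter; exact: Fc].
have cab : {within `[a, b], continuous (derive1 F)} by exact: continuous_subspaceT.
have := continuous_FTC2 ab cab dLR (fun x _ => erefl).
by rewrite /Rintegral => ->.
Qed.

(** The fundamental theorem of calculus and Cauchy-Schwarz on the segment between [t] and [s], of
    length at most [h]; then the segment is enlarged to the whole interval. *)
Lemma line_oscillation (F : R -> R) a h s t : 0 <= h ->
  (forall x, derivable F x 1) -> continuous (derive1 F) ->
  s \in `[a, a + h[ -> t \in `[a, a + h[ ->
  (F s - F t) ^+ 2 <= h * \int[leb1]_(x in `[a, a + h[) derive1 F x ^+ 2.
Proof.
move=> h0 dF cF.
have c2 : continuous (fun x => derive1 F x ^+ 2) by move=> x; apply: cvgM; exact: cF.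
wlog ts : s t / t <= s => [H|].
  by case: (leP t s) => [|/ltW] ts sI tI; [|rewrite -sqrrN opprB]; apply: H.
rewrite !in_itv/= => /andP[has sh] /andP[hat th].
rewrite -Rintegral_derive1//.
have mts : leb1 `[t, s] = (s - t)%:E.
  rewrite lebesgue_measure_itv/= lte_fin; case: ltP => [_|st]; first by rewrite -EFinB.
  by congr EFin; apply/eqP; rewrite eq_sym subr_eq0 eq_le st ts.
have [i1 _] := continuous_itv_integrable t s cF.
have [i2 _] := continuous_itv_integrable t s c2.
have [_ i3] := continuous_itv_integrable a (a + h) c2.
have st0 : 0 <= s - t by rewrite subr_ge0.
have mI : measurable (`[t, s]%classic : set R) by exact: measurable_itv.
apply: le_trans (@Rintegral_sqr_le _ _ _ leb1 _ _ mI mts (derive1 F) st0 i1 i2) _.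
apply: ler_pM => //; first by apply: Rintegral_ge0 => x _; rewrite sqr_ge0.
  lra.
apply: le_Rintegral_subset => //.
  by move=> x /=; rewrite !in_itv/= => /andP[tx xs]; apply/andP; split; lra.
by move=> x _; rewrite sqr_ge0.
Qed.

End poincare.

Lemma integrable_Rintegral_sum d (T : measurableType d) (R : realType)
    (mu : {measure set T -> \bar R}) (D : set T) I (s : seq I) (K : I -> T -> R) :
  measurable D -> (forall j, mu.-integrable D (EFin \o K j)) ->
  mu.-integrable D (EFin \o (fun x => \sum_(j <- s) K j x)) /\
  \int[mu]_(x in D) (\sum_(j <- s) K j x) = \sum_(j <- s) \int[mu]_(x in D) K j x.
Proof.
move=> mD Ki; elim: s => [|j s [si sE]].
  rewrite big_nil (_ : (fun _ => _) = cst 0); last by apply/funext => x; rewrite big_nil.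
  split; first exact: integrable0.
  by rewrite /cst Rintegral_cst// mul0r.
have E : (fun x => \sum_(j <- j :: s) K j x) = (fun x => K j x + \sum_(j <- s) K j x).
  by apply/funext => x; rewrite big_cons.
split; first by rewrite E; have := integrableD mD (Ki j) si.
by rewrite E RintegralD// big_cons sE.
Qed.

(** * Poincare's inequality and vanishing integrals of derivatives on a cube *)

Section cube_calculus.
Context {R : realType}.
Local Notation leb1 := (@lebesgue_measure R).
Local Notation leb n := (lebesgue_rV R n).

Lemma continuous_sqr n (f : 'rV[R]_n -> R) : continuous f ->
  continuous (fun x => f x ^+ 2).
Proof. by move=> fc x; exact: (cvgM (fc x) (fc x)). Qed.

Lemma C1_continuous n (f : 'rV[R]_n -> R) : C1 f -> continuous f.
Proof. by case. Qed.

Lemma C1_partial_continuous n (f : 'rV[R]_n -> R) i : C1 f -> continuous (partial i f).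
Proof. by case=> _ /(_ i)[]. Qed.

Lemma itv_lebesgueE (a h : R) : 0 <= h -> leb1 `[a, a + h[ = h%:E.
Proof.
move=> h0; rewrite lebesgue_measure_itv/= lte_fin ltrDl.
have [h1|h1] := ltP 0 h; first by rewrite -EFinB addrC addKr.
by congr EFin; apply/eqP; rewrite eq_le h0 h1.
Qed.

(** Cauchy-Schwarz over the face, of measure [h ^ n], then [line_oscillation] on each line
    orthogonal to it, then Fubini. *)
Lemma slice_mean_oscillation n (a : 'rV[R]_n.+1) h (f : 'rV[R]_n.+1 -> R) s t :
  0 <= h -> C1 f ->
  s \in `[a ord0 ord0, a ord0 ord0 + h[ -> t \in `[a ord0 ord0, a ord0 ord0 + h[ ->
  (\int[leb n]_(v in cube (rV_behead a) h) f (rV_cons (s, v))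
   - \int[leb n]_(v in cube (rV_behead a) h) f (rV_cons (t, v))) ^+ 2 <=
  h ^+ n * (h * \int[leb n.+1]_(x in cube a h) partial ord0 f x ^+ 2).
Proof.
move=> h0 Cf sI tI; set Q := cube _ h.
have fc := C1_continuous Cf; have pc := C1_partial_continuous (i := ord0) Cf.
have mQ : measurable Q by exact: measurable_cube.
have ci r : (leb n).-integrable Q (EFin \o (fun v => f (rV_cons (r, v)))).
  by apply: cube_integrable => //; exact: continuous_slice.
have dc : continuous (fun v => f (rV_cons (s, v)) - f (rV_cons (t, v))).
  have c r := continuous_slice (t := r) fc.
  by move=> v; first [exact: (continuousB (c s v) (c t v)) |
    apply: cvgB; [exact: (c s v)|exact: (c t v)]].
rewrite -RintegralB//.
have di := cube_integrable (rV_behead a) h0 dc.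
have d2i := cube_integrable (rV_behead a) h0 (continuous_sqr dc).
have hn0 : 0 <= h ^+ n by rewrite exprn_ge0.
have := @Rintegral_sqr_le _ _ _ (leb n) _ _ mQ (lebesgue_cube _ h0) _ hn0 di d2i.
move=> /le_trans; apply; apply: ler_wpM2l => //.
have [_ ki _ ->] := cube_fubini a h0 (continuous_sqr pc).
rewrite -RintegralZl//.
apply: le_Rintegral => //; first by have := integrableZl mQ h ki.
move=> v _; have := @line_oscillation R (fun r => f (rV_cons (r, v))) (a ord0 ord0) h s t h0.
rewrite (_ : derive1 _ = fun r => partial ord0 f (rV_cons (r, v))).
  apply=> //; last exact: continuous_line.
  move=> x; apply: derivable_line; have [_ /(_ ord0)[+ _]] := Cf; exact.
by apply/funext => r; exact: derive1_line.
Qed.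

(** Induction on the dimension. On each slice the induction hypothesis leaves [h ^- n] times the
    square of the slice integral [g t]. Integrating this over [t] with [oscillation_le] produces the
    missing derivative in direction 0 and the square of the full integral; every direction gets the
    same factor [h ^ 2]. *)
Lemma cube_poincare n (a : 'rV[R]_n) h (f : 'rV[R]_n -> R) : 0 < h -> C1 f ->
  \int[leb n]_(x in cube a h) f x ^+ 2 <=
  h ^+ 2 * (\sum_(i < n) \int[leb n]_(x in cube a h) partial i f x ^+ 2)
  + (h ^+ n)^-1 * (\int[leb n]_(x in cube a h) f x) ^+ 2.
Proof.
move=> h0; have h0' := ltW h0; elim: n => [|n IHn] in a f *.
  (* In dimension 0 the space is a point of mass 1, so both sides equal [f 0 ^ 2]. *)
  move=> _; rewrite big_ord0 mulr0 add0r expr0 invr1 mul1r.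
  have mC := measurable_cube a h; have CE := lebesgue_cube a h0'.
  have cE c : \int[leb 0]_(x in cube a h) (cst c) x = c.
    rewrite /cst Rintegral_cst//.
    transitivity (c * fine (h ^+ 0)%:E); last by rewrite /= expr0 mulr1.
    by congr (c * fine _); exact: CE.
  rewrite (eq_Rintegral _ (g := cst (f 0 ^+ 2))); last first.
    by move=> x _ /=; rewrite [x]thinmx0.
  rewrite [in leRHS](eq_Rintegral _ (g := cst (f 0))); last first.
    by move=> x _ /=; rewrite [x]thinmx0.
  by rewrite !cE.
move=> Cf; have fc := C1_continuous Cf.
pose I := `[a ord0 ord0, a ord0 ord0 + h[%classic; pose Q := cube (rV_behead a) h.
have mI : measurable (I : set (measurableTypeR R)) by exact: measurable_itv.
pose g t := \int[leb n]_(v in Q) f (rV_cons (t, v)).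
have [f2i _ f2E _] := cube_fubini a h0' (continuous_sqr fc).
have [gi _ gE _] := cube_fubini a h0' fc.
have pF j := cube_fubini a h0' (continuous_sqr (C1_partial_continuous (i := lift ord0 j) Cf)).
(* [|g| <= h ^ n * |M|] for a bound [M] of [|f|] on the cube, so [g ^ 2] is bounded on an interval
   of finite length. *)
have g2i : leb1.-integrable I (EFin \o (fun t => g t ^+ 2)).
  have [M fM] := continuous_bounded_cube a h fc.
  apply: measurable_bounded_integrable => //.
  - by have := itv_lebesgueE (a ord0 ord0) h0' => /= ->; rewrite ltry.
  - by apply: measurable_funX; apply/measurable_EFinP; exact: measurable_int gi.
  have M0 t v : I t -> Q v -> `|f (rV_cons (t, v))| <= M.
    by move=> It Qv; apply: fM; apply/cube_cons.
  exists ((h ^+ n * `|M|) ^+ 2); split; first exact: num_real.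
  move=> x Mx t It; apply: le_trans (ltW Mx).
  rewrite /= ger0_norm ?sqr_ge0// -real_normK ?num_real// lerXn2r ?nnegrE ?mulr_ge0 ?exprn_ge0//.
  have si : (leb n).-integrable Q (EFin \o (fun v => f (rV_cons (t, v)))).
    by apply: cube_integrable => //; exact: continuous_slice.
  have mQ : measurable Q by exact: measurable_cube.
  apply: le_trans (le_normr_Rintegral mQ si) _.
  have QE : fine (leb n Q) = h ^+ n by have := lebesgue_cube (rV_behead a) h0' => /= ->.
  rewrite mulrC -QE.
  have <- : \int[leb n]_(v in Q) `|M| = `|M| * fine (leb n Q) by rewrite Rintegral_cst.
  apply: le_Rintegral => //.
  - by have := integrable_norm si.
  - by apply: measurable_bounded_integrable => //; [have := lebesgue_cube (rV_behead a) h0' => /= ->; rewrite ltry|exact: bounded_cst].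
  - by move=> v Qv; apply: le_trans (M0 _ _ It Qv) (ler_norm _).
pose K j t := \int[leb n]_(v in Q) partial (lift ord0 j) f (rV_cons (t, v)) ^+ 2.
have Ki j : leb1.-integrable I (EFin \o K j) by have [] := pF j.
have KE j : \int[leb1]_(t in I) K j t =
    \int[leb n.+1]_(x in cube a h) partial (lift ord0 j) f x ^+ 2.
  by have [_ _ ->] := pF j.
have [si sE] := @integrable_Rintegral_sum _ _ R leb1 _ _ (index_enum 'I_n) K mI Ki.
have hsi : leb1.-integrable I (EFin \o (fun t => h ^+ 2 * \sum_j K j t)).
  by have := integrableZl mI (h ^+ 2) si.
have hgi : leb1.-integrable I (EFin \o (fun t => (h ^+ n)^-1 * g t ^+ 2)).
  by have := integrableZl mI (h ^+ n)^-1 g2i.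
have s1 : \int[leb n.+1]_(x in cube a h) f x ^+ 2 <=
    \int[leb1]_(t in I) (h ^+ 2 * (\sum_j K j t) + (h ^+ n)^-1 * g t ^+ 2).
  rewrite f2E; apply: le_Rintegral => //.
    by have := integrableD mI hsi hgi.
  move=> t It; set S := \sum_j K j t; rewrite /g.
  have IH := IHn (rV_behead a) _ (C1_slice t Cf).
  rewrite (_ : \sum_(i < n) _ = S) in IH.
    exact: IH.
  by apply: eq_bigr => j _; apply: eq_Rintegral => v _; rewrite partial_slice.
apply: le_trans s1 _; rewrite RintegralD// !RintegralZl// sE.
under eq_bigr do rewrite KE.
rewrite big_ord_recl gE -/g.
set P0 := \int[leb n.+1]_(x in cube a h) partial ord0 f x ^+ 2.
have osc := oscillation_le mI (itv_lebesgueE _ h0') h0 gi g2i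
  (fun s t Is It => slice_mean_oscillation h0' Cf Is It).
have hn0 : 0 < h ^+ n by rewrite exprn_gt0.
set S1 := \sum_(j < n) _.
set G2 := \int[leb1]_(t in I) g t ^+ 2; set G := \int[leb1]_(t in _) g t.
have {}osc : G2 <= h * (h ^+ n * (h * P0)) + h^-1 * G ^+ 2 by exact: osc.
suff : (h ^+ n)^-1 * G2 <= h ^+ 2 * P0 + (h ^+ n.+1)^-1 * G ^+ 2.
  by rewrite (mulrDr (h ^+ 2)); lra.
rewrite -(ler_pM2l hn0) mulrA mulfV ?gt_eqF// mul1r.
apply: le_trans osc _; rewrite (exprS h n) le_eqVlt; apply/orP; left; apply/eqP; field.
by rewrite !gt_eqF.
Qed.

(** For direction 0, integrate first along the lines parallel to that axis: [f] vanishes at both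
    ends, as the hypothesis includes the faces [|x_j| = M]. The other directions are handled by
    induction, slice by slice. *)
Lemma cube_integral_partial0 n (f : 'rV[R]_n -> R) M i : 0 <= M -> C1 f ->
  (forall x : 'rV[R]_n, (exists j, M <= `|x ord0 j|) -> f x = 0) ->
  \int[leb n]_(x in cube (const_mx (- M)) (M *+ 2)) partial i f x = 0.
Proof.
move=> M0; have M20 : 0 <= M *+ 2 by rewrite mulrn_wge0.
elim: n i f => [[]//|n IHn] i f Cf f0.
have bE : rV_behead (const_mx (- M) : 'rV[R]_n.+1) = const_mx (- M).
  by apply/rowP => j; rewrite !mxE.
have [j ->|->] := unliftP ord0 i.
  have [_ _ -> _] := cube_fubini (const_mx (- M)) M20 (C1_partial_continuous (i := lift ord0 j) Cf).
  rewrite (eq_Rintegral _ (g := cst 0)); first by rewrite Rintegral_cst//= mul0r.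
  move=> t _; rewrite bE /=; under eq_Rintegral do rewrite -partial_slice.
  apply: IHn; first exact: C1_slice.
  by move=> x [k xk]; apply: f0; exists (lift ord0 k); rewrite rV_cons_lift.
have pc := C1_partial_continuous (i := ord0) Cf.
have [_ _ _ ->] := cube_fubini (const_mx (- M)) M20 pc.
rewrite (eq_Rintegral _ (g := cst 0)).
  by rewrite Rintegral_cst ?mul0r//; exact: measurable_cube.
move=> v _; rewrite /= mxE (_ : - M + M *+ 2 = M); last by rewrite mulr2n addKr.
have [i1 _] := continuous_itv_integrable (- M) M (continuous_line (v := v) pc).
have [_ i2] := continuous_itv_integrable (- M) M (continuous_line (v := v) pc).
rewrite Rintegral_itv_bndo_bndc//.
have dE : derive1 (fun r => f (rV_cons (r, v))) = fun r => partial ord0 f (rV_cons (r, v)).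
  by apply/funext => r; exact: derive1_line.
have -> : \int[leb1]_(x in `[- M, M]) partial ord0 f (rV_cons (x, v)) =
    \int[leb1]_(x in `[- M, M]) derive1 (fun r => f (rV_cons (r, v))) x.
  by apply: eq_Rintegral => t _; rewrite derive1_line.
rewrite Rintegral_derive1.
- by rewrite !f0 ?subrr//; exists ord0; rewrite rV_cons0 ?normrN ler_norm.
- lra.
- by move=> x; apply: derivable_line; have [_ /(_ ord0)[+ _]] := Cf; exact.
- by rewrite dE; exact: continuous_line.
Qed.

End cube_calculus.

(** * Test functions *)

Section smooth_functions.
Context {R : realType} {N : nat}.
Implicit Types f g : 'rV[R]_N -> R.

(** [smooth] quantifies over lists of directions, which the Leibniz rule does not respect. Counting
    orders of differentiation instead gives closure under products by induction on [k]. *)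
Fixpoint Ck k f : Prop := if k is k'.+1 then
  continuous f /\ forall i, (forall x, derivable f x (basis_rV i)) /\ Ck k' (partial i f)
  else continuous f.

Lemma CkW k f : Ck k.+1 f -> Ck k f.
Proof.
elim: k f => [|k IHk] f; first by case.
by move=> [fc fd]; split=> // i; have [di /IHk Ci] := fd i.
Qed.

Lemma smooth_partial i f : smooth f -> smooth (partial i f).
Proof. by move=> sf s; have := sf (rcons s i); rewrite foldr_rcons. Qed.

Lemma smoothP f : smooth f <-> forall k, Ck k f.
Proof.
split=> [sf k|Cf s].
  elim: k f sf => [|k IHk] f sf; first by have [] := sf [::].
  have [fc fd] := sf [::]; split=> // i; split; first exact: fd.
  exact/IHk/smooth_partial.
(* [foldr] differentiates in the last direction of the list first, whence the induction from the end
   of the list. *)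
suff H k g : Ck (size s + k.+1) g -> Ck k.+1 (foldr partial g s).
  have := H 0 f (Cf _) => -[gc gd]; split=> // i; exact: (gd i).1.
elim/last_ind: s k g => [//|s i IHs] k g; rewrite size_rcons => -[_ /(_ i)[_ Cg]].
by rewrite foldr_rcons; exact: IHs.
Qed.

Lemma smooth_C1 f : smooth f -> C1 f.
Proof.
by move=> /smoothP/(_ 1)[fc fd]; split=> // i; have [di Ci] := fd i; split.
Qed.

Lemma smooth_continuous f : smooth f -> continuous f.
Proof. by move=> /smooth_C1[]. Qed.

Lemma smooth_derivable f i x : smooth f -> derivable f x (basis_rV i).
Proof. by move=> /smooth_C1[_ /(_ i)[]]. Qed.

Lemma partialD i f g : (forall x, derivable f x (basis_rV i)) ->
  (forall x, derivable g x (basis_rV i)) ->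
  partial i (f + g) = partial i f + partial i g.
Proof. by move=> df dg; apply/funext => x; rewrite /partial deriveD. Qed.

Lemma partialZ i (a : R) f : (forall x, derivable f x (basis_rV i)) ->
  partial i (a *: f) = a *: partial i f.
Proof. by move=> df; apply/funext => x; rewrite /partial deriveZ. Qed.

Lemma partialM i f g : (forall x, derivable f x (basis_rV i)) ->
  (forall x, derivable g x (basis_rV i)) ->
  partial i (f * g) = f * partial i g + g * partial i f.
Proof. by move=> df dg; apply/funext => x; rewrite /partial deriveM. Qed.

Lemma CkD k f g : Ck k f -> Ck k g -> Ck k (f + g).
Proof.
elim: k f g => [|k IHk] f g; first by move=> fc gc x; exact: (cvgD (fc x) (gc x)).
move=> [fc fd] [gc gd]; split; first by move=> x; exact: (cvgD (fc x) (gc x)).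
move=> i; have [di Ci] := fd i; have [di' Ci'] := gd i; split.
  by move=> x; exact: derivableD.
by rewrite partialD//; exact: IHk.
Qed.

Lemma CkZ k (a : R) f : Ck k f -> Ck k (a *: f).
Proof.
have cZ f' : continuous f' -> continuous (a *: f').
  by move=> fc x; exact: (cvgM (cvg_cst a) (fc x)).
elim: k f => [|k IHk] f; first exact: cZ.
move=> [fc fd]; split; first exact: cZ.
move=> i; have [di Ci] := fd i; split; first by move=> x; exact: derivableZ.
by rewrite partialZ//; exact: IHk.
Qed.

Lemma CkM k f g : Ck k f -> Ck k g -> Ck k (f * g).
Proof.
elim: k f g => [|k IHk] f g; first by move=> fc gc x; exact: (cvgM (fc x) (gc x)).
move=> Cf Cg; have [fc fd] := Cf; have [gc gd] := Cg.
split; first by move=> x; exact: (cvgM (fc x) (gc x)).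
move=> i; have [di Ci] := fd i; have [di' Ci'] := gd i; split.
  by move=> x; exact: derivableM.
by rewrite partialM//; apply: CkD; apply: IHk => //; exact: CkW.
Qed.

Lemma Ck_cst k (c : R) : Ck k (cst c).
Proof.
have d0 i : partial i (cst c : 'rV[R]_N -> R) = cst 0.
  by apply/funext => x; rewrite /partial derive_cst.
elim: k c d0 => [|k IHk] c d0; first exact: cst_continuous.
split; first exact: cst_continuous.
move=> i; split; first by move=> x; exact: derivable_cst.
rewrite d0; apply: IHk => j; by apply/funext => x; rewrite /partial derive_cst.
Qed.

Lemma smoothD f g : smooth f -> smooth g -> smooth (f + g).
Proof. by move=> /smoothP sf /smoothP sg; apply/smoothP => k; exact: CkD. Qed.

Lemma smoothZ a f : smooth f -> smooth (a *: f).
Proof. by move=> /smoothP sf; apply/smoothP => k; exact: CkZ. Qed.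

Lemma smoothM f g : smooth f -> smooth g -> smooth (f * g).
Proof. by move=> /smoothP sf /smoothP sg; apply/smoothP => k; exact: CkM. Qed.

End smooth_functions.

(** * Closure properties of test functions and integration by parts *)

Section test_functions.
Context {R : realType} {N : nat}.
Variable Omega : set 'rV[R]_N.
Implicit Types f g phi psi : 'rV[R]_N -> R.
Local Notation leb := (lebesgue_rV R N).
Local Notation supp f := (closure [set x | f x != 0]).

Lemma test_functionS f g : test_function Omega f -> smooth g ->
  [set x | g x != 0] `<=` supp f -> test_function Omega g.
Proof.
move=> [_ cf fO] sg gf.
have gf' : supp g `<=` supp f.
  by have := closureS gf; rewrite -((closure_id _).1 (@closed_closure _ _)).
split=> //; last exact: subset_trans fO.
exact: (subclosed_compact (@closed_closure _ _) cf gf').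
Qed.

Lemma test_function0 : test_function Omega 0.
Proof.
have -> : (0 : 'rV[R]_N -> R) = cst 0 by [].
split; first by apply/smoothP => k; exact: Ck_cst.
  rewrite (_ : [set _ | _] = set0) ?closure0; first exact: compact0.
  by apply/seteqP; split=> x //=; rewrite eqxx.
rewrite (_ : [set _ | _] = set0) ?closure0//.
by apply/seteqP; split=> x //=; rewrite eqxx.
Qed.

Lemma test_functionZ a f : test_function Omega f -> test_function Omega (a *: f).
Proof.
move=> tf; have [sf _ _] := tf; apply: (test_functionS tf); first exact: smoothZ.
apply: subset_trans (@subset_closure _ _) => x /=; apply: contra_neq => fx.
by rewrite fctE fx scaler0.
Qed.

Lemma test_functionD f g : test_function Omega f -> test_function Omega g ->
  test_function Omega (f + g).
Proof.
move=> [sf cf fO] [sg cg gO].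
have sub : supp (f + g) `<=` supp f `|` supp g.
  rewrite -closureU; apply: closureS => x /= fgx.
  have [fx|] := eqVneq (f x) 0; last by left.
  by right; apply: contra_neq fgx => gx; rewrite fctE fx gx addr0.
split; first exact: smoothD.
  by apply: (subclosed_compact _ _ sub); [exact: closed_closure|exact: compactU].
by move=> x /sub[/fO|/gO].
Qed.

Lemma test_function_partial i f : test_function Omega f ->
  test_function Omega (partial i f).
Proof.
move=> tf; have [sf _ _] := tf; apply: (test_functionS tf); first exact: smooth_partial.
move=> x /= fx; apply: contrapT => nx; move/negP: fx; apply; apply/eqP.
have opn : open (~` supp f) by exact/closed_openC/closed_closure.
rewrite /partial (@near_eq_derive _ _ _ f (cst 0)) ?derive_cst//.
have : nbhs x (~` supp f) by apply: open_nbhs_nbhs.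
apply: filterS => y ny; apply/eqP/negPn/negP => fy; apply: ny.
exact: subset_closure.
Qed.

Lemma test_function_out f x : test_function Omega f -> ~ Omega x -> f x = 0.
Proof.
move=> [_ _ fO] nx; apply/eqP/negPn/negP => fx; apply/nx/fO.
exact: subset_closure.
Qed.

Lemma test_function_restrict f : test_function Omega f -> f \_ Omega = f.
Proof.
move=> tf; apply/funext => x; rewrite /patch; case: ifPn => //.
by rewrite notin_setE => /(test_function_out tf) ->.
Qed.

Lemma normr_coord_le (x : 'rV[R]_N) j : `|x ord0 j| <= `|x|.
Proof.
rewrite [leRHS]/Num.norm /= mx_normrE; apply/bigmax_geP; right => /=.
by exists (ord0, j).
Qed.

Lemma test_function_bounded_support f : test_function Omega f ->
  exists2 M, 0 <= M & forall x : 'rV[R]_N, (exists j, M <= `|x ord0 j|) -> f x = 0.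
Proof.
move=> [_ /compact_bounded[M [_ bM]] _].
(* [|M| + 1] already bounds the support; one unit more makes the function vanish on the faces of the
   cube as well. *)
exists (`|M| + 2); first by rewrite addr_ge0.
move=> x [j xj]; apply/eqP/negPn/negP => fx.
have := bM (`|M| + 1) _ x (@subset_closure _ [set x | f x != 0] x fx).
rewrite (le_lt_trans (ler_norm M)) ?ltrDl// => /(_ isT) xM.
have := le_trans xj (le_trans (normr_coord_le x j) xM); lra.
Qed.

Lemma cube_restrict f M : 0 <= M ->
  (forall x : 'rV[R]_N, (exists j, M <= `|x ord0 j|) -> f x = 0) ->
  f \_ (cube (const_mx (- M)) (M *+ 2)) = f.
Proof.
move=> M0 fM; apply/funext => x; rewrite /patch; case: ifPn => //.
rewrite notin_setE => nQ; apply/esym/fM; apply: contrapT => nj; apply: nQ => j.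
rewrite in_itv/= !mxE (_ : - M + M *+ 2 = M); last by rewrite mulr2n addKr.
have : `|x ord0 j| < M by rewrite ltNge; apply/negP => Mj; apply: nj; exists j.
by rewrite ltr_norml => /andP[/ltW -> ->].
Qed.

(** The derivative of [phi * psi] integrates to zero over a cube outside which [phi] and its
    derivative vanish. The cube may leave [Omega], because these functions vanish there too. *)
Lemma test_function_integral_partialM phi psi i :
  test_function Omega phi -> test_function Omega psi ->
  L2dot Omega phi (partial i psi) = - L2dot Omega (partial i phi) psi.
Proof.
move=> tphi tpsi; have [s1 _ _] := tphi; have [s2 _ _] := tpsi.
have [M M0 phiM] := test_function_bounded_support tphi.
have M20 : 0 <= M *+ 2 by rewrite mulrn_wge0.
have [M' M'0 phiM'] := test_function_bounded_support (test_function_partial i tphi).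
pose Q := cube (const_mx (- Num.max M M') : 'rV[R]_N) (Num.max M M' *+ 2).
have MM0 : 0 <= Num.max M M' by rewrite le_max M0.
have MM20 : 0 <= Num.max M M' *+ 2 by rewrite mulrn_wge0.
have E f : f \_ Omega = f -> f \_ Q = f ->
    \int[leb]_(x in Omega) f x = \int[leb]_(x in Q) f x.
  by move=> f1 f2; rewrite Rintegral_mkcond [RHS]Rintegral_mkcond f1 f2.
have resM f g A : f \_ A = f -> (f * g) \_ A = f * g.
  move=> fA; apply/funext => x; rewrite /patch; case: ifPn => // xA.
  by rewrite -fA fctE /patch (negbTE xA) mul0r.
have Q1 : phi \_ Q = phi.
  by apply: cube_restrict => // x [j]; rewrite ge_max => /andP[Mj _]; apply: phiM; exists j.
have Q2 : partial i phi \_ Q = partial i phi.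
  by apply: cube_restrict => // x [j]; rewrite ge_max => /andP[_ Mj]; apply: phiM'; exists j.
have O1 := test_function_restrict tphi.
have O2 := test_function_restrict (test_function_partial i tphi).
rewrite /L2dot (E (phi * partial i psi)) ?resM// (E (partial i phi * psi)) ?resM//.
apply/eqP; rewrite -addr_eq0 -RintegralD.
- have sM := smoothM s1 s2.
  have := @cube_integral_partial0 R N _ (Num.max M M') i MM0 (smooth_C1 sM).
  rewrite partialM; try by move=> x; exact: smooth_derivable.
  move=> H; rewrite -[X in _ == X]H; last first.
    move=> x [j]; rewrite ge_max => /andP[Mj _]; rewrite fctE phiM ?mul0r//.
    by exists j.
  by apply/eqP/eq_Rintegral => x _; rewrite !fctE [in RHS](mulrC (psi x)).
- exact: measurable_cube.
- apply: cube_integrable => // x; apply: (smooth_continuous (smoothM s1 (smooth_partial i s2))).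
- apply: cube_integrable => // x; apply: (smooth_continuous (smoothM (smooth_partial i s1) s2)).
Qed.

Lemma test_function_L2 phi : test_function Omega phi -> L2 Omega phi.
Proof.
move=> tphi; have [s _ _] := tphi.
have [M M0 phiM] := test_function_bounded_support tphi.
have M20 : 0 <= M *+ 2 by rewrite mulrn_wge0.
have pc := smooth_continuous s.
apply/Lfun2P; rewrite test_function_restrict//; split.
  exact: continuous_measurable_rV.
have cQ := cube_integrable (const_mx (- M)) M20 (continuous_sqr pc).
have := integrable_lty (measurable_cube _ _) cQ; apply: le_lt_trans.
rewrite /sqint [leRHS]integral_mkcond le_eqVlt; apply/orP; left; apply/eqP.
apply: eq_integral => x _; rewrite /patch /=; case: ifPn => // xQ.
have := cube_restrict M0 phiM => /(congr1 (fun f => f x)).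
by rewrite /patch (negbTE xQ) => <-; rewrite expr0n.
Qed.

End test_functions.

(** * Bump functions and uniqueness of weak derivatives *)

Section flat_function.
Context {R : realType}.
Implicit Types (c t : R) (m : nat).

Lemma is_derive_cvg (V W : normedModType R) (f : V -> W) a v df :
  h^-1 *: (f (h *: v + a) - f a) @[h --> 0^'] --> df -> is_derive a v f df.
Proof.
by move=> fd; apply: DeriveDef; [apply: cvgP; exact: fd|apply: cvg_lim => //; exact: fd].
Qed.

(** For fixed [c] the linear span of the [flat c m] is stable under differentiation, so smoothness
    follows for all [m] at once. The rate [c] is kept because letting it tend to 0 makes [flat c 0]
    tend to 1 on the positive axis. *)
Definition flat c m t : R := if 0 < t then t^-1 ^+ m * expR (- c * t^-1) else 0.

Lemma flat_ge0 c m t : 0 <= flat c m t.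
Proof.
rewrite /flat; case: ifP => // t0; rewrite mulr_ge0 ?expR_ge0// exprn_ge0// invr_ge0.
exact: ltW.
Qed.

Lemma flat_le0 c m t : t <= 0 -> flat c m t = 0.
Proof. by move=> t0; rewrite /flat ltNge t0. Qed.

Lemma flatS c m t : flat c m.+1 t = t^-1 * flat c m t.
Proof. by rewrite /flat; case: ifP => _; rewrite ?mulr0// exprS mulrA. Qed.

(* From [expR x >= (x / n) ^ n] with [n = m + 1] and [x = c / t]. *)
Lemma flat_le c m : 0 < c -> exists C, forall t, 0 < t -> flat c m t <= C * t.
Proof.
move=> c0; pose n : R := m.+1%:R; have n0 : 0 < n by rewrite ltr0n.
exists ((n / c) ^+ m.+1) => t t0; rewrite /flat t0.
pose x := c * t^-1; have x0 : 0 < x by rewrite mulr_gt0 ?invr_gt0.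
have ex : (x / n) ^+ m.+1 <= expR x.
  have -> : expR x = expR (x / n) ^+ m.+1.
    by rewrite -expRM_natl -/n mulrC divfK ?gt_eqF.
  have xn : 0 <= x / n by rewrite ltW// divr_gt0.
  rewrite lerXn2r ?nnegrE ?expR_ge0//.
  by apply: le_trans (expR_ge1Dx _); rewrite lerDr ler01.
have xn0 : 0 < (x / n) ^+ m.+1 by rewrite exprn_gt0 ?divr_gt0.
have -> : - c * t^-1 = - x by rewrite mulNr.
rewrite expRN.
apply: (@le_trans _ _ (t^-1 ^+ m * ((x / n) ^+ m.+1)^-1)).
  rewrite ler_wpM2l ?exprn_ge0 ?invr_ge0 ?(ltW t0)//.
  by rewrite lef_pV2 ?posrE ?expR_gt0.
rewrite -exprVn (_ : (x / n)^-1 = (n / c) * t); last by rewrite /x; field; rewrite !gt_eqF.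
rewrite (exprMn m.+1 (n / c) t) mulrCA (exprSr t m) (mulrA (t^-1 ^+ m)) -(exprMn m t^-1 t).
by rewrite mulVf ?gt_eqF// expr1n mul1r.
Qed.

Lemma is_derive_flat_gt0 c m t : 0 < t ->
  is_derive t (1 : R) (fun y => y^-1 ^+ m * expR (- c * y^-1))
    (- m%:R * (t^-1 ^+ m.+1 * expR (- c * t^-1)) + c * (t^-1 ^+ m.+2 * expR (- c * t^-1))).
Proof.
move=> t0; have tn0 : t != 0 by rewrite gt_eqF.
have dV : is_derive t (1 : R) (fun y : R => y^-1) (- t ^- 2).
  have := @is_deriveV R id t 1 1 tn0 (is_derive_id _ _).
  by move/is_derive_eq; apply; rewrite /= scaler1.
elim: m => [|m IHm].
  have dc : is_derive t (1 : R) (fun y : R => - c * y^-1) (- c * (- t ^- 2)).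
    by have := is_deriveZ (- c) dV.
  have := @is_derive1_comp R expR (fun y => - c * y^-1) t _ _ (is_derive_expR _) dc.
  rewrite (_ : _ \o _ = (fun y => y^-1 ^+ 0 * expR (- c * y^-1))); last first.
    by apply/funext => y /=; rewrite expr0 mul1r.
  by move/is_derive_eq; apply; rewrite mulr0n oppr0 mul0r add0r; field.
have := is_deriveM dV IHm.
rewrite (_ : _ * _ = (fun y => y^-1 ^+ m.+1 * expR (- c * y^-1))); last first.
  by apply/funext => y /=; rewrite fctE exprS mulrA.
move/is_derive_eq; apply; rewrite /GRing.scale/=.
by rewrite !exprS -[m.+1%:R]natr1; field.
Qed.

Lemma is_derive_flat c m t : 0 < c ->
  is_derive t (1 : R) (flat c m) (- m%:R * flat c m.+1 t + c * flat c m.+2 t).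
Proof.
move=> c0; have [t0|t0|<-] := ltgtP 0 t.
- have := is_derive_flat_gt0 c m t0; rewrite /flat t0; apply: near_eq_is_derive.
  have : \forall y \near t, 0 < y by exact: lt_nbhsr.
  by apply: filterS => y ->.
- rewrite {2 3}/flat ltNge (ltW t0)/= !mulr0 addr0.
  have := is_derive_cst (0 : R) t (1 : R); apply: near_eq_is_derive.
  have : \forall y \near t, y < 0 by exact: lt_nbhsl.
  by apply: filterS => y y0; rewrite /flat ltNge (ltW y0).
(* At 0 the difference quotient of [flat c m] is [flat c m.+1], which tends to 0 by [flat_le]. *)
- have f0 k : flat c k 0 = 0 by rewrite /flat ltxx.
  rewrite !f0 !mulr0 addr0; apply: is_derive_cvg.
  rewrite (_ : (fun h => _) = flat c m.+1); last first.
    by apply/funext => h; rewrite addr0 f0 subr0 flatS /GRing.scale/= mulr1.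
  have [C CP] := flat_le m.+1 c0.
  apply: cvg_within_filter; apply: (@squeeze_cvgr _ _ _ _ (cst 0) (fun h => `|C| * `|h|)).
  + apply: nearW => h; rewrite flat_ge0/=; have [h0|h0] := ltP 0 h.
      apply: le_trans (CP h h0) _; rewrite -normrM; exact: ler_norm.
    by rewrite /flat ltNge h0 /= mulr_ge0.
  + exact: cvg_cst.
  + rewrite -[X in _ --> X](mulr0 `|C|); apply: cvgM; first exact: cvg_cst.
    by rewrite -[X in _ --> X](normr0 R); apply: cvg_norm; exact: cvg_id.
Qed.

End flat_function.

Section bump.
Context {R : realType} {N : nat}.

Lemma is_derive_coord (g : R -> R) (x : 'rV[R]_N) i j a :
  is_derive (x ord0 i) 1 g a ->
  is_derive x (basis_rV j) (fun v => g (v ord0 i)) (if i == j then a else 0).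
Proof.
move=> dg; apply: is_derive_cvg; case: eqVneq => [<-|ij].
  have [] := dg; rewrite /derivable /derive => dg1 dg2.
  rewrite (_ : (fun h => _) = (fun h => h^-1 *: ((g \o shift (x ord0 i)) (h *: (1 : R)) - g (x ord0 i)))).
    by rewrite -dg2; exact: dg1.
  by apply/funext => h /=; rewrite !mxE !eqxx.
rewrite (_ : (fun h => _) = cst 0); first exact: cvg_cst.
by apply/funext => h; rewrite !mxE (negbTE ij) andbF mulr0 add0r subrr scaler0.
Qed.

Lemma continuous_is_derive (g : R -> R) : (forall t : R, exists a, is_derive t (1 : R) g a) ->
  continuous g.
Proof.
move=> dg t; have [a [ga _]] := dg t.
exact/differentiable_continuous/derivable1_diffP.
Qed.

(** The affine argument covers both faces of a box, [x_i - a_i] and [b_i - x_i]. The induction on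
    [k] needs all [m], since differentiating raises [m]. *)
Lemma Ck_flat k c m (s d : R) (i : 'I_N) : 0 < c ->
  Ck k (fun x : 'rV[R]_N => flat c m (s * x ord0 i + d)).
Proof.
move=> c0.
have dF n (t : R) : is_derive t (1 : R) (fun y => flat c n (s * y + d))
    ((- n%:R * flat c n.+1 (s * t + d) + c * flat c n.+2 (s * t + d)) * s).
  apply: (is_derive1_comp (is_derive_flat _ _ c0)).
  have := is_deriveD (is_deriveZ s (is_derive_id t 1)) (is_derive_cst d t 1).
  by move/is_derive_eq; apply; rewrite /GRing.scale/= mulr1 addr0.
have cF n : continuous (fun x : 'rV[R]_N => flat c n (s * x ord0 i + d)).
  move=> x; apply: (@continuous_comp _ _ _ (fun x : 'rV[R]_N => x ord0 i)
    (fun y => flat c n (s * y + d))); first exact: coord_continuous.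
  by apply: continuous_is_derive => t; eexists; exact: dF.
elim: k m => [|k IHk] m; first exact: cF.
split; first exact: cF.
move=> j; have dj (x : 'rV[R]_N) := is_derive_coord j (dF m (x ord0 i)).
split; first by move=> x; have [] := dj x.
rewrite (_ : partial j _ = (if i == j then s else 0) *:
    (- m%:R *: (fun x : 'rV[R]_N => flat c m.+1 (s * x ord0 i + d)) +
     c *: (fun x : 'rV[R]_N => flat c m.+2 (s * x ord0 i + d)))).
  by apply: CkZ; apply: CkD; apply: CkZ; exact: IHk.
apply/funext => x; have [_] := dj x; rewrite /partial => ->.
rewrite !fctE /GRing.scale/=; case: ifP => _; last by rewrite mul0r.
by rewrite mulrC.
Qed.

Lemma Ck_prod k I (s : seq I) (F : I -> 'rV[R]_N -> R) : (forall i, Ck k (F i)) ->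
  Ck k (fun x => \prod_(i <- s) F i x).
Proof.
move=> CF; elim: s => [|i s IHs].
  rewrite (_ : (fun x => _) = cst 1); first exact: Ck_cst.
  by apply/funext => x; rewrite big_nil.
rewrite (_ : (fun x => _) = F i * (fun x => \prod_(i <- s) F i x)); first exact: CkM.
by apply/funext => x; rewrite big_cons.
Qed.

Implicit Types (a b : 'I_N -> R).

Definition obox a b : set 'rV[R]_N := [set v | forall i, a i < v ord0 i < b i].
Definition cbox a b : set 'rV[R]_N := [set v | forall i, a i <= v ord0 i <= b i].

(** A product of one factor per face of the box. It vanishes outside the open box whatever [k] is,
    and the rate [k.+1%:R^-1] makes it tend to 1 inside. *)
Definition bump a b (k : nat) (x : 'rV[R]_N) : R :=
  \prod_(i < N) (flat k.+1%:R^-1 0 (1 * x ord0 i + - a i) *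
                 flat k.+1%:R^-1 0 (-1 * x ord0 i + b i)).

Lemma smooth_bump a b k : smooth (bump a b k).
Proof.
apply/smoothP => l; apply: Ck_prod => i.
by apply: (CkM (f := fun x => flat _ _ _) (g := fun x => flat _ _ _)); apply: Ck_flat; rewrite invr_gt0.
Qed.

Lemma flat0_le1 (c t : R) : 0 < c -> flat c 0 t <= 1.
Proof.
move=> c0; rewrite /flat; case: ifP => // t0; rewrite expr0 mul1r -expR0 ler_expR.
by rewrite mulNr oppr_le0 mulr_ge0 ?invr_ge0 ?ltW.
Qed.

Lemma bump_ge0 a b k x : 0 <= bump a b k x.
Proof. by apply: prodr_ge0 => i _; rewrite mulr_ge0 ?flat_ge0. Qed.

Lemma bump_le1 a b k x : bump a b k x <= 1.
Proof.
apply: prodr_ile1 => i _; rewrite mulr_ge0 ?flat_ge0//=.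
by rewrite mulr_ile1 ?flat_ge0 ?flat0_le1// invr_gt0.
Qed.

Lemma bump_out a b k x : ~ obox a b x -> bump a b k x = 0.
Proof.
move=> nx; have [i /negP nxi] : exists i, ~ a i < x ord0 i < b i by apply/existsNP.
rewrite /bump (bigD1 i)//=; move: nxi; rewrite negb_and -!leNgt => /orP[xa|bx].
  by rewrite flat_le0 ?mul0r//; lra.
by rewrite (@flat_le0 _ _ _ (-1 * x ord0 i + b i)) ?mulr0 ?mul0r//; lra.
Qed.

Lemma bump_cvg a b x : obox a b x -> bump a b k x @[k --> \oo] --> (1 : R).
Proof.
move=> xab; rewrite /bump.
have flat_cvg (t : R) : 0 < t -> flat k.+1%:R^-1 0 t @[k --> \oo] --> (1 : R).
  move=> t0; have H : expR (- k.+1%:R^-1 * t^-1) @[k --> \oo] --> expR (0 : R).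
    apply: continuous_cvg; first exact: continuous_expR.
    rewrite -[X in _ --> X](mul0r t^-1); apply: cvgM; last exact: cvg_cst.
    by rewrite -[X in _ --> X]oppr0; apply: cvgN; exact: cvg_harmonic.
  rewrite expR0 in H.
  rewrite (_ : (fun k : nat => _) = (fun k => expR (- k.+1%:R^-1 * t^-1))) //.
  by apply/funext => k; rewrite /flat t0 expr0 mul1r.
elim: (index_enum _) => [|i s IHs].
  by under eq_fun do rewrite big_nil; exact: cvg_cst.
have /andP[ax xb] := xab i.
have H : flat k.+1%:R^-1 0 (1 * x ord0 i + - a i) *
    flat k.+1%:R^-1 0 (-1 * x ord0 i + b i) *
    \prod_(j <- s) (flat k.+1%:R^-1 0 (1 * x ord0 j + - a j) *
      flat k.+1%:R^-1 0 (-1 * x ord0 j + b j)) @[k --> \oo] --> (1 * 1 * 1 : R).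
  by apply: cvgM IHs; apply: cvgM; apply: flat_cvg; lra.
by rewrite !mulr1 in H; under eq_fun do rewrite big_cons; exact: H.
Qed.

Lemma cbox_compact a b : compact (cbox a b).
Proof.
rewrite (_ : cbox a b = [set v : 'rV[R]_N | forall i, `[a i, b i]%classic (v ord0 i)]).
  by apply: (@rV_compact _ _ (fun i => `[a i, b i]%classic)) => i; exact: segment_compact.
by apply/seteqP; split=> v /= Hv i; have := Hv i; rewrite in_itv.
Qed.

Lemma test_function_bump Omega a b k : cbox a b `<=` Omega ->
  test_function Omega (bump a b k).
Proof.
move=> abO; have cl : closed (cbox a b).
  by apply: compact_closed; [exact: norm_hausdorff|exact: cbox_compact].
have sub : closure [set x | bump a b k x != 0] `<=` cbox a b.
  rewrite ((closure_id (cbox a b)).1 cl); apply: closureS => x /= bx i.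
  have : obox a b x by apply: contrapT => /(bump_out k) b0; rewrite b0 eqxx in bx.
  by move=> /(_ i)/andP[/ltW-> /ltW->].
split; first exact: smooth_bump.
  by apply: (subclosed_compact _ _ sub); [exact: closed_closure|exact: cbox_compact].
exact: subset_trans abO.
Qed.

End bump.

(** * The fundamental lemma of the calculus of variations *)

Section fundamental_lemma.
Context {R : realType} {N : nat}.
Local Notation leb := (lebesgue_rV R N).
Implicit Types (a b : 'I_N -> R).

Lemma measurable_obox a b : measurable (obox a b : set 'rV[R]_N).
Proof.
rewrite (_ : obox a b = \bigcap_(i in [set: 'I_N])
    ((fun v : 'rV[R]_N => v ord0 i) @^-1` `]a i, b i[%classic)).
  apply: fin_bigcap_measurable => // i _; rewrite -[X in measurable X]setTI.
  exact: measurable_coord.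
by apply/seteqP; split=> v /= Hv i; [move=> _|have := Hv i Logic.I]; rewrite /= in_itv/=.
Qed.

Lemma obox_ltey a b : (leb (obox a b) < +oo)%E.
Proof.
have E : leb (obox a b) = (\prod_(i < N) lebesgue_measure `]a i, b i[%classic)%E.
  have -> : obox a b = [set v : 'rV[R]_N | forall i, `]a i, b i[%classic (v ord0 i)].
    by apply/seteqP; split=> v /= Hv i; have := Hv i; rewrite /= in_itv.
  exact: lebesgue_rV_box.
have H (s : seq 'I_N) : exists2 c : R, 0 <= c &
    (\prod_(i <- s) lebesgue_measure `]a i, b i[%classic)%E = c%:E.
  elim: s => [|i s [c c0 IH]]; first by exists 1; rewrite ?big_nil.
  rewrite big_cons IH lebesgue_measure_itv/= lte_fin; case: ifP => ab.
    exists ((b i - a i) * c); last by rewrite -EFinB -EFinM.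
    by rewrite mulr_ge0// subr_ge0 ltW.
  by exists 0; rewrite ?mul0e.
by rewrite E; have [c _ ->] := H (index_enum _); rewrite ltry.
Qed.

Lemma oboxI a b a' b' : obox a b `&` obox a' b' =
  obox (fun i => Num.max (a i) (a' i)) (fun i => Num.min (b i) (b' i)) :> set 'rV[R]_N.
Proof.
apply/seteqP; split=> v.
  by move=> [H H'] i; rewrite gt_max lt_min; have /andP[-> ->] := H i; have /andP[-> ->] := H' i.
by move=> H; split=> i; have := H i; rewrite gt_max lt_min => /andP[/andP[h1 h2] /andP[h3 h4]];
  rewrite ?h1 ?h2 ?h3 ?h4.
Qed.

Lemma measurable_gen_obox (A : set 'rV[R]_N) : measurable A ->
  <<s [set obox p.1 p.2 | p in [set: ('I_N -> R) * ('I_N -> R)]] >> A.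
Proof.
pose S := <<s [set obox p.1 p.2 | p in [set: ('I_N -> R) * ('I_N -> R)]] >> : set (set 'rV[R]_N).
suff : @measurable _ 'rV[R]_N `<=` S by apply.
apply: smallest_sub; first exact: smallest_sigma_algebra.
rewrite -bigcup_seq => B [i _ [Y mY <-]]; rewrite setTI.
pose C := [set D : set R | S ((fun v : 'rV[R]_N => v ord0 i) @^-1` D)].
suff : @measurable _ (measurableTypeR R) `<=` C by apply.
rewrite RGenOpens.measurableE; apply: smallest_sub.
  split; rewrite /C /=.
  - by rewrite preimage_set0; exact: sigma_algebra0.
  - by move=> D SD; rewrite setTD preimage_setC; exact: sigma_algebraC.
  - by move=> F SF; rewrite preimage_bigcup; exact: sigma_algebra_bigcup.
move=> _ [x [y ->]]; rewrite /C/=.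
(* A slab in direction [i] is the union of boxes with side from [-k] to [k] in the other
   directions. *)
pose lo k j : R := if j == i then x else - k%:R.
pose up k j : R := if j == i then y else k%:R.
rewrite (_ : _ @^-1` _ = \bigcup_k obox (lo k) (up k)).
  by apply: sigma_algebra_bigcup => k; apply: sub_sigma_algebra; exists (lo k, up k).
apply/seteqP; split=> v.
  rewrite /= in_itv/= => xvy; exists (Num.truncn `|v|).+1 => // j.
  rewrite /lo /up; case: eqP => [->//|_]; rewrite -ltr_norml.
  by apply: le_lt_trans (normr_coord_le v j) _; exact: truncnS_gt.
by move=> [k _ /(_ i)]; rewrite /lo /up eqxx /= in_itv.
Qed.

Variable Omega : set 'rV[R]_N.
Hypothesis openO : open Omega.
Variable g : 'rV[R]_N -> R.
Hypothesis Lg : L2 Omega g.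
Hypothesis g_orth : forall phi, test_function Omega phi -> L2dot Omega g phi = 0.

Let G := g \_ Omega.

Let mG : measurable_fun setT G. Proof. by have /Lfun2P[] := Lg. Qed.

(** [|G| <= 1 + G ^ 2], and the box has finite measure. *)
Let iG a b : leb.-integrable (obox a b) (EFin \o G).
Proof.
have mD := measurable_obox a b.
have i1 : leb.-integrable (obox a b) (EFin \o cst 1).
  apply: measurable_bounded_integrable => //; [exact: obox_ltey|exact: bounded_cst].
have i2 : leb.-integrable (obox a b) (EFin \o (fun x => G x ^+ 2)).
  by apply: integrableS (Lfun2_integrable_sqr Lg).
apply: (le_integrable mD _ _ (integrableD mD i1 i2)).
  by apply: measurable_funTS; exact/measurable_EFinP.
move=> x _ /=; rewrite lee_fin [leRHS]ger0_norm ?addr_ge0 ?sqr_ge0//.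
by rewrite -[G x ^+ 2]real_normK ?num_real//; have := sqr_ge0 (`|G x| - 2^-1);
   rewrite sqrrB; lra.
Qed.

(** Dominated convergence with bound [|G|]: the bumps of the box are test functions, lie between 0
    and 1 and tend to 1 on it. *)
Let obox_int0 a b : cbox a b `<=` Omega -> (\int[leb]_(x in obox a b) (G x)%:E = 0)%E.
Proof.
move=> abO; have mD := measurable_obox a b.
have tk k := test_function_bump k abO.
pose f k x := (G x * bump a b k x)%:E.
have mb k : measurable_fun setT (bump a b k).
  by apply: continuous_measurable_rV; exact/smooth_continuous/smooth_bump.
have mf k : measurable_fun (obox a b) (f k).
  by apply: measurable_funTS; apply/measurable_EFinP; exact: measurable_funM.
have f0 k : (\int[leb]_(x in obox a b) f k x = 0)%E.
  have := g_orth (tk k); rewrite L2dotE (test_function_restrict (tk k)) => /eqP.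
  have fi := L2_integrable Lg (test_function_L2 (tk k)).
  rewrite (test_function_restrict (tk k)) in fi.
  rewrite /Rintegral fine_eq0; last exact: integrable_fin_num.
  move=> /eqP H; transitivity (\int[leb]_x ((g \_ Omega) x * bump a b k x)%:E)%E => //.
  rewrite integral_mkcond; apply: eq_integral => x _.
  rewrite /patch; case: ifPn => //; rewrite notin_setE => /(bump_out k) ->.
  by rewrite mulr0.
have [_ _] : [/\ leb.-integrable (obox a b) (EFin \o G),
   [sequence (\int[leb]_(x in obox a b) `|f n x - (G x)%:E|)%E]_n @ \oo --> 0%E &
   [sequence (\int[leb]_(x in obox a b) f n x)%E]_n @ \oo -->
     (\int[leb]_(x in obox a b) (G x)%:E)%E].
  apply: (@dominated_convergence _ _ _ _ _ mD f (EFin \o G) (fun x => `|(G x)%:E|%E)) => //.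
  - by apply: measurable_funTS; exact/measurable_EFinP.
  - apply: aeW => x Dx; apply: cvg_EFin; first exact: nearW.
    rewrite -[X in _ --> X]mulr1; apply: cvgM; [exact: cvg_cst|exact: bump_cvg].
  - exact: integrable_abse (iG a b).
  - apply: aeW => x n _; rewrite lee_fin normrM ler_piMr//.
    by rewrite ger0_norm ?bump_ge0 ?bump_le1.
under eq_fun do rewrite f0.
by move=> /cvg_lim; rewrite lim_cst// => ->.
Qed.

(** The sets over whose trace on the box [G] integrates to 0 form a Dynkin system. It contains all
    open boxes, which are stable under intersection and whose traces are again boxes with closure in
    [Omega]; so it contains every measurable set. Applied to the set where [G >= 0] and to its
    complement, this makes the integral of [|G|] over the box vanish. *)
Lemma fundamental_lemma_obox a b : cbox a b `<=` Omega ->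
  leb.-negligible (obox a b `&` [set x | G x != 0]).
Proof.
move=> abO; have mD := measurable_obox a b; set D := obox a b in mD *.
have iA (A : set 'rV[R]_N) : measurable A -> leb.-integrable (A `&` D) (EFin \o G).
  move=> mA; apply: integrableS (iG a b) => //; exact: measurableI.
pose H := [set A : set 'rV[R]_N | measurable A /\ (\int[leb]_(x in A `&` D) (G x)%:E = 0)%E].
have dH : dynkin H.
  split.
  - by split=> //; rewrite setTI; exact: obox_int0.
  - move=> A [mA A0]; split; first exact: measurableC.
    have := obox_int0 abO; rewrite -/D.
    have {1}-> : D = (A `&` D) `|` (~` A `&` D) by rewrite -setIUl setUv setTI.
    rewrite integral_setU_EFin ?A0 ?add0e//.
    + exact: measurableI.
    + by apply: measurableI => //; exact: measurableC.
    + by apply: measurable_funTS.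
    + by rewrite disj_set2E; apply/eqP; rewrite setIACA setICr set0I.
  - move=> F tF HF; split; first by apply: bigcupT_measurable => k; exact: (HF k).1.
    rewrite setI_bigcupl integral_bigcup.
    + by apply: eseries0 => k _ _; exact: (HF k).2.
    + exact: trivIset_setIr.
    + by move=> k; apply: measurableI => //; exact: (HF k).1.
    + by rewrite -setI_bigcupl; apply: iA; apply: bigcupT_measurable => k; exact: (HF k).1.
have lH : lambda_system setT H by exact/dynkin_lambda_system.
have HA A : measurable A -> H A.
  move=> /measurable_gen_obox; apply: (lambda_system_subset _ lH) => //.
  - by move=> _ _ [p _ <-] [q _ <-]; rewrite oboxI; eexists (_, _).
  - move=> _ [p _ <-]; split; first exact: measurable_obox.
    rewrite oboxI; apply: obox_int0 => v Hv; apply: abO => i.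
    by have := Hv i; rewrite ge_max le_min => /andP[/andP[_ ->] /andP[_ ->]].
have abs0 : (\int[leb]_(x in D) `|(G x)%:E| = 0)%E.
  pose P := [set x | 0 <= G x].
  have mP : measurable P.
    rewrite -[P]setTI; rewrite (_ : P = G @^-1` `[0, +oo[%classic); last first.
      by apply/seteqP; split=> x /=; rewrite in_itv/= andbT.
    exact: mG.
  have mPD := measurableI _ _ mP mD; have mCD := measurableI _ _ (measurableC mP) mD.
  have {1}-> : D = (P `&` D) `|` (~` P `&` D) by rewrite -setIUl setUv setTI.
  rewrite ge0_integral_setU//; first last.
  - by rewrite disj_set2E; apply/eqP; rewrite setIACA setICr set0I.
  - by apply: measurable_funTS; apply: measurableT_comp => //; exact/measurable_EFinP.
  rewrite (_ : (\int[leb]_(x in P `&` D) _)%E = \int[leb]_(x in P `&` D) (G x)%:E)%E; last first.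
    by apply: eq_integral => x /[!inE] -[Px _]; rewrite gee0_abs// lee_fin.
  rewrite (_ : (\int[leb]_(x in ~` P `&` D) _)%E =
      \int[leb]_(x in ~` P `&` D) ((-1)%:E * (G x)%:E))%E; last first.
    apply: eq_integral => x /[!inE] -[/negP Px _]; rewrite -ltNge in Px.
    by rewrite lee0_abs ?lee_fin ?ltW// mulN1e.
  rewrite integralZl//; last exact: iA (measurableC mP).
  by rewrite (HA _ mP).2 (HA _ (measurableC mP)).2 mule0 adde0.
have mEG : measurable_fun D (EFin \o G).
  by apply: measurable_funTS; exact/measurable_EFinP.
have := (ae_eq_integral_abs leb mD mEG).1 abs0.
move=> [M [mM M0 sM]]; exists M; split=> // x [Dx /= Gx]; apply: sM => /= /(_ Dx) [] G0.
by rewrite G0 eqxx in Gx.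
Qed.

(** Countably many boxes with rational centre and half-side, whose closures lie in [Omega], cover
    [Omega]; outside [Omega] the extension [G] is 0. *)
Lemma fundamental_lemma : leb.-negligible [set x | G x != 0].
Proof.
pose F (p : 'rV[rat]_N * rat) : set 'rV[R]_N :=
  let a i := ratr (p.1 ord0 i) - ratr p.2 in
  let b i := ratr (p.1 ord0 i) + ratr p.2 in
  if `[< cbox a b `<=` Omega >] then obox a b `&` [set x | G x != 0] else set0.
have nF p : leb.-negligible (F p).
  rewrite /F; case: ifPn => [/asboolP|_]; first exact: fundamental_lemma_obox.
  exact: negligible_set0.
pose F' n := if unpickle n is Some p then F p else set0.
have nF' n : leb.-negligible (F' n).
  by rewrite /F'; case: unpickle => //; exact: negligible_set0.
apply: negligibleS (negligible_bigcup nF') => x /= Gx.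
have Ox : Omega x.
  by apply: contrapT => nO; move: Gx; rewrite /G /patch memNset// eqxx.
have /nbhs_ballP[e /= e0 xeO] : nbhs x Omega by exact: open_nbhs_nbhs.
(* The half-side is below [e / 2] and the centre is within one half-side of [x], so the closed box
   stays within [e] of [x]. *)
have e2 : 0 < e / 2 by rewrite divr_gt0.
have [q /andP[q0 qe]] : exists q : rat, (0 < ratr q :> R) && (ratr q < e / 2).
  have [q] := rat_in_itvoo e2; rewrite in_itv /= => qe.
  by exists q.
have /choice[f fP] (i : 'I_N) : exists r : rat, `|ratr r - x ord0 i| < ratr q.
  have : x ord0 i - ratr q < x ord0 i + ratr q.
    by rewrite ltrBlDr -addrA ltrDl addr_gt0.
  move=> /rat_in_itvoo[r]; rewrite in_itv/= => /andP[r1 r2]; exists r.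
  by rewrite ltr_distl r1 r2.
exists (pickle (\row_i f i, q)) => //; rewrite /F' pickleK /F asboolT/=.
  split=> // i; rewrite mxE; have := fP i; rewrite ltr_distl => /andP[r1 r2].
  by apply/andP; split; lra.
move=> w cw; apply: xeO; split=> // i j; rewrite ord1 -ball_normE/=.
have := cw j; rewrite mxE => /andP[w1 w2]; have := fP j; rewrite !ltr_distl => /andP[r1 r2].
by apply/andP; split; lra.
Qed.

End fundamental_lemma.

(** * The spaces W^{1,2} and W^{1,2}_0 *)

Section semi_inner_cvg.
Context {R : realType} {V : lmodType R} {S : V -> Prop} {B : V -> V -> R}.
Hypothesis SB : semi_inner S B.

Lemma semi_inner_cvgl (u : nat -> V) l v : (forall n, S (u n)) -> S l -> S v ->
  semi_norm B (u n - l) @[n --> \oo] --> (0 : R) ->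
  B (u n) v @[n --> \oo] --> B l v.
Proof.
move=> Su Sl Sv ul; apply/cvgrPdist_le => /= e e0.
have e1 : 0 < e / (semi_norm B v + 1) by rewrite divr_gt0// ltr_wpDl ?semi_norm_ge0.
have /cvgrPdist_le/(_ _ e1)[k _ kP] := ul; exists k => // n /kP.
rewrite sub0r normrN ger0_norm ?semi_norm_ge0// => nk.
rewrite distrC -(semi_innerBl SB)//.
apply: le_trans (semi_inner_CS SB (semi_innerB SB (Su n) Sl) Sv) _.
apply: le_trans (ler_wpM2r (semi_norm_ge0 _ _) nk) _.
by rewrite mulrAC ler_pdivrMr ?ltr_wpDl ?semi_norm_ge0// ler_wpM2l ?(ltW e0)// lerDl.
Qed.

End semi_inner_cvg.

Lemma sum_sqr_le (R : realDomainType) I (s : seq I) (q : I -> R) :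
  (forall i, 0 <= q i) -> \sum_(i <- s) q i ^+ 2 <= (\sum_(i <- s) q i) ^+ 2.
Proof.
move=> q0; elim: s => [|i s IHs]; first by rewrite !big_nil expr0n.
rewrite !big_cons sqrrD.
have sq : 0 <= \sum_(j <- s) q j by apply: sumr_ge0 => j _; exact: q0.
have := mulr_ge0 (q0 i) sq.
by rewrite mulr2n; lra.
Qed.

Section semi_inner_constructions.
Context {R : realType} {V : lmodType R}.

Lemma semi_inner_ext (S : V -> Prop) (B B' : V -> V -> R) :
  (forall u v, S u -> S v -> B' u v = B u v) -> semi_inner S B -> semi_inner S B'.
Proof.
move=> BB SB; have [S0 SD SZ sym Dl Zl ge0] := SB; split; [exact: S0|exact: SD|exact: SZ|..].
- by move=> u v Su Sv; rewrite !BB//; exact: sym.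
- by move=> u v w Su Sv Sw; rewrite !BB//; [exact: Dl|exact: SD].
- by move=> a u v Su Sv; rewrite !BB//; [exact: Zl|exact: SZ].
- by move=> u Su; rewrite BB//; exact: ge0.
Qed.

(* The maps [D i] need only be linear up to null vectors of [B]. *)
Lemma semi_inner_graph n (S S' : V -> Prop) (B : V -> V -> R) (D : 'I_n -> V -> V) :
  semi_inner S B -> S' 0 -> (forall a u v, S' u -> S' v -> S' (a *: u + v)) ->
  (forall u, S' u -> S u) -> (forall i u, S' u -> S (D i u)) ->
  (forall i a u v w, S' u -> S' v -> S w ->
    B (D i (a *: u + v)) w = a * B (D i u) w + B (D i v) w) ->
  semi_inner S' (fun u v => B u v + \sum_(i < n) B (D i u) (D i v)).
Proof.
move=> SB S0 SL SS DS DL.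
have D0 i w : S w -> B (D i 0) w = 0.
  by move=> Sw; have := DL i (-1) 0 0 w S0 S0 Sw; rewrite scaler0 addr0 mulN1r addNr.
have SD u v : S' u -> S' v -> S' (u + v) by rewrite -{2}(scale1r u); exact: SL.
have SZ a u : S' u -> S' (a *: u) by rewrite -(addr0 (a *: u)) => Su; exact: SL.
split=> //.
- move=> u v Su Sv; congr +%R; first by apply: (semi_inner_sym SB); exact: SS.
  by apply: eq_bigr => i _; apply: (semi_inner_sym SB); exact: DS.
- move=> u v w Su Sv Sw; rewrite (semi_innerDl SB); try exact: SS.
  rewrite addrACA -big_split/=; congr +%R; apply: eq_bigr => i _.
  by rewrite -{1}(scale1r u) DL ?mul1r//; exact: DS.
- move=> a u v Su Sv; rewrite (semi_innerZl SB); try exact: SS.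
  rewrite mulrDr mulr_sumr; congr +%R; apply: eq_bigr => i _.
  have Sw := DS i _ Sv.
  by rewrite -(addr0 (a *: u)) DL// D0// addr0.
- move=> u Su; rewrite addr_ge0//; first by apply: (semi_inner_ge0 SB); exact: SS.
  by apply: sumr_ge0 => i _; apply: (semi_inner_ge0 SB); exact: DS.
Qed.

End semi_inner_constructions.

Section W12.
Context {R : realType} {N : nat} {Omega : set 'rV[R]_N}.
Hypothesis openO : open Omega.
Local Notation leb := (lebesgue_rV R N).
Local Notation B := (L2dot Omega).
Local Notation SI := (L2_semi_inner Omega).
Implicit Types u v w g phi : 'rV[R]_N -> R.

Let mO : measurable Omega. Proof. exact: open_measurable_rV. Qed.

Lemma L2_integrable_on u v : L2 Omega u -> L2 Omega v ->
  leb.-integrable Omega (EFin \o (fun x => u x * v x)).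
Proof.
move=> Lu Lv; apply/(integrable_mkcond _ mO); have := L2_integrable Lu Lv.
rewrite (_ : (EFin \o _) = (EFin \o (fun x => u x * v x)) \_ Omega)//.
by apply/funext => x; rewrite /patch /=; case: ifP => //; rewrite mulr0.
Qed.

Lemma L2dot_ae0 g v : L2 Omega g -> L2 Omega v ->
  leb.-negligible [set x | (g \_ Omega) x != 0] -> L2dot Omega g v = 0.
Proof.
move=> Lg Lv [M [mM M0 sM]]; rewrite L2dotE /Rintegral.
rewrite (ae_eq_integral (cst 0%E))//; first by rewrite integral0.
  exact: measurable_int (L2_integrable Lg Lv).
exists M; split=> // x /= nx; apply: sM => /=; apply/eqP => g0; apply: nx => _.
by rewrite g0 mul0r.
Qed.

(** Uniqueness is recorded through pairings rather than almost everywhere, since weak gradients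
    enter the Dirichlet form only through integrals. *)
Lemma weak_partial_unique i u g1 g2 v : L2 Omega g1 -> L2 Omega g2 ->
  weak_partial Omega i u g1 -> weak_partial Omega i u g2 -> L2 Omega v ->
  L2dot Omega g1 v = L2dot Omega g2 v.
Proof.
move=> L1 L2' w1 w2 Lv; apply/eqP; rewrite -subr_eq0 -(semi_innerBl SI)//; apply/eqP.
have L12 := semi_innerB SI L1 L2'.
apply: L2dot_ae0 => //; apply: (fundamental_lemma openO L12) => phi tphi.
have Lphi := test_function_L2 tphi.
by rewrite (semi_innerBl SI)//; apply/eqP; rewrite subr_eq0 -eqr_opp -w1// -w2.
Qed.

Lemma W12_L2 u : W12 Omega u -> L2 Omega u.
Proof. by case. Qed.

Lemma wgradP u i : W12 Omega u ->
  L2 Omega (wgrad Omega u i) /\ weak_partial Omega i u (wgrad Omega u i).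
Proof.
move=> [_ /(_ i)[g Lg wg]]; rewrite /wgrad.
have := @xgetPex _ (cst 0) [set g | L2 Omega g /\ weak_partial Omega i u g].
by apply; exists g.
Qed.

Lemma wgrad_L2 u i : W12 Omega u -> L2 Omega (wgrad Omega u i).
Proof. by move=> /(wgradP i)[]. Qed.

Lemma wgrad_dot u i g v : W12 Omega u -> L2 Omega g -> weak_partial Omega i u g ->
  L2 Omega v -> B (wgrad Omega u i) v = B g v.
Proof. by move=> /(wgradP i)[Lu wu] Lg wg Lv; exact: weak_partial_unique wu wg Lv. Qed.

Lemma wgrad_norm u i g : W12 Omega u -> L2 Omega g -> weak_partial Omega i u g ->
  B (wgrad Omega u i) (wgrad Omega u i) = B g g.
Proof.
move=> Wu Lg wg; have Lu := wgrad_L2 i Wu.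
by rewrite (wgrad_dot Wu Lg wg)// (semi_inner_sym SI)// (wgrad_dot Wu Lg wg).
Qed.

Lemma weak_partial_lin i a u v g h : L2 Omega u -> L2 Omega v -> L2 Omega g ->
  L2 Omega h -> weak_partial Omega i u g -> weak_partial Omega i v h ->
  weak_partial Omega i (a *: u + v) (a *: g + h).
Proof.
move=> Lu Lv Lg Lh wg wh phi tphi; have Lp := test_function_L2 tphi.
have Ldp := test_function_L2 (test_function_partial i tphi).
have Lau := semi_innerZ SI a Lu; have Lag := semi_innerZ SI a Lg.
rewrite !(semi_innerDl SI)// !(semi_innerZl SI)// wg// wh//; ring.
Qed.

Lemma weak_partialB i u v g h : L2 Omega u -> L2 Omega v -> L2 Omega g ->
  L2 Omega h -> weak_partial Omega i u g -> weak_partial Omega i v h ->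
  weak_partial Omega i (u - v) (g - h).
Proof.
move=> Lu Lv Lg Lh wg wh phi tphi; have Lp := test_function_L2 tphi.
have Ldp := test_function_L2 (test_function_partial i tphi).
by rewrite !(semi_innerBl SI)// wg// wh// opprB opprK addrC.
Qed.

Lemma W12_lin a u v : W12 Omega u -> W12 Omega v -> W12 Omega (a *: u + v).
Proof.
move=> Wu Wv; have Lu := W12_L2 Wu; have Lv := W12_L2 Wv; split.
  by apply: (semi_innerD SI) => //; exact: (semi_innerZ SI).
move=> i; have [Lg wg] := wgradP i Wu; have [Lh wh] := wgradP i Wv.
exists (a *: wgrad Omega u i + wgrad Omega v i); last exact: weak_partial_lin.
by apply: (semi_innerD SI) => //; exact: (semi_innerZ SI).
Qed.

Lemma wgrad_lin a u v w i : W12 Omega u -> W12 Omega v -> L2 Omega w ->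
  B (wgrad Omega (a *: u + v) i) w = a * B (wgrad Omega u i) w + B (wgrad Omega v i) w.
Proof.
move=> Wu Wv Lw; have [Lg wg] := wgradP i Wu; have [Lh wh] := wgradP i Wv.
have Lag := semi_innerZ SI a Lg; have La := semi_innerD SI Lag Lh.
rewrite (@wgrad_dot _ i (a *: wgrad Omega u i + wgrad Omega v i))//.
- by rewrite (semi_innerDl SI)// (semi_innerZl SI).
- exact: W12_lin.
- by apply: weak_partial_lin => //; exact: W12_L2.
Qed.

Lemma test_function_weak_partial i phi : test_function Omega phi ->
  weak_partial Omega i phi (partial i phi).
Proof. by move=> tphi psi tpsi; exact: test_function_integral_partialM. Qed.

Lemma test_function_W12 phi : test_function Omega phi -> W12 Omega phi.
Proof.
move=> tphi; split; first exact: test_function_L2.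
move=> i; exists (partial i phi); last exact: test_function_weak_partial.
exact/test_function_L2/test_function_partial.
Qed.

Lemma W12_0 : W12 Omega 0.
Proof. exact/test_function_W12/test_function0. Qed.

Lemma dirichlet_formE u v : W12 Omega u -> W12 Omega v ->
  dirichlet_form Omega u v = \sum_(i < N) B (wgrad Omega u i) (wgrad Omega v i).
Proof.
move=> Wu Wv.
have Hi (i : 'I_N) : leb.-integrable Omega
    (EFin \o (fun x => wgrad Omega u i x * wgrad Omega v i x)).
  by apply: L2_integrable_on; exact: wgrad_L2.
have [_ E] := integrable_Rintegral_sum (index_enum 'I_N) mO Hi.
by rewrite /dirichlet_form E.
Qed.

Definition Wdot u v : R := L2dot Omega u v + dirichlet_form Omega u v.

Lemma W12normE u : W12norm Omega u = semi_norm Wdot u.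
Proof. by rewrite /W12norm /semi_norm /Wdot /L2dot; under eq_Rintegral do rewrite expr2. Qed.

Local Opaque L2dot dirichlet_form wgrad.

Lemma W12_semi_inner : semi_inner (W12 Omega) Wdot.
Proof.
apply: (semi_inner_ext (B := fun u v => B u v + \sum_(i < N) B (wgrad Omega u i) (wgrad Omega v i))).
  by move=> u v Wu Wv; rewrite /Wdot (dirichlet_formE Wu Wv).
apply: (semi_inner_graph SI W12_0 W12_lin W12_L2 (D := fun i u => wgrad Omega u i)).
  by move=> i u; exact: wgrad_L2.
by move=> i a u v w; exact: wgrad_lin.
Qed.

Lemma test_function_W012 phi : test_function Omega phi -> W012 Omega phi.
Proof.
move=> tphi; split; first exact: test_function_W12.
move=> e e0; exists phi => //; rewrite W12normE (_ : phi \- phi = 0).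
  by rewrite (semi_norm0 W12_semi_inner).
by apply/funext => x /=; rewrite subrr.
Qed.

Lemma W012_semi_inner : semi_inner (W012 Omega) Wdot.
Proof.
have [W0 WD WZ Wsym Dl Zl ge0] := W12_semi_inner; have WSI := W12_semi_inner.
split.
- exact/test_function_W012/test_function0.
- move=> u v [Wu u0] [Wv v0]; split; first exact: WD.
  move=> e e0; have e2 : 0 < e / 2 by rewrite divr_gt0.
  have [phi tphi uphi] := u0 _ e2; have [psi tpsi vpsi] := v0 _ e2.
  have Wphi := test_function_W12 tphi; have Wpsi := test_function_W12 tpsi.
  exists (phi + psi); first exact: test_functionD.
  rewrite W12normE (_ : (u + v) \- (phi + psi) = (u - phi) + (v - psi)); last first.
    by apply/funext => x /=; rewrite !fctE; ring.
  have h1 : semi_norm Wdot (u - phi) < e / 2 by rewrite -W12normE; exact: uphi.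
  have h2 : semi_norm Wdot (v - psi) < e / 2 by rewrite -W12normE; exact: vpsi.
  apply: le_lt_trans (semi_normD WSI (semi_innerB WSI Wu Wphi) (semi_innerB WSI Wv Wpsi)) _.
  by rewrite [ltRHS]splitr; exact: ltrD h1 h2.
- move=> a u [Wu u0]; split; first exact: WZ.
  move=> e e0; have e2 : 0 < e / (`|a| + 1) by rewrite divr_gt0// ltr_wpDl.
  have [phi tphi uphi] := u0 _ e2; have Wphi := test_function_W12 tphi.
  exists (a *: phi); first exact: test_functionZ.
  rewrite W12normE (_ : (a *: u) \- (a *: phi) = a *: (u - phi)); last first.
    by apply/funext => x /=; rewrite !fctE scalerBr.
  rewrite (semi_normZ WSI); last exact: (semi_innerB WSI).
  move: uphi; rewrite W12normE => uphi.
  apply: (@le_lt_trans _ _ ((`|a| + 1) * semi_norm Wdot (u - phi))).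
    by rewrite ler_wpM2r ?semi_norm_ge0// lerDl.
  by rewrite mulrC -ltr_pdivlMr// ltr_wpDl.
- by move=> u v [Wu _] [Wv _]; exact: Wsym.
- by move=> u v w [Wu _] [Wv _] [Ww _]; exact: Dl.
- by move=> a u v [Wu _] [Wv _]; exact: Zl.
- by move=> u [Wu _]; exact: ge0.
Qed.

Lemma L2_le_W12 u : W12 Omega u -> semi_norm B u <= semi_norm Wdot u.
Proof.
move=> Wu; rewrite ler_wsqrtr// /Wdot lerDl dirichlet_formE//.
by apply: sumr_ge0 => i _; apply: (semi_inner_ge0 SI); exact: wgrad_L2.
Qed.

Lemma wgrad_le_W12 u i : W12 Omega u ->
  semi_norm B (wgrad Omega u i) <= semi_norm Wdot u.
Proof.
move=> Wu; rewrite ler_wsqrtr// /Wdot dirichlet_formE// (bigD1 i)//=.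
have := semi_inner_ge0 SI (W12_L2 Wu).
suff : 0 <= \sum_(j < N | j != i) B (wgrad Omega u j) (wgrad Omega u j) by lra.
by apply: sumr_ge0 => j _; apply: (semi_inner_ge0 SI); exact: wgrad_L2.
Qed.

Lemma W12_le_sum u : W12 Omega u ->
  semi_norm Wdot u <= semi_norm B u + \sum_(i < N) semi_norm B (wgrad Omega u i).
Proof.
move=> Wu; have WSI := W12_semi_inner.
pose q i := semi_norm B (wgrad Omega u i).
have q0 i : 0 <= q i by exact: semi_norm_ge0.
have sq0 : 0 <= \sum_(i < N) q i by exact: sumr_ge0.
have qu := semi_norm_ge0 B u.
have E : Wdot u u = semi_norm B u ^+ 2 + \sum_(i < N) q i ^+ 2.
  rewrite /Wdot dirichlet_formE// (sqr_semi_norm SI (W12_L2 Wu)); congr +%R.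
  by apply: eq_bigr => i _; rewrite /q (sqr_semi_norm SI (wgrad_L2 i Wu)).
rewrite -(@ler_pXn2r _ 2)// ?nnegrE ?addr_ge0 ?semi_norm_ge0//.
rewrite (sqr_semi_norm WSI Wu) E sqrrD -/q.
have := sum_sqr_le (index_enum 'I_N) q0; have := mulr_ge0 qu sq0.
by rewrite mulr2n; lra.
Qed.

(** The functions and each of their weak derivatives converge in L^2. The identity defining a weak
    derivative survives the limit because both of its sides are continuous pairings. Test functions
    near some [u k] close to the limit then approximate the limit. *)
Lemma W012_semi_complete : semi_complete (W012 Omega) Wdot.
Proof.
move=> u Wu uC; have WSI := W12_semi_inner; have W0SI := W012_semi_inner.
have W1 n : W12 Omega (u n) by have [] := Wu n.
have Lu n : L2 Omega (u n) by exact: W12_L2.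
have [l Ll ul] : exists2 l, L2 Omega l & semi_norm B (u n - l) @[n --> \oo] --> (0 : R).
  apply: L2_semi_complete => // e e0; have [k kP] := uC e e0.
  exists k => m n km kn; apply: le_lt_trans (kP m n km kn).
  by apply: L2_le_W12; exact: (semi_innerB WSI).
(* The difference of two chosen gradients need not be the chosen gradient of the difference, but the
   L^2 norms agree. *)
have wB v w i : W12 Omega v -> W12 Omega w ->
    semi_norm B (wgrad Omega v i - wgrad Omega w i) = semi_norm B (wgrad Omega (v - w) i).
  move=> Wv Ww; have [Lg wg] := wgradP i Wv; have [Lh wh] := wgradP i Ww.
  rewrite /semi_norm; congr Num.sqrt; apply/esym/wgrad_norm.
  - exact: (semi_innerB WSI).
  - exact: (semi_innerB SI).
  - by apply: weak_partialB => //; exact: W12_L2.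
have /choice[g gP] i : exists g, L2 Omega g /\
    semi_norm B (wgrad Omega (u n) i - g) @[n --> \oo] --> (0 : R).
  have [||g] := L2_semi_complete mO (u := fun n => wgrad Omega (u n) i); last by exists g.
    by move=> n; exact: wgrad_L2.
  move=> e e0; have [k kP] := uC e e0.
  exists k => m n km kn; apply: le_lt_trans (kP m n km kn); rewrite wB//.
  by apply: wgrad_le_W12; exact: (semi_innerB WSI).
have wl i : weak_partial Omega i l (g i).
  move=> phi tphi; have Lphi := test_function_L2 tphi.
  have Ldphi := test_function_L2 (test_function_partial i tphi).
  have [Lg gl] := gP i.
  have c1 := semi_inner_cvgl SI Lu Ll Ldphi ul.
  have c2 := semi_inner_cvgl SI (fun n => wgrad_L2 i (W1 n)) Lg Lphi gl.
  have c3 : - B (wgrad Omega (u n) i) phi @[n --> \oo] --> - B (g i) phi by exact: cvgN c2.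
  have E : (fun n => B (u n) (partial i phi)) = (fun n => - B (wgrad Omega (u n) i) phi).
    by apply/funext => n; have [_ ->] := wgradP i (W1 n).
  rewrite E in c1; have hR : hausdorff_space R by exact: norm_hausdorff.
  by rewrite -(cvg_lim hR c1) -(cvg_lim hR c3).
have Wl : W12 Omega l by split=> // i; exists (g i) => //; have [] := gP i.
have Wul n : W12 Omega (u n - l) by exact: (semi_innerB WSI).
have cW : semi_norm Wdot (u n - l) @[n --> \oo] --> (0 : R).
  have gE n i : semi_norm B (wgrad Omega (u n - l) i) = semi_norm B (wgrad Omega (u n) i - g i).
    have [Lg _] := gP i; have [Lh wh] := wgradP i (W1 n).
    rewrite /semi_norm; congr Num.sqrt; apply: wgrad_norm => //.
      exact: (semi_innerB SI).
    exact: weak_partialB.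
  apply: (@squeeze_cvgr _ _ _ _ (cst 0)
    (fun n => semi_norm B (u n - l) + \sum_(i < N) semi_norm B (wgrad Omega (u n) i - g i))).
  - apply: nearW => n; rewrite semi_norm_ge0/=; apply: le_trans (W12_le_sum (Wul n)) _.
    by rewrite lerD2l; apply: ler_sum => i _; rewrite gE.
  - exact: cvg_cst.
  - rewrite -[X in _ --> X](addr0 0); apply: cvgD => //.
    elim: (index_enum _) => [|i s IHs].
      by under eq_fun do rewrite big_nil; exact: cvg_cst.
    under eq_fun do rewrite big_cons.
    have := cvgD (gP i).2 IHs; rewrite addr0; exact.
exists l => //; split=> // e e0.
have e2 : 0 < e / 2 by rewrite divr_gt0.
have /cvgrPdist_lt/(_ _ e2)[k _ /(_ k (leqnn k))] := cW.
rewrite /= sub0r normrN ger0_norm ?semi_norm_ge0// => kl.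
have [phi tphi uphi] := (Wu k).2 _ e2; exists phi => //.
have Wphi := test_function_W12 tphi.
rewrite W12normE (_ : l \- phi = (l - u k) + (u k - phi)); last first.
  by apply/funext => x /=; rewrite !fctE; ring.
have h1 : semi_norm Wdot (l - u k) < e / 2.
  by rewrite (semi_norm_sub WSI Wl (W1 k)); exact: kl.
have h2 : semi_norm Wdot (u k - phi) < e / 2 by rewrite -W12normE; exact: uphi.
apply: le_lt_trans (semi_normD WSI (semi_innerB WSI Wl (W1 k)) (semi_innerB WSI (W1 k) Wphi)) _.
by rewrite [ltRHS]splitr; exact: ltrD h1 h2.
Qed.

End W12.

(** * Rellich's theorem on balls *)

Section grid.
Context {R : realType} {N : nat}.
Local Notation leb := (lebesgue_rV R N).
Variables (a h : R) (m : nat).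
Hypothesis h0 : 0 < h.

Definition grid_pt (z : {ffun 'I_N -> 'I_m}) : 'rV[R]_N := \row_i (a + h * (z i)%:R).

Definition grid_union : set 'rV[R]_N :=
  \big[setU/set0]_(z : {ffun 'I_N -> 'I_m}) cube (grid_pt z) h.

Lemma grid_trivIset (D : set {ffun 'I_N -> 'I_m}) :
  trivIset D (fun z => cube (grid_pt z) h).
Proof.
have lt_absurd (i j : nat) (x : R) : (i < j)%N -> x < a + h * i%:R + h -> a + h * j%:R <= x -> False.
  move=> ij x1 x2; have : h * (i.+1%:R) <= h * j%:R :> R by rewrite ler_pM2l// ler_nat.
  by rewrite -natr1; lra.
move=> z z' _ _ [x [Hz Hz']]; apply/ffunP => i.
have := Hz i; have := Hz' i; rewrite !in_itv/= !mxE => /andP[l1 u1] /andP[l2 u2].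
apply/val_inj; case: (ltngtP (z i) (z' i)) => // zz; exfalso.
  exact: lt_absurd zz u2 l1.
exact: lt_absurd zz u1 l2.
Qed.

Lemma measurable_grid_union : measurable grid_union.
Proof. by apply: bigsetU_measurable => z _; exact: measurable_cube. Qed.

Lemma grid_Rintegral (f : 'rV[R]_N -> R) : continuous f -> (forall x, 0 <= f x) ->
  leb.-integrable grid_union (EFin \o f) /\
  \int[leb]_(x in grid_union) f x = \sum_z \int[leb]_(x in cube (grid_pt z) h) f x.
Proof.
move=> fc f0.
have mf : measurable_fun grid_union (EFin \o f).
  by apply: measurable_funTS; apply/measurable_EFinP; exact: continuous_measurable_rV.
have E : (\int[leb]_(x in grid_union) (f x)%:E =
    (\sum_z \int[leb]_(x in cube (grid_pt z) h) f x)%:E)%E.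
  rewrite ge0_integral_bigsetU//; first last.
  - by move=> x _; rewrite lee_fin.
  - exact: grid_trivIset.
  - exact: index_enum_uniq.
  - by move=> z; exact: measurable_cube.
  rewrite -sumEFin; apply: eq_bigr => z _; rewrite /Rintegral fineK//.
  apply: integrable_fin_num; first exact: measurable_cube.
  by apply: cube_integrable => //; exact: ltW.
split; last by rewrite /Rintegral E.
apply/integrableP; split=> //; under eq_integral do rewrite /= ger0_norm//.
by rewrite E ltry.
Qed.

End grid.

(** * Poincare's inequality over a ball and its consequence for weakly null sequences *)

Section local_poincare.
Context {R : realType} {N : nat}.
Local Notation leb := (lebesgue_rV R N).

Lemma enorm_coord (x : 'rV[R]_N) i : `|x ord0 i| <= enorm x.
Proof.
rewrite /enorm -sqrtr_sqr ler_wsqrtr// (bigD1 i)//= lerDl.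
by apply: sumr_ge0 => j _; exact: sqr_ge0.
Qed.

Lemma sum_sqr_coord_continuous (s : seq 'I_N) :
  continuous (fun x : 'rV[R]_N => \sum_(i <- s) x ord0 i ^+ 2).
Proof.
elim: s => [|i s IHs].
  rewrite (_ : (fun x : 'rV[R]_N => _) = cst 0); first exact: cst_continuous.
  by apply/funext => x; rewrite big_nil.
rewrite (_ : (fun x : 'rV[R]_N => _) =
    (fun x => x ord0 i ^+ 2) \+ (fun x => \sum_(j <- s) x ord0 j ^+ 2)).
  move=> x; have ci := @coord_continuous R 1 N ord0 i x.
  exact: (cvgD (cvgM ci ci) (IHs x)).
by apply/funext => x; rewrite big_cons.
Qed.

Lemma measurable_eball (r : R) : measurable (eball r : set 'rV[R]_N).
Proof.
have me : measurable_fun setT (@enorm R N).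
  apply: continuous_measurable_rV => x.
  apply: (@continuous_comp _ _ _ (fun x : 'rV[R]_N => \sum_(i < N) x ord0 i ^+ 2) Num.sqrt);
    last exact: sqrt_continuous.
  exact: sum_sqr_coord_continuous.
rewrite (_ : eball r = @enorm R N @^-1` `]-oo, r[%classic).
  by rewrite -[X in measurable X]setTI; apply: me.
by apply/seteqP; split=> x /=; rewrite in_itv.
Qed.

(** The ball lies in the cube of side [2 * r] around 0, cut into [m] pieces per direction; the cell
    of [x] is found by truncating the rescaled coordinates [t i]. *)
Lemma eball_sub_grid (r : R) m : 0 < r -> (0 < m)%N ->
  eball r `<=` (grid_union (- r) (2 * r / m%:R) m : set 'rV[R]_N).
Proof.
move=> r0 m0 x xr; have m0' : 0 < m%:R :> R by rewrite ltr0n.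
have h0 : 0 < 2 * r / m%:R by rewrite divr_gt0// mulr_gt0.
pose t i := (x ord0 i + r) / (2 * r / m%:R).
have xi i : - r < x ord0 i < r by rewrite -ltr_norml (le_lt_trans (enorm_coord x i)).
have t0 i : 0 <= t i.
  by rewrite divr_ge0 ?(ltW h0)//; have /andP[] := xi i; lra.
have tm i : (Num.truncn (t i) < m)%N.
  rewrite -(ltr_nat R); have /andP[l _] := truncn_itv (t0 i).
  apply: le_lt_trans l _.
  rewrite ltr_pdivrMr// mulrC divfK ?gt_eqF//; have /andP[] := xi i; lra.
rewrite /grid_union -bigcup_seq; exists [ffun i => Ordinal (tm i)] => /=.
  by rewrite mem_index_enum.
move=> i; rewrite in_itv/= !mxE ffunE/=; have /andP[l u] := truncn_itv (t0 i).
have E : x ord0 i = - r + 2 * r / m%:R * t i.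
  by rewrite /t mulrC divfK ?gt_eqF//; lra.
rewrite E lerD2l -addrA ltrD2l ler_pM2l// l/=.
by rewrite -[X in _ + X]mulr1 -mulrDr natr1 ltr_pM2l.
Qed.

Variable Omega : set 'rV[R]_N.
Hypothesis openO : open Omega.

Let mO : measurable Omega. Proof. exact: open_measurable_rV. Qed.

Lemma L2S (A : set 'rV[R]_N) u : measurable A -> A `<=` Omega -> L2 Omega u ->
  L2 A u /\ L2dot A u u <= L2dot Omega u u.
Proof.
move=> mA AO Lu; have [mu uoo] := (Lfun2P _ _).1 Lu.
have E : u \_ A = (u \_ Omega) \_ A.
  apply/funext => x; rewrite /patch; case: ifPn => // /set_mem/AO Ox.
  by rewrite mem_set.
have muA : measurable_fun setT (u \_ A).
  by rewrite E; apply/measurable_restrict => //; rewrite setTI; exact: measurable_funTS.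
have le : (sqint leb (u \_ A) <= sqint leb (u \_ Omega))%E.
  apply: ge0_le_integral => //.
  - by move=> x _; rewrite lee_fin sqr_ge0.
  - exact: measurable_sqr.
  - exact: measurable_sqr.
  - by move=> x _; rewrite E lee_fin /patch; case: ifP => // _; rewrite expr0n sqr_ge0.
have LA : L2 A u by apply/Lfun2P; split=> //; exact: le_lt_trans uoo.
by split=> //; rewrite -lee_fin -!sqint_L2dot.
Qed.

Lemma L2_indic_cube (c : 'rV[R]_N) h : 0 <= h -> L2 Omega \1_(cube c h).
Proof.
move=> h0; have mQ := measurable_cube c h.
have L : L2 setT (\1_(cube c h) : 'rV[R]_N -> R).
  apply/Lfun2P; rewrite patch_setT; split; first exact: measurable_indic.
  rewrite /sqint (eq_integral (fun x => (\1_(cube c h) x)%:E)).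
    rewrite integral_indic// setIT; have := lebesgue_cube c h0 => /= ->; exact: ltry.
  by move=> x _; rewrite indicE; case: (_ \in _); rewrite ?expr1n ?expr0n.
have [mL sL] := (Lfun2P _ _).1 L; rewrite patch_setT in mL sL.
have E : (\1_(cube c h) : 'rV[R]_N -> R) \_ Omega = \1_(cube c h `&` Omega).
  apply/funext => x; rewrite /patch !indicE in_setI.
  by case: (x \in Omega); rewrite ?andbT ?andbF.
apply/Lfun2P; rewrite E; split; first by apply: measurable_indic; exact: measurableI.
apply: le_lt_trans sL; apply: ge0_le_integral => //.
- by apply: measurable_sqr; apply: measurable_indic; exact: measurableI.
- exact: measurable_sqr.
- move=> x _; rewrite lee_fin !indicE in_setI.
  by case: (_ \in cube _ _); case: (_ \in Omega); rewrite ?expr0n ?expr1n.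
Qed.

(** A mean value over a cube becomes a pairing on [Omega], even when the cube leaves [Omega],
    because [phi] vanishes outside. *)
Lemma L2dot_indic_cube (phi : 'rV[R]_N -> R) c h : test_function Omega phi ->
  L2dot Omega phi \1_(cube c h) = \int[leb]_(x in cube c h) phi x.
Proof.
move=> tphi; rewrite L2dotE test_function_restrict// [RHS]Rintegral_mkcond.
apply: eq_Rintegral => x _; rewrite /patch indicE.
case: ifPn => [_|/negP nO]; last first.
  rewrite mulr0; case: ifP => // _; apply/esym/(test_function_out tphi) => Ox.
  by apply: nO; rewrite inE.
by case: (x \in cube c h); rewrite ?mulr1 ?mulr0.
Qed.

(** Sum [cube_poincare] over a grid covering the ball. A test function is continuously
    differentiable on the whole space, so cubes that meet the boundary of [Omega] need no special
    care, and the energies on the disjoint cubes add up to at most the total energy. *)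
Lemma test_function_local_poincare (phi : 'rV[R]_N -> R) (r h : R) m :
  0 < r -> (0 < m)%N -> h = 2 * r / m%:R -> test_function Omega phi ->
  L2dot (Omega `&` eball r) phi phi <= h ^+ 2 * Wdot (Omega := Omega) phi phi +
    (h ^+ N)^-1 * \sum_(z : {ffun 'I_N -> 'I_m})
      L2dot Omega phi \1_(cube (grid_pt (- r) h z) h) ^+ 2.
Proof.
move=> r0 m0 hE tphi; have m0' : 0 < m%:R :> R by rewrite ltr0n.
have h0 : 0 < h by rewrite hE divr_gt0// mulr_gt0.
have [sphi _ _] := tphi; have fc := smooth_continuous sphi.
pose K := grid_union (N := N) (- r) h m.
have mK : measurable K by exact: measurable_grid_union.
have AK : Omega `&` eball r `<=` K by move=> x [_ xr]; rewrite /K hE; exact: eball_sub_grid.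
have mA : measurable (Omega `&` eball r) by apply: measurableI => //; exact: measurable_eball.
have [fi fE] := @grid_Rintegral R N (- r) h m h0 _ (continuous_sqr fc) (fun x => sqr_ge0 _).
have s1 : L2dot (Omega `&` eball r) phi phi <= \int[leb]_(x in K) phi x ^+ 2.
  by apply: le_Rintegral_subset => // x _; rewrite sqr_ge0.
apply: le_trans s1 _; rewrite fE.
have CP (z : {ffun 'I_N -> 'I_m}) := cube_poincare (grid_pt (- r) h z) h0 (smooth_C1 sphi).
apply: le_trans (ler_sum _ (fun z _ => CP z)) _.
rewrite big_split/= -!mulr_sumr lerD//; last first.
  rewrite ler_wpM2l ?invr_ge0 ?exprn_ge0 ?(ltW h0)//.
  by apply: ler_sum => z _; rewrite L2dot_indic_cube.
rewrite ler_wpM2l ?exprn_ge0 ?(ltW h0)// exchange_big/=.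
have Wphi := test_function_W12 tphi; have Lphi := test_function_L2 tphi.
have tp i := test_function_partial i tphi.
rewrite /Wdot dirichlet_formE//.
apply: (@le_trans _ _ (\sum_(i < N) L2dot Omega (partial i phi) (partial i phi))).
  apply: ler_sum => i _; have [sp _ _] := tp i.
  have [pi pE] := @grid_Rintegral R N (- r) h m h0 _ (continuous_sqr (smooth_continuous sp)) (fun x => sqr_ge0 _).
  have ii := L2_integrable (test_function_L2 (tp i)) (test_function_L2 (tp i)).
  rewrite -pE L2dotE test_function_restrict// in ii *.
  by apply: le_Rintegral_subset => // x _; rewrite sqr_ge0.
rewrite -[leLHS]add0r lerD//; first exact: (semi_inner_ge0 (L2_semi_inner Omega)).
apply: ler_sum => i _; rewrite (wgrad_norm openO Wphi (test_function_L2 (tp i)))//.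
exact: test_function_weak_partial.
Qed.

(** By density: both sides are limits of their values along test functions converging to [u] in
    W^{1,2}. *)
Lemma W012_local_poincare (u : 'rV[R]_N -> R) (r h : R) m :
  0 < r -> (0 < m)%N -> h = 2 * r / m%:R -> W012 Omega u ->
  semi_norm (L2dot (Omega `&` eball r)) u ^+ 2 <=
    h ^+ 2 * semi_norm (Wdot (Omega := Omega)) u ^+ 2 +
    (h ^+ N)^-1 * \sum_(z : {ffun 'I_N -> 'I_m})
      L2dot Omega u \1_(cube (grid_pt (- r) h z) h) ^+ 2.
Proof.
move=> r0 m0 hE Wu; have m0' : 0 < m%:R :> R by rewrite ltr0n.
have h0 : 0 < h by rewrite hE divr_gt0// mulr_gt0.
set A := Omega `&` eball r; have AO : A `<=` Omega by exact: subIsetl.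
have mA : measurable A by apply: measurableI => //; exact: measurable_eball.
have WSI := W12_semi_inner openO; have SI := L2_semi_inner Omega; have SA := L2_semi_inner A.
have [W1 _] := Wu; have Lu := W12_L2 W1.
have /choice[phi phiP] (n : nat) : exists phi, test_function Omega phi /\
    semi_norm (Wdot (Omega := Omega)) (u - phi) < n.+1%:R^-1.
  have [|phi tphi] := Wu.2 n.+1%:R^-1; first by rewrite invr_gt0.
  by rewrite W12normE => uphi; exists phi.
have Wp n : W12 Omega (phi n) by apply: test_function_W12; have [] := phiP n.
have Lp n : L2 Omega (phi n) by exact: W12_L2.
(* Applied to three seminorms: that of W^{1,2}, that of L^2 on [Omega] and that of L^2 on the part
   of [Omega] in the ball. The first dominates the others. *)
have norm_cvg (S : ('rV[R]_N -> R) -> Prop) B : semi_inner S B -> S u -> (forall n, S (phi n)) ->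
    (forall n, semi_norm B (u - phi n) < n.+1%:R^-1) ->
    semi_norm B (phi n - u) @[n --> \oo] --> (0 : R) /\
    semi_norm B (phi n) @[n --> \oo] --> semi_norm B u.
  move=> SB Su Sp lt.
  have c0 : semi_norm B (phi n - u) @[n --> \oo] --> (0 : R).
    apply: (@squeeze_cvgr _ _ _ _ (cst 0) (fun n => n.+1%:R^-1)); last exact: cvg_harmonic.
      by apply: nearW => n; rewrite semi_norm_ge0/= (semi_norm_sub SB (Sp n) Su) ltW.
    exact: cvg_cst.
  split=> //; apply/cvgrPdist_le => e e0; have /cvgrPdist_le/(_ _ e0)[k _ kP] := c0.
  exists k => // n /kP; rewrite sub0r normrN ger0_norm ?semi_norm_ge0// => le.
  by rewrite distrC; apply: le_trans le; exact: (semi_norm_sub_le SB (Sp n) Su).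
have [_ cW] := norm_cvg _ _ WSI W1 Wp (fun n => (phiP n).2).
have ltL n : semi_norm (L2dot Omega) (u - phi n) < n.+1%:R^-1.
  by apply: le_lt_trans (phiP n).2; apply: (L2_le_W12 openO); exact: (semi_innerB WSI).
have [cL _] := norm_cvg _ _ SI Lu Lp ltL.
have ltA n : semi_norm (L2dot A) (u - phi n) < n.+1%:R^-1.
  apply: le_lt_trans (ltL n); rewrite ler_wsqrtr//.
  by have [] := L2S mA AO (semi_innerB SI Lu (Lp n)).
have [_ cA] := norm_cvg _ _ SA (L2S mA AO Lu).1 (fun n => (L2S mA AO (Lp n)).1) ltA.
have cz (z : {ffun 'I_N -> 'I_m}) : L2dot Omega (phi n) \1_(cube (grid_pt (- r) h z) h) @[n --> \oo] -->
    L2dot Omega u \1_(cube (grid_pt (- r) h z) h).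
  by apply: (semi_inner_cvgl SI Lp Lu _ cL); apply: L2_indic_cube; exact: ltW.
have cL2 : semi_norm (L2dot A) (phi n) ^+ 2 @[n --> \oo] --> semi_norm (L2dot A) u ^+ 2.
  exact: (cvgM cA cA).
apply: (ler_cvg_to cL2 (g := fun n => h ^+ 2 * semi_norm (Wdot (Omega := Omega)) (phi n) ^+ 2 +
    (h ^+ N)^-1 * \sum_(z : {ffun 'I_N -> 'I_m})
      L2dot Omega (phi n) \1_(cube (grid_pt (- r) h z) h) ^+ 2)).
  apply: cvgD; apply: cvgM; [exact: cvg_cst|exact: (cvgM cW cW)|exact: cvg_cst|].
  elim: (index_enum _) => [|z s IHs].
    by rewrite big_nil; under eq_fun do rewrite big_nil; exact: cvg_cst.
  rewrite big_cons; under eq_fun do rewrite big_cons.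
  exact: (cvgD (cvgM (cz z) (cz z)) IHs).
apply: nearW => n; have [tp _] := phiP n.
rewrite (sqr_semi_norm SA (L2S mA AO (Lp n)).1) (sqr_semi_norm WSI (Wp n)).
exact: test_function_local_poincare.
Qed.

(** The mesh [h] is chosen from the energy bound and [e] alone. With the grid thus fixed, the
    remaining term is a finite sum of squared pairings with fixed L^2 functions, and it tends to
    0. *)
Lemma rellich (u : nat -> 'rV[R]_N -> R) C : (forall n, W012 Omega (u n)) ->
  (forall n, semi_norm (Wdot (Omega := Omega)) (u n) <= C) -> weakly_null Omega u ->
  singular_sequence Omega u.
Proof.
move=> Wu uC wu r r0; have SI := L2_semi_inner Omega.
set A := Omega `&` eball r; have AO : A `<=` Omega by exact: subIsetl.
have mA : measurable A by apply: measurableI => //; exact: measurable_eball.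
have Lu n : L2 Omega (u n) by apply: W12_L2; have [] := Wu n.
have E n : L2norm A (u n) = semi_norm (L2dot A) (u n).
  by apply: L2normE; exact: (L2S mA AO (Lu n)).1.
under eq_fun do rewrite E.
have C0 : 0 <= C := le_trans (semi_norm_ge0 _ _) (uC 0%N).
apply/cvgrPdist_le => e e0.
(* More than [M] cells per side give [h * C <= e / 2]; [C + 1] keeps [M] positive when [C = 0]. *)
pose M := 2 * (2 * r * (C + 1)) / e.
have M0 : 0 < M by rewrite divr_gt0// !mulr_gt0// ltr_wpDl.
pose m := (Num.truncn M).+1.
have mM : M < m%:R by exact: truncnS_gt.
have m0 : 0 < m%:R :> R by rewrite ltr0n.
pose h := 2 * r / m%:R; have h0 : 0 < h by rewrite divr_gt0// mulr_gt0.
have hC : h * C <= e / 2.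
  rewrite /h mulrAC ler_pdivrMr//; move: mM; rewrite /M ltr_pdivrMr// => mM.
  have : 2 * r * C <= 2 * r * (C + 1) by rewrite ler_pM2l ?mulr_gt0// lerDl.
  lra.
pose T n := (h ^+ N)^-1 * \sum_(z : {ffun 'I_N -> 'I_m})
      L2dot Omega (u n) \1_(cube (grid_pt (- r) h z) h) ^+ 2.
have T0 : T n @[n --> \oo] --> (0 : R).
  rewrite -[X in _ --> X](mulr0 (h ^+ N)^-1) /T; apply: cvgM; first exact: cvg_cst.
  elim: (index_enum _) => [|z s IHs].
    by under eq_fun do rewrite big_nil; exact: cvg_cst.
  under eq_fun do rewrite big_cons.
  have cz := wu _ (L2_indic_cube (grid_pt (- r) h z) (ltW h0)).
  have := cvgD (cvgM cz cz) IHs; rewrite mulr0 addr0; exact.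
have e2 : 0 < (e / 2) ^+ 2 by rewrite exprn_gt0// divr_gt0.
have /cvgrPdist_le/(_ _ e2)[k _ kP] := T0.
exists k => // n /kP; rewrite !sub0r !normrN [X in _ -> X <= _]ger0_norm ?semi_norm_ge0// => Tn.
rewrite -(@ler_pXn2r _ 2)// ?nnegrE ?semi_norm_ge0 ?(ltW e0)//.
apply: le_trans (W012_local_poincare (m := m) (h := h) r0 isT erefl (Wu n)) _.
rewrite -/(T n).
have h1 : h ^+ 2 * semi_norm (Wdot (Omega := Omega)) (u n) ^+ 2 <= (e / 2) ^+ 2.
  have le : h * semi_norm (Wdot (Omega := Omega)) (u n) <= e / 2.
    by apply: le_trans hC; rewrite ler_pM2l.
  rewrite -exprMn lerXn2r// nnegrE; last by rewrite divr_ge0 ?(ltW e0).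
  by rewrite mulr_ge0 ?semi_norm_ge0 ?(ltW h0).
have := le_trans (ler_norm _) Tn.
by rewrite expr_div_n in h1 *; have := exprn_gt0 2 e0; lra.
Qed.

End local_poincare.

(** * The two spectra *)

Section weak_convergence.
Context {R : realType} {N : nat} {Omega : set 'rV[R]_N}.
Hypothesis openO : open Omega.
Local Notation leb := (lebesgue_rV R N).
Local Notation B := (L2dot Omega).
Implicit Types u v g : 'rV[R]_N -> R.

Let mO : measurable Omega. Proof. exact: open_measurable_rV. Qed.

(** The part of [g] away from the origin: singularity of a sequence says nothing there, so the
    smallness has to come from [g]. *)
Definition tail g (k : nat) : 'rV[R]_N -> R := g \_ (~` eball k%:R).

Lemma tailE g k : (tail g k) \_ Omega = tail (g \_ Omega) k.
Proof. by apply/funext => x; rewrite /tail /patch; case: ifP; case: ifP. Qed.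

Lemma measurable_tail g k : measurable_fun setT g -> measurable_fun setT (tail g k).
Proof.
move=> mg; have mC : measurable (~` eball k%:R : set 'rV[R]_N).
  by apply: measurableC; exact: measurable_eball.
by apply/measurable_restrict => //; rewrite setTI; exact: measurable_funTS.
Qed.

Lemma tail_sqr_le g k x : (tail g k x) ^+ 2 <= g x ^+ 2.
Proof. by rewrite /tail /patch; case: ifP => // _; rewrite expr0n sqr_ge0. Qed.

Lemma tail_L2 g k : L2 Omega g -> L2 Omega (tail g k).
Proof.
move=> /Lfun2P[mg goo]; apply/Lfun2P; rewrite tailE; split; first exact: measurable_tail.
apply: le_lt_trans goo; apply: ge0_le_integral => //.
- by move=> x _; rewrite lee_fin sqr_ge0.
- by apply: measurable_sqr; exact: measurable_tail.
- exact: measurable_sqr.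
- by move=> x _; rewrite lee_fin; exact: tail_sqr_le.
Qed.

(** Dominated convergence with bound [g ^ 2]: each point lies in all balls of large radius. *)
Lemma tail_cvg g : L2 Omega g -> semi_norm B (tail g k) @[k --> \oo] --> (0 : R).
Proof.
move=> Lg; have [mg goo] := (Lfun2P _ _).1 Lg.
have H : (\int[leb]_x ((tail (g \_ Omega) k x) ^+ 2)%:E)%E @[k --> \oo] --> 0%E.
  have [_ _] : [/\ leb.-integrable setT (cst 0%E),
     [sequence (\int[leb]_x `|((tail (g \_ Omega) n x) ^+ 2)%:E - 0|)%E]_n @ \oo --> 0%E &
     [sequence (\int[leb]_x ((tail (g \_ Omega) n x) ^+ 2)%:E)%E]_n @ \oo -->
       (\int[leb]_x (cst 0%E x))%E].
    apply: (@dominated_convergence _ _ _ _ _ measurableT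
      (fun n x => ((tail (g \_ Omega) n x) ^+ 2)%:E) (cst 0%E)
      (fun x => (((g \_ Omega) x) ^+ 2)%:E)) => //.
    - by move=> n; apply: measurable_sqr; exact: measurable_tail.
    - apply: aeW => x _; apply: cvg_near_cst.
      exists (Num.truncn (enorm x)).+1 => // n /= xn; rewrite /tail /patch memNset ?expr0n//.
      apply; rewrite /eball/=; apply: lt_le_trans (truncnS_gt _) _.
      by rewrite ler_nat.
    - exact: Lfun2_integrable_sqr.
    - by apply: aeW => x n _; rewrite lee_fin ger0_norm ?sqr_ge0//; exact: tail_sqr_le.
  by rewrite integral0.
have E k : (\int[leb]_x ((tail (g \_ Omega) k x) ^+ 2)%:E)%E = (B (tail g k) (tail g k))%:E.
  by rewrite -sqint_L2dot ?tailE//; exact: tail_L2.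
rewrite (_ : (fun k => _) = fun k => (B (tail g k) (tail g k))%:E) in H; last exact/funext.
have {}H := fine_cvg H.
rewrite -[X in _ --> X]sqrtr0; apply: continuous_cvg; first exact: sqrt_continuous.
exact: H.
Qed.

Lemma L2dot_split u g k : L2 Omega u -> L2 Omega g ->
  B u g = L2dot (Omega `&` eball k%:R) u g + B u (tail g k).
Proof.
move=> Lu Lg; have SI := L2_semi_inner Omega; have Lt := tail_L2 k Lg.
rewrite -[g in LHS](subrK (tail g k)) (semi_innerDr SI)//; last exact: (semi_innerB SI).
congr +%R; rewrite !L2dotE; apply: eq_Rintegral => x _.
rewrite /patch in_setI; case: (x \in Omega); rewrite ?mul0r//=.
have -> : (g - tail g k) x = g x - tail g k x by [].
rewrite /tail /patch in_setC; case: (x \in eball _) => /=.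
  by rewrite subr0.
by rewrite subrr mulr0 mul0r.
Qed.

(** Inside a large ball [u n] is small by singularity; outside it [g] is small, uniformly in [n]
    since the [u n] have norm 1. *)
Lemma singular_weakly_null (u : nat -> 'rV[R]_N -> R) :
  (forall n, L2 Omega (u n)) -> (forall n, semi_norm B (u n) = 1) ->
  singular_sequence Omega u -> weakly_null Omega u.
Proof.
move=> Lu u1 su g Lg; have SI := L2_semi_inner Omega.
apply/cvgrPdist_le => e e0; have e2 : 0 < e / 2 by rewrite divr_gt0.
have /cvgrPdist_le/(_ _ e2)[k0 _ kP] := tail_cvg Lg.
(* The successor makes the radius positive, as [singular_sequence] requires. *)
pose k := k0.+1; have {kP} := kP k (leqnSn _).
rewrite /= sub0r normrN ger0_norm ?semi_norm_ge0// => tk.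
set A := Omega `&` eball k%:R.
have mA : measurable A by apply: measurableI => //; exact: measurable_eball.
have AO : A `<=` Omega by exact: subIsetl.
have SA := L2_semi_inner A.
have LA v : L2 Omega v -> L2 A v by move=> Lv; have [] := L2S mA AO Lv.
have k0' : 0 < k%:R :> R by rewrite ltr0n.
have e3 : 0 < e / 2 / (semi_norm (L2dot A) g + 1).
  by rewrite divr_gt0// ltr_wpDl ?semi_norm_ge0.
have /cvgrPdist_le/(_ _ e3)[m _ mP] := su _ k0'.
exists m => // n /mP; rewrite !sub0r !normrN L2normE; last exact: LA.
rewrite ger0_norm ?semi_norm_ge0// => un.
rewrite (L2dot_split k (Lu n) Lg); apply: le_trans (ler_normD _ _) _.
rewrite [leRHS]splitr; apply: lerD.
  apply: le_trans (semi_inner_CS SA (LA _ (Lu n)) (LA _ Lg)) _.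
  apply: le_trans (ler_wpM2r (semi_norm_ge0 _ _) un) _.
  rewrite mulrAC ler_pdivrMr ?ltr_wpDl ?semi_norm_ge0//.
  by rewrite ler_wpM2l ?(ltW e2)// lerDl.
apply: le_trans (semi_inner_CS SI (Lu n) (tail_L2 k Lg)) _.
by rewrite u1 mul1r.
Qed.

End weak_convergence.

(** * Weyl sequences and singular Palais-Smale sequences *)

Section spectra_equality.
Context {R : realType} {N : nat} {Omega : set 'rV[R]_N}.
Hypothesis openO : open Omega.
Local Notation B := (L2dot Omega).
Local Notation W := (Wdot (Omega := Omega)).
Implicit Types (u : nat -> 'rV[R]_N -> R) (lambda : R).

Lemma dirichlet_formWE (v phi : 'rV[R]_N -> R) :
  dirichlet_form Omega v phi = W v phi - B v phi.
Proof. by rewrite /Wdot addrC addKr. Qed.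

Lemma dual_norm_ge0 (T : functional) : (0 <= dual_norm Omega T)%E.
Proof.
have W0SI := W012_semi_inner openO.
apply: (@le_trans _ _ `|T 0|%:E); first by rewrite lee_fin.
apply: ereal_sup_ubound; exists 0 => //; split; first exact: (semi_inner0 W0SI).
by rewrite W12normE (semi_norm0 W0SI).
Qed.

Lemma weyl_palais_smale lambda u : weyl_sequence Omega lambda u ->
  palais_smale_sequence Omega lambda u /\ singular_sequence Omega u.
Proof.
move=> [L1 wu Wu [f [fP f0]]]; have SI := L2_semi_inner Omega.
have WSI := W12_semi_inner openO.
have Lu n : L2 Omega (u n) by have [] := L1 n.
have W1 n : W12 Omega (u n) by have [] := Wu n.
have u1 n : semi_norm B (u n) = 1 by rewrite -L2normE; have [] := L1 n.
pose g n : 'rV[R]_N -> R := f n - lambda *: u n.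
have Lf n : L2 Omega (f n) by have [] := fP n.
have Lg n : L2 Omega (g n).
  by apply: (semi_innerB SI) => //; exact: (semi_innerZ SI).
have g0 : semi_norm B (g n) @[n --> \oo] --> (0 : R).
  have E : (fun n => L2norm Omega (fun x => f n x - lambda * u n x)) =
      (fun n => semi_norm B (g n)) by apply/funext => n; exact: (L2normE (Lg n)).
  by rewrite -E.
have TE n phi : W012 Omega phi ->
    neg_laplacian Omega (u n) phi - lambda * B (u n) phi = B (g n) phi.
  move=> Wphi; have Lphi := W12_L2 Wphi.1; have [_ ->//] := fP n.
  rewrite /g (semi_innerBl SI (Lf n) (semi_innerZ SI lambda (Lu n)) Lphi).
  by rewrite (semi_innerZl SI lambda (Lu n) Lphi).
(* Testing the residual [g n] against [u n] itself yields both the limit of the energies and, below,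
   their boundedness. *)
have dE n : dirichlet_form Omega (u n) (u n) = B (g n) (u n) + lambda.
  rewrite -(TE n _ (Wu n)) -(sqr_semi_norm SI (Lu n)) u1 expr1n mulr1.
  by rewrite /neg_laplacian subrK.
have gu n : `|B (g n) (u n)| <= semi_norm B (g n).
  by apply: le_trans (semi_inner_CS SI (Lg n) (Lu n)) _; rewrite u1 mulr1.
have gu0 : B (g n) (u n) @[n --> \oo] --> (0 : R).
  apply/cvgrPdist_le => e e0; have /cvgrPdist_le/(_ _ e0)[k _ kP] := g0.
  exists k => // n /kP; rewrite !sub0r !normrN => /(le_trans (ler_norm _)).
  exact: le_trans.
split; first split.
- exact: Wu.
- by move=> n; have [] := L1 n.
- rewrite -[X in _ --> X]add0r; under eq_fun do rewrite dE.
  by apply: cvgD => //; exact: cvg_cst.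
- apply: (@squeeze_cvge _ _ _ _ (cst 0%E) _ (fun n => (semi_norm B (g n))%:E)).
  + apply: nearW => n; apply/andP; split.
      exact: dual_norm_ge0.
    apply: ge_ereal_sup => _ [phi [Wphi phi1] <-]; rewrite lee_fin (TE n _ Wphi).
    have Lphi := W12_L2 Wphi.1.
    apply: le_trans (semi_inner_CS SI (Lg n) Lphi) _.
    rewrite -[leRHS]mulr1 ler_wpM2l ?semi_norm_ge0//.
    apply: le_trans (L2_le_W12 openO Wphi.1) _.
    by rewrite -W12normE.
  + exact: cvg_cst.
  + by apply: cvg_EFin; [exact: nearW|exact: g0].
have [M [_ MP]] := cvg_seq_bounded (cvgP _ g0).
pose C := `|M| + 1.
have gC n : semi_norm B (g n) <= C.
  apply: le_trans (ler_norm _) _; apply: MP => //.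
  by rewrite (le_lt_trans (ler_norm M))// ltrDl.
(* The squared W^{1,2} norm of [u n] is 1 plus its energy, and the energy is
   [B (g n) (u n) + lambda], at most [C + lambda]. *)
apply: (rellich openO (C := Num.sqrt (1 + (C + lambda))) Wu) => // n.
rewrite /semi_norm ler_wsqrtr// /Wdot dE -(sqr_semi_norm SI (Lu n)) u1 expr1n lerD2l lerD2r.
exact: le_trans (ler_norm _) (le_trans (gu n) (gC n)).
Qed.

(** The seminorm of [phi] is not known to be positive, so [phi] is divided by the seminorm plus [e],
    and then [e] tends to 0. *)
Lemma dual_norm_le (T : functional) (d : R) (phi : 'rV[R]_N -> R) :
  (forall a psi, W012 Omega psi -> T (a *: psi) = a * T psi) ->
  (dual_norm Omega T <= d%:E)%E -> W012 Omega phi -> `|T phi| <= d * semi_norm W phi.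
Proof.
move=> TZ Td Wphi; have W0SI := W012_semi_inner openO.
have n0 := semi_norm_ge0 W phi.
have H (e : R) : 0 < e -> `|T phi| <= d * (semi_norm W phi + e).
  move=> e0; set s := _ + e; have s0 : 0 < s by rewrite ltr_wpDl.
  have Wp := semi_innerZ W0SI s^-1 Wphi.
  have : (`|T (s^-1 *: phi)|%:E <= d%:E)%E.
    apply: le_trans Td; apply: ereal_sup_ubound; exists (s^-1 *: phi) => //; split=> //.
    rewrite W12normE (semi_normZ W0SI _ Wphi) ger0_norm ?invr_ge0 ?(ltW s0)//.
    by rewrite mulrC ler_pdivrMr// mul1r lerDl ltW.
  rewrite lee_fin TZ// normrM ger0_norm ?invr_ge0 ?(ltW s0)//.
  by rewrite mulrC ler_pdivrMr.
have d0 : 0 <= d by rewrite -lee_fin; exact: le_trans (dual_norm_ge0 T) Td.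
apply/ler_addgt0Pr => e e0; apply: le_trans (H (e / (d + 1)) _) _.
  by rewrite divr_gt0// ltr_wpDl.
rewrite mulrDr lerD2l mulrC mulrAC ler_pdivrMr ?ltr_wpDl//.
by rewrite ler_wpM2l ?(ltW e0)// lerDl.
Qed.

(* The solution [v] of [- Delta v + v = (1 + lambda) u] differs from [u] by the
   Riesz representative of [- T]. *)
Lemma palais_smale_weyl lambda u : palais_smale_sequence Omega lambda u ->
  singular_sequence Omega u -> ess_spectrum Omega lambda.
Proof.
move=> [Wu u1' _ dual0] su; have SI := L2_semi_inner Omega.
have WSI := W12_semi_inner openO; have W0SI := W012_semi_inner openO.
have W1 n : W12 Omega (u n) by have [] := Wu n.
have Lu n : L2 Omega (u n) by exact: W12_L2.
have u1 n : semi_norm B (u n) = 1 by rewrite -L2normE.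
have wu := singular_weakly_null openO Lu u1 su.
pose T n : functional := fun phi => neg_laplacian Omega (u n) phi - lambda * B (u n) phi.
have /choice[v vP] n : exists v, W012 Omega v /\
    forall w, W012 Omega w -> W v w = (1 + lambda) * B (u n) w.
  have [|||v Wv vE] := semi_inner_riesz W0SI (F := fun w => (1 + lambda) * B (u n) w)
      (C := `|1 + lambda|) (W012_semi_complete openO); last by exists v.
  - by move=> w w' Ww Ww'; rewrite (semi_innerDr SI (W12_L2 Ww.1) (W12_L2 Ww'.1) (Lu n)) mulrDr.
  - by move=> a w Ww; rewrite (semi_innerZr SI a (W12_L2 Ww.1) (Lu n)) mulrCA.
  - move=> w Ww; rewrite normrM ler_wpM2l//.
    apply: le_trans (semi_inner_CS SI (Lu n) (W12_L2 Ww.1)) _.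
    by rewrite u1 mul1r; exact: (L2_le_W12 openO Ww.1).
have Wv n : W012 Omega (v n) by have [] := vP n.
have Lv n : L2 Omega (v n) by exact: (W12_L2 (Wv n).1).
pose w n : 'rV[R]_N -> R := v n - u n.
have Ww n : W012 Omega (w n) by exact: (semi_innerB W0SI).
have Lw n : L2 Omega (w n) by exact: (W12_L2 (Ww n).1).
(* The form [W] of [u n] at [phi] is [T n phi + (1 + lambda) * B (u n) phi]; the second term is what
   [v n] was made to match. *)
have wT n phi : W012 Omega phi -> W (w n) phi = - T n phi.
  move=> Wphi; rewrite (semi_innerBl W0SI (Wv n) (Wu n) Wphi) (vP n).2//.
  by rewrite /T /neg_laplacian dirichlet_formWE; ring.
have TZ n a psi : W012 Omega psi -> T n (a *: psi) = a * T n psi.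
  move=> Wpsi; have Wap := semi_innerZ W0SI a Wpsi.
  apply: oppr_inj; rewrite -(wT n _ Wap) (semi_innerZr W0SI a Wpsi (Ww n)) wT//.
  by rewrite mulrN.
(* Testing against [w n] itself: [semi_norm W (w n) ^ 2 = - T n (w n) <= d * semi_norm W (w n)]. *)
have w_le n d : (dual_norm Omega (T n) <= d%:E)%E -> semi_norm W (w n) <= d.
  move=> Td; have := dual_norm_le (TZ n) Td (Ww n).
  have := sqr_semi_norm W0SI (Ww n); rewrite wT// => E.
  rewrite -normrN -E ger0_norm ?sqr_ge0//.
  have [->|n0] := eqVneq (semi_norm W (w n)) 0.
    by move=> _; rewrite -lee_fin; exact: le_trans (dual_norm_ge0 _) Td.
  by rewrite expr2 ler_pM2r// lt_neqAle eq_sym n0 semi_norm_ge0.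
have w0 : semi_norm W (w n) @[n --> \oo] --> (0 : R).
  apply/cvgrPdist_le => e e0.
  have : \forall n \near \oo, (dual_norm Omega (T n) < e%:E)%E.
    have n0 : nbhs (0 : \bar R)%E [set y | (y < e%:E)%E].
      by apply: open_nbhs_nbhs; split; [exact: open_ereal_lt_ereal|rewrite /= lte_fin].
    exact: dual0 n0.
  move=> [k _ kP]; exists k => // n /kP/ltW/w_le.
  by rewrite sub0r normrN ger0_norm ?semi_norm_ge0.
have wB n : semi_norm B (w n) <= semi_norm W (w n) by exact: (L2_le_W12 openO (Ww n).1).
pose s n := semi_norm B (v n).
have s_ge n : 1 - semi_norm W (w n) <= s n.
  have := semi_norm_sub_le SI (Lv n) (Lu n); rewrite u1 -/(s n) ler_norml => /andP[h _].
  by have := wB n; rewrite /w in h *; lra.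
(* Since [v n] approaches functions of norm 1, its norm is eventually at least 1/2. Shifting the
   index by [k] allows division by it, with inverses bounded by 2. *)
have [k kP] : exists k, forall n, (k <= n)%N -> 2^-1 <= s n.
  have h0 : (0 : R) < 2^-1 by rewrite invr_gt0.
  have /cvgrPdist_le/(_ _ h0)[k _ kP] := w0; exists k => n /kP.
  rewrite sub0r normrN ger0_norm ?semi_norm_ge0// => le; have := s_ge n; lra.
have s0 n : 0 < s (n + k)%N.
  by apply: lt_le_trans (kP _ (leq_addl _ _)); rewrite invr_gt0.
have si n : `|(s (n + k)%N)^-1| <= 2.
  rewrite ger0_norm ?invr_ge0 ?(ltW (s0 n))// -[2]invrK.
  by rewrite lef_pV2 ?posrE ?invr_gt0// kP// leq_addl.
have w0k : semi_norm W (w (n + k)%N) @[n --> \oo] --> (0 : R).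
  by rewrite (cvg_shiftn k (fun n => semi_norm W (w n))).
pose y n : 'rV[R]_N -> R := (s (n + k)%N)^-1 *: v (n + k)%N.
have Ly n : L2 Omega (y n) by exact: (semi_innerZ SI).
have Wy n : W012 Omega (y n) by exact: (semi_innerZ W0SI).
exists y; split.
- move=> n; split; first exact: Ly.
  rewrite (L2normE (Ly n)) (semi_normZ SI _ (Lv _)) -/(s (n + k)%N).
  by rewrite ger0_norm ?invr_ge0 ?(ltW (s0 n))// mulVf// gt_eqF.
- move=> g Lg.
  have gE n : B (y n) g = (s (n + k)%N)^-1 * (B (u (n + k)%N) g + B (w (n + k)%N) g).
    rewrite (semi_innerZl SI _ (Lv _) Lg); congr (_ * _).
    by rewrite (semi_innerBl SI (Lv _) (Lu _) Lg); ring.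
  have c0 : 2 * (`|B (u (n + k)%N) g| + semi_norm W (w (n + k)%N) * semi_norm B g)
      @[n --> \oo] --> (0 : R).
    rewrite (_ : 0 = 2 * (`|0 : R| + 0 * semi_norm B g) :> R); last first.
      by rewrite normr0 mul0r addr0 mulr0.
    apply: cvgM; first exact: cvg_cst.
    apply: cvgD; last by apply: cvgM => //; exact: cvg_cst.
    by apply: cvg_norm; rewrite (cvg_shiftn k (fun n => B (u n) g)); exact: wu.
  apply/cvgrPdist_le => e e0; have /cvgrPdist_le/(_ _ e0)[m _ mP] := c0.
  exists m => // n /mP; rewrite !sub0r !normrN => /(le_trans (ler_norm _)).
  apply: le_trans; rewrite gE normrM ler_pM//.
  apply: le_trans (ler_normD _ _) _; rewrite lerD2l.
  apply: le_trans (semi_inner_CS SI (Lw _) Lg) _.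
  by rewrite ler_wpM2r ?semi_norm_ge0.
- exact: Wy.
(* The equation for [v] reads - Delta v = (1 + lambda) u - v. Subtracting lambda v leaves - (1 +
   lambda) w, so the residual of [y n] is a bounded multiple of [w (n + k)]. *)
- pose f n : 'rV[R]_N -> R := (s (n + k)%N)^-1 *: ((1 + lambda) *: u (n + k)%N - v (n + k)%N).
  have Lf' n : L2 Omega ((1 + lambda) *: u n - v n).
    by apply: (semi_innerB SI) => //; exact: (semi_innerZ SI).
  have Lf n : L2 Omega (f n) by exact: (semi_innerZ SI).
  exists f; split.
    move=> n; split; first exact: Lf.
    move=> phi Wphi; have Lphi := W12_L2 Wphi.1.
    rewrite /neg_laplacian dirichlet_formWE (semi_innerZl W0SI _ (Wv _) Wphi).
    rewrite (semi_innerZl SI _ (Lv _) Lphi) (semi_innerZl SI _ (Lf' _) Lphi).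
    rewrite (semi_innerBl SI (semi_innerZ SI _ (Lu _)) (Lv _) Lphi).
    by rewrite (semi_innerZl SI _ (Lu _) Lphi) (vP _).2// mulrBr.
  have E n : L2norm Omega (fun x => f n x - lambda * y n x) =
      `|(s (n + k)%N)^-1 * - (1 + lambda)| * semi_norm B (w (n + k)%N).
    rewrite -(semi_normZ SI _ (Lw _)).
    rewrite (_ : (fun x => _) = ((s (n + k)%N)^-1 * - (1 + lambda)) *: w (n + k)%N).
      by apply: L2normE; exact: (semi_innerZ SI).
    apply/funext => x; rewrite /f /y /w !fctE /GRing.scale/=; ring.
  have c0 : (2 * `|1 + lambda|) * semi_norm W (w (n + k)%N) @[n --> \oo] --> (0 : R).
    by rewrite -[X in _ --> X](mulr0 (2 * `|1 + lambda|)); apply: cvgM => //; exact: cvg_cst.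
  apply: (@squeeze_cvgr _ _ _ _ (cst 0) (fun n => (2 * `|1 + lambda|) * semi_norm W (w (n + k)%N))) => //.
    apply: nearW => n; rewrite E mulr_ge0 ?semi_norm_ge0//=.
    by apply: ler_pM => //; [exact: semi_norm_ge0|rewrite normrM normrN ler_wpM2r].
  exact: cvg_cst.
Qed.

End spectra_equality.

Theorem theorem4p2 (R : realType) (N : nat) (Omega : set 'rV[R]_N)
    (openOmega : open Omega) :
  vess_spectrum2 Omega = ess_spectrum Omega.
Proof.
apply/seteqP; split=> lambda.
  by move=> [u psu su]; exact: (palais_smale_weyl openOmega psu su).
move=> [u wu]; have [psu su] := weyl_palais_smale openOmega wu.
by exists u.
Qed.
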